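(* Let $\mathbf Z$ be an AV-bundle over $M$. (a) A section $\Lambda\in\mathrm{Sec}(\bigwedge^2\widetilde{\mathsf T}\mathbf Z)$ represents an aff-Poisson structure on $\mathbf Z$ if and only if $[\![\Lambda,\Lambda]\!]_{\widetilde{\mathsf T}\mathbf Z}=0$. (b) A section $\mathcal J\in\mathrm{Sec}(\bigwedge^2\widetilde{\mathsf L}\mathbf Z)$ represents an aff-Jacobi structure on $\mathbf Z$ if and only if $[\![\mathcal J,\mathcal J]\!]^{\phi^0}_{\widetilde{\mathsf L}\mathbf Z}=0$.
   Context: An AV-bundle $\zeta:\mathbf Z\to M$ is a rank-one affine bundle modelled on $M\times\mathbb R$ (equivalently a principal $(\mathbb R,+)$-bundle). $X_{\mathbf Z}$ is the vertical vector field on $\mathbf Z$ with flow $z\mapsto z-t$; in local affine coordinates $(x^a,s)$ it is $-\partial_s$. For a section $\sigma$, $\mathbf F_\sigma\in C^\infty(\mathbf Z)$ is $\mathbf F_\sigma(z)=\sigma(\zeta(z))-z$. $\widetilde{\mathsf T}\mathbf Z=T\mathbf Z/\mathbb R$ is the vector bundle over $M$ whose sections are the vector fields on $\mathbf Z$ commuting with $X_{\mathbf Z}$ (locally $f_a(x)\partial_{x^a}-\beta(x)\partial_s$). $\widetilde{\mathsf L}\mathbf Z$ is the vector bundle over $M$ whose sections are the first-order differential operators on $C^\infty(\mathbf Z)$ locally of the form $D=f_a(x)\partial_{x^a}-(\alpha(x)s+\beta(x))\partial_s+\alpha(x)$. Both are Lie algebroids over $M$ with commutator bracket and anchor $f_a\partial_{x^a}$.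 On $\widetilde{\mathsf L}\mathbf Z$ there is the closed 1-form $\phi^0\in\mathrm{Sec}((\widetilde{\mathsf L}\mathbf Z)^* )$, $[D,X_{\mathbf Z}]=\phi^0(D)X_{\mathbf Z}$, locally $\phi^0(D)=\alpha$. A section $D$ of either bundle acts on sections of $\mathbf Z$: $D(\sigma)\in C^\infty(M)$ is defined by $D(\sigma)\circ\zeta=D(\mathbf F_\sigma)$ (locally $f_a\partial_{x^a}\sigma+\alpha\sigma+\beta$, with $\alpha=0$ for $\widetilde{\mathsf T}\mathbf Z$). The maps $\sigma\mapsto D(\sigma)$ with $D\in\mathrm{Sec}(\widetilde{\mathsf T}\mathbf Z)$ (resp. $D\in\mathrm{Sec}(\widetilde{\mathsf L}\mathbf Z)$) are exactly the affine derivations (resp. affine first-order differential operators) $\mathrm{Sec}(\mathbf Z)\to C^\infty(M)$. An aff-Poisson (resp. aff-Jacobi) bracket on $\mathbf Z$ is a bi-affine skew-symmetric map $\{\cdot,\cdot\}:\mathrm{Sec}(\mathbf Z)\times\mathrm{Sec}(\mathbf Z)\to C^\infty(M)$ such that $\{\sigma_1,\{\sigma_2,\sigma_3\}\}^2_{\mathsf v}+\{\sigma_2,\{\sigma_3,\sigma_1\}\}^2_{\mathsf v}+\{\sigma_3,\{\sigma_1,\sigma_2\}\}^2_{\mathsf v}=0$, where $\{\sigma,f\}^2_{\mathsf v}=\{\sigma,\sigma'+f\}-\{\sigma,\sigma'\}$ for $f\in C^\infty(M)$, and such that $\{\sigma,\cdot\}$ is an affine derivation (resp. affine first-order differential operator)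 for every $\sigma$. A section of $\bigwedge^2\widetilde{\mathsf T}\mathbf Z$ or $\bigwedge^2\widetilde{\mathsf L}\mathbf Z$ induces the skew-symmetric bracket on $\mathrm{Sec}(\mathbf Z)$ determined by $(D\wedge D')(\sigma,\sigma')=D(\sigma)D'(\sigma')-D(\sigma')D'(\sigma)$; it ''represents an aff-Poisson (aff-Jacobi) structure'' if this bracket is aff-Poisson (aff-Jacobi). $[\![\cdot,\cdot]\!]_E$ denotes the Lie algebroid Schouten bracket on $\mathrm{Sec}(\bigwedge^\bullet E)$, with $[\![X_1\wedge\dots\wedge X_p,Y_1\wedge\dots\wedge Y_q]\!]_E=\sum_{i,j}(-1)^{i+j}[X_i,Y_j]\wedge X_1\wedge\dots\widehat{X_i}\dots\wedge X_p\wedge Y_1\wedge\dots\widehat{Y_j}\dots\wedge Y_q$. For a closed 1-form $\phi$ on $E$ the Schouten–Jacobi bracket is $[\![X,Y]\!]^\phi_E=[\![X,Y]\!]_E+(p-1)X\wedge i_\phi Y-(-1)^{p-1}(q-1)\,i_\phi X\wedge Y$ for $X,Y$ of degrees $p,q$, where $i_\phi$ is the left contraction, $i_\phi(X\wedge Y)=\phi(X)Y-\phi(Y)X$ for $X,Y\in\mathrm{Sec}(E)$. *)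

(* Defs.v *)
From HB Require Import structures.
From mathcomp Require Import all_boot all_order all_algebra perm.
From mathcomp Require Import all_classical all_reals all_analysis.

Set Implicit Arguments.
Unset Strict Implicit.
Unset Printing Implicit Defensive.

Import Order.TTheory GRing.Theory Num.Theory.
Import numFieldNormedType.Exports.
Local Open Scope classical_set_scope.
Local Open Scope ring_scope.

(* Conventions.  An operator on a set A of functions (smooth functions, or
   sections of a bundle) is a total function that is required to vanish outside
   A; two such operators agreeing on A are then equal, and the composite of two
   operators preserving A is again one. *)

Section SmoothOnRn.
Context (R : realType) (n : nat).

Definition basis_vec (i : 'I_n) : 'rV[R]_n := delta_mx 0 i.

Definition partial (i : 'I_n) (f : 'rV[R]_n -> R) : 'rV[R]_n -> R :=
  fun v => 'D_(basis_vec i) f v.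

(* V is meant to be open: only the germs of f at the points of V matter. *)
Fixpoint Ck (k : nat) (V : set 'rV[R]_n) (f : 'rV[R]_n -> R) : Prop :=
  (forall v, V v -> {for v, continuous f}) /\
  (if k is k'.+1 then
     forall i, (forall v, V v -> derivable f v (basis_vec i)) /\
               Ck k' V (partial i f)
   else True).

Definition smooth_on (V : set 'rV[R]_n) (f : 'rV[R]_n -> R) :=
  forall k, Ck k V f.

End SmoothOnRn.

Record chart (R : realType) (T : topologicalType) (n : nat) := Chart {
  cdom : set T;
  cmap : T -> 'rV[R]_n;
  cinv : 'rV[R]_n -> T;
  cdom_open : open cdom;
  cimg_open : open (cmap @` cdom);
  cmapK : forall p, cdom p -> cinv (cmap p) = p;
  cmap_continuous : forall p, cdom p -> {for p, continuous cmap};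
  cinv_continuous : forall v, (cmap @` cdom) v -> {for v, continuous cinv}
}.

Definition cimg (R : realType) (T : topologicalType) n (c : chart R T n) :
  set 'rV[R]_n := cmap c @` cdom c.

Definition smooth_transition (R : realType) (T : topologicalType) n
    (c c' : chart R T n) :=
  forall i, smooth_on (cmap c @` (cdom c `&` cdom c'))
                      (fun v => cmap c' (cinv c v) 0 i).

Record manifold (R : realType) (n : nat) := Manifold {
  mcarrier :> topologicalType;
  atlas : set (chart R mcarrier n);
  manifold_hausdorff : hausdorff_space mcarrier;
  manifold_second_countable : @second_countable mcarrier;
  atlas_cover : forall p : mcarrier, exists2 c, atlas c & cdom c p;
  atlas_compat : forall c c', atlas c -> atlas c' -> smooth_transition c c'
}.

Definition max_atlas (R : realType) n (M : manifold R n) : set (chart R M n) :=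
  [set c | forall c', atlas c' ->
             smooth_transition c c' /\ smooth_transition c' c].

Definition Cinf (R : realType) n (M : manifold R n) : set (M -> R) :=
  [set f : M -> R | forall c : chart R M n,
     atlas c -> smooth_on (cimg c) (f \o cinv c)].

Definition smooth_map (R : realType) m n (M : manifold R m) (N : manifold R n)
    (f : M -> N) :=
  continuous f /\
  forall c c', atlas c -> atlas c' ->
    forall i, smooth_on (cmap c @` (cdom c `&` f @^-1` cdom c'))
                        (fun v => cmap c' (f (cinv c v)) 0 i).

Section LocalAffineCoordinates.
Context (R : realType) (n : nat) (M : manifold R n) (T : manifold R (n + 1)).
Context (proj : T -> M) (av_add : T -> R -> T).

(* cz is the chart (x^a, s) of T induced by the chart c = (x^a) of M and by a
   fibre coordinate s with s (z + t) = s z + t; s is the last coordinate of cz.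
   Its domain is the full preimage of that of c. *)
Definition affine_coordinates (c : chart R M n) (cz : chart R T (n + 1)) :=
  [/\ max_atlas c, max_atlas cz, cdom cz = proj @^-1` cdom c &
      forall z, cdom cz z ->
        lsubmx (cmap cz z) = cmap c (proj z) /\
        forall t, cmap cz (av_add z t) = cmap cz z + row_mx 0 t%:M].

End LocalAffineCoordinates.

(* A rank-one affine bundle modelled on M x R: av_add z t is z + t, and av_sub z' z
   is z' - z, of which only the values at points of a common fibre matter.
   Smoothness of the projection and of the action follows from local
   triviality. *)
Record AVbundle (R : realType) (n : nat) (M : manifold R n) := AVBundle {
  total :> manifold R (n + 1);
  zeta : total -> M;
  av_add : total -> R -> total;
  av_sub : total -> total -> R;
  zeta_surj : forall x, exists z, zeta z = x;
  zeta_av_add : forall z t, zeta (av_add z t) = zeta z;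
  av_add0 : forall z, av_add z 0 = z;
  av_addD : forall z t u, av_add z (t + u) = av_add (av_add z t) u;
  av_addK : forall z t, av_sub (av_add z t) z = t;
  av_subK : forall z z', zeta z = zeta z' -> av_add z (av_sub z' z) = z';
  locally_trivial : forall x, exists c, exists2 cz,
    cdom c x & affine_coordinates zeta av_add c cz
}.

Section AVGeometry.
Context (R : realType) (n : nat) (M : manifold R n) (Z : AVbundle M).

Definition affine_coords (c : chart R M n) (cz : chart R Z (n + 1)) :=
  affine_coordinates (@zeta _ _ _ Z) (@av_add _ _ _ Z) c cz.

Definition Sec : set (M -> Z) :=
  [set sigma | (forall x, zeta (sigma x) = x) /\ smooth_map sigma].

Definition sec_add (sigma : M -> Z) (f : M -> R) : M -> Z :=
  fun x => av_add (sigma x) (f x).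

Definition Fsec (sigma : M -> Z) : Z -> R :=
  fun z => av_sub (sigma (zeta z)) z.

Definition op := (Z -> R) -> Z -> R.

Definition XZ : op := fun g z => derive1 (fun t : R => g (av_add z (- t))) 0.

Definition commutator (D D' : op) : op :=
  fun g z => D (D' g) z - D' (D g) z.

Definition Cinf_op : set op :=
  [set D | (forall g, Cinf g -> Cinf (D g)) /\
           (forall g, ~ Cinf g -> D g = cst 0)].

Definition vector_field : set op :=
  [set D | Cinf_op D /\
    forall c : chart R Z (n + 1), atlas c ->
      exists2 a : 'I_(n + 1) -> 'rV[R]_(n + 1) -> R,
        forall i, smooth_on (cimg c) (a i) &
        forall g, Cinf g -> forall v, cimg c v ->
          D g (cinv c v) = \sum_i a i v * partial i (g \o cinv c) v].

Definition secT : set op :=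
  [set D | vector_field D /\ forall g, Cinf g -> D (XZ g) = XZ (D g)].

(* In affine coordinates w = (x, s), D is
   f_a(x) d/dx^a - (alpha(x) s + beta(x)) d/ds + alpha(x); this shape does not
   depend on the choice of the affine coordinates. *)
Definition secL : set op :=
  [set D | Cinf_op D /\
    forall c cz, affine_coords c cz ->
      exists (f : 'I_n -> 'rV[R]_n -> R) (alpha beta : 'rV[R]_n -> R),
        [/\ forall a, smooth_on (cimg c) (f a),
            smooth_on (cimg c) alpha, smooth_on (cimg c) beta &
            forall g, Cinf g -> forall w, cimg cz w ->
              let x := lsubmx w in
              let s := rsubmx w 0 0 in
              let G := g \o cinv cz in
              D g (cinv cz w) =
                \sum_(a < n) f a x * partial (lshift 1 a) G w
                - (alpha x * s + beta x) * partial (rshift n ord0) G w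
                + alpha x * G w]].

(* D(sigma) o zeta = D(F_sigma): as D(F_sigma) is constant on the fibres, it may
   be evaluated at the point sigma x of the fibre over x. *)
Definition act (D : op) (sigma : M -> Z) : M -> R :=
  fun x => D (Fsec sigma) (sigma x).

Section Multisections.
(* E is the set of sections, seen as operators, of a vector bundle over M. *)
Context (E : set op).

Definition op_comb (f : M -> R) (D : op) (f' : M -> R) (D' : op) : op :=
  fun g z => f (zeta z) * D g z + f' (zeta z) * D' g z.

Definition dform := op -> M -> R.

(* Sections of the dual bundle: C^oo(M)-linear maps from E to C^oo(M). *)
Definition dual_sec : set dform :=
  [set theta |
    [/\ forall D, E D -> Cinf (theta D),
        forall D, ~ E D -> theta D = cst 0 &
        forall f D f' D', Cinf f -> Cinf f' -> E D -> E D' -> forall x,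
          theta (op_comb f D f' D') x = f x * theta D x + f' x * theta D' x]].

(* Multisections of degree k are functions of k sections of the dual bundle;
   only their values on dual_secs k are relevant. *)
Definition multi k := ('I_k -> dform) -> M -> R.

Definition dual_secs k : set ('I_k -> dform) :=
  [set theta | forall i, dual_sec (theta i)].

(* Sections of the k-th exterior power of the bundle, as alternating
   C^oo(M)-multilinear functions on the sections of the dual bundle. *)
Definition multisection k : set (multi k) :=
  [set P |
    [/\ forall theta, dual_secs theta -> Cinf (P theta),
        forall theta i f eta f' eta', dual_secs theta ->
          Cinf f -> Cinf f' -> dual_sec eta -> dual_sec eta' -> forall x,
          P [eta theta with i |-> fun D y => f y * eta D y + f' y * eta' D y] x
          = f x * P [eta theta with i |-> eta] x
            + f' x * P [eta theta with i |-> eta'] x &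
        forall theta i j, dual_secs theta -> i != j -> theta i = theta j ->
          P theta = cst 0]].

Definition multi_zero k (P : multi k) :=
  forall theta, dual_secs theta -> forall x, P theta x = 0.

(* X_1 /\ ... /\ X_k, normalized so that
   (X /\ Y)(theta, eta) = theta(X) eta(Y) - theta(Y) eta(X). *)
Definition wedge_sec k (X : seq op) : multi k := fun theta x =>
  \det (\matrix_(i < k, j < k) theta i (nth (fun _ => cst 0) X j) x).

Definition multi_wedge p q (P : multi p) (Q : multi q) : multi (p + q) :=
  fun theta x => (p`! * q`!)%:R^-1 *
    \sum_(s : 'S_(p + q)) (-1) ^+ s
       * P (fun i => theta (s (lshift q i))) x
       * Q (fun j => theta (s (rshift p j))) x.

Definition contraction (phi : dform) p (P : multi p.+1) : multi p :=
  fun theta => P (fun i => oapp theta phi (unlift ord0 i)).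

(* The Schouten bracket of X_0 /\ ... /\ X_p and Y_0 /\ ... /\ Y_q; shifting both
   indices by one does not change the signs. *)
Definition schouten_wedge p q (X : p.+1.-tuple op) (Y : q.+1.-tuple op) :
    multi (p + q).+1 := fun theta x =>
  \sum_(i < p.+1) \sum_(j < q.+1) (-1) ^+ (i + j)
    * wedge_sec (commutator (tnth X i) (tnth Y j)
              :: take i X ++ drop i.+1 X ++ take j Y ++ drop j.+1 Y) theta x.

Definition decomposition_on (U : set M) k (P : multi k)
    (s : seq (k.-tuple op)) :=
  (forall X i, X \in s -> E (tnth X i)) /\
  (forall theta, dual_secs theta -> forall y, U y ->
     P theta y = \sum_(X <- s) wedge_sec X theta y).

(* The Schouten bracket is the local bilinear extension of schouten_wedge: its
   value at x is computed from decompositions of P and Q into sums of wedge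
   products of sections on a neighbourhood of x.  Such decompositions exist for
   multisections of a vector bundle of finite rank, and the value does not depend
   on them, as the bracket is a differential operator in each argument. *)
Definition schouten p q (P : multi p.+1) (Q : multi q.+1) : multi (p + q).+1 :=
  fun theta x => xget 0 [set r : R | exists U s t,
    [/\ open U, U x, decomposition_on U P s, decomposition_on U Q t &
        r = \sum_(X <- s) \sum_(Y <- t) schouten_wedge X Y theta x]].

(* P and Q have degrees p + 1 and q + 1. *)
Definition schouten_jacobi (phi : dform) p q (P : multi p.+1) (Q : multi q.+1) :
    multi (p + q).+1 := fun theta x =>
  schouten P Q theta x
  + p%:R * multi_wedge P (contraction phi Q) theta x
  - (-1) ^+ p * q%:R
      * multi_wedge (contraction phi P) Q (theta \o cast_ord (addnS p q)) x.

(* The section D |-> D(sigma) of the dual bundle. *)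
Definition jet (sigma : M -> Z) : dform :=
  patch (fun=> cst 0) E (act^~ sigma).

(* For P = D /\ D' this is D(sigma) D'(sigma') - D(sigma') D'(sigma). *)
Definition induced_bracket (P : multi 2) (sigma sigma' : M -> Z) : M -> R :=
  P (fun i => jet (if i == ord0 then sigma else sigma')).

End Multisections.

(* phi^0(D)(x) is the number a such that [D, XZ] = a XZ along the fibre of x. *)
Definition phi0 : dform := patch (fun=> cst 0) secL (fun D x =>
  xget 0 [set a : R | forall g z, Cinf g -> zeta z = x ->
                        commutator D XZ g z = a * XZ g z]).

Definition linear_operator : set ((M -> R) -> M -> R) :=
  [set L | (forall f, Cinf f -> Cinf (L f)) /\
    forall (a b : R) f g, Cinf f -> Cinf g -> forall x,
      L (fun y => a * f y + b * g y) x = a * L f x + b * L g x].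

Definition derivation : set ((M -> R) -> M -> R) :=
  [set L | linear_operator L /\
    forall f g, Cinf f -> Cinf g -> forall x,
      L (f \* g) x = L f x * g x + f x * L g x].

(* Algebraically: [[L, f], g] = 0 for all functions f and g. *)
Definition diffop1 : set ((M -> R) -> M -> R) :=
  [set L | linear_operator L /\
    forall f g h, Cinf f -> Cinf g -> Cinf h -> forall x,
      L (f \* (g \* h)) x - f x * L (g \* h) x
      - (g x * L (f \* h) x - g x * (f x * L h x)) = 0].

(* F maps sections of Z to functions; A is the class of its linear part. *)
Definition affine_with (A : set ((M -> R) -> M -> R))
    (F : (M -> Z) -> M -> R) :=
  (forall sigma, Sec sigma -> Cinf (F sigma)) /\
  exists2 L, A L &
    forall sigma f, Sec sigma -> Cinf f -> forall x,
      F (sec_add sigma f) x = F sigma x + L f x.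

Definition bracket := (M -> Z) -> (M -> Z) -> M -> R.

(* {sigma, f}^2_v; sigma' is an auxiliary section, irrelevant for affine br. *)
Definition br_v (br : bracket) (sigma' sigma : M -> Z) (f : M -> R) : M -> R :=
  fun x => br sigma (sec_add sigma' f) x - br sigma sigma' x.

Definition aff_bracket (A : set ((M -> R) -> M -> R)) (br : bracket) :=
  [/\ forall sigma, Sec sigma -> affine_with linear_operator (br sigma),
      forall sigma, Sec sigma -> affine_with linear_operator (br^~ sigma),
      forall s1 s2, Sec s1 -> Sec s2 -> forall x, br s1 s2 x = - br s2 s1 x,
      forall s s1 s2 s3, Sec s -> Sec s1 -> Sec s2 -> Sec s3 -> forall x,
        br_v br s s1 (br s2 s3) x + br_v br s s2 (br s3 s1) x
        + br_v br s s3 (br s1 s2) x = 0 &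
      forall sigma, Sec sigma -> affine_with A (br sigma)].

Definition aff_Poisson := aff_bracket derivation.
Definition aff_Jacobi := aff_bracket diffop1.

End AVGeometry.

Arguments secT {R n M} Z.
Arguments secL {R n M} Z.
Arguments phi0 {R n M} Z.

(* Main.v *)
Require Import Defs.
From HB Require Import structures.
From mathcomp Require Import all_boot all_order all_algebra perm.
From mathcomp Require Import all_classical all_reals all_analysis.
From mathcomp Require Import ring lra.
Set Implicit Arguments.
Unset Strict Implicit.
Unset Printing Implicit Defensive.
Import Order.TTheory GRing.Theory Num.Theory.
Import numFieldNormedType.Exports.
Local Open Scope classical_set_scope.
Local Open Scope ring_scope.

(* Let D^ be the linear part of sigma |-> D(sigma). It is a first-order operator,
   [D, D'](sigma) = D^(D'(sigma)) - D'^(D(sigma)), and phi^0(D) = D(1). Let P be a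
   bivector, { , } its bracket, and let X_0 /\ X_1 and Y_0 /\ Y_1 run through two
   local decompositions of P. The Leibniz rule for X_i^ and Y_j^ shows that
   [[P, P]], evaluated on the jets of three sections, is twice the Jacobiator minus
   twice the cyclic sum of P(phi^0, s1) {s2, s3}. The two correction terms of the
   Schouten-Jacobi bracket cancel the cyclic sum, which vanishes on T~Z. Both sides
   are trilinear over functions, and the jets of global sections span the fibres of
   the dual bundle, so vanishing on jets is vanishing.

   Global sections exist by a partition of unity. The sections of L~Z are the
   first-order operators that map the functions on M and the functions F_sigma to
   functions on M, and those of T~Z satisfy D(1) = 0 in addition; hence commutators
   of sections are sections, and there are local frames of global sections whose
   dual frames consist of jets of sections of Z. *)

(** * Calculus on R^n *)

Section RnCalculus.
Context {R : realType}.

(** The Schouten bracket is defined by picking decompositions of P near a point. Rather than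
    comparing decompositions with each other, the computation on jets is carried out for two
    arbitrary ones, one for each argument; its result involves P alone and so applies to whichever
    pair the definition picks. The factor two is the symmetry between the two copies of P: a
    commutator [X_i, Y_j] splits into two halves, and each half yields one full Jacobiator. The
    Jacobiator differentiates brackets and is not visibly tensorial, whereas a sum of
    [schouten_wedge] terms over fixed decompositions is. The passage from jets to all forms is
    therefore made on the Schouten side. Both parts of the theorem come from one argument, for a
    class E of operators inside [EL] that is closed under combinations and commutators and locally
    framed. Operators act on globally defined functions, so local statements pass through smooth
    cutoffs, built from exp(-1/t). *)

Lemma mvt_dir m (f : 'rV[R]_m -> R) (v u : 'rV[R]_m) (a : R) :
  (forall t, `|t| <= `|a| -> derivable f (v + t *: u) u) ->
  exists2 t, `|t| <= `|a| & f (v + a *: u) - f v = a * 'D_u f (v + t *: u).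
Proof.
move=> df; pose g : R -> R := fun t : R => f (v + t *: u).
have dg (t : R) : `|t| <= `|a| -> is_derive t (1 : R) g ('D_u f (v + t *: u)).
  move=> /df fd.
  have E : (fun h : R => h^-1 *: (g (h *: 1 + t) - g t)) =
           (fun h : R => h^-1 *: (f (h *: u + (v + t *: u)) - f (v + t *: u))).
    apply/funext => h; rewrite /g /=; congr (_ *: (f _ - _)).
    by rewrite addrCA -scalerDl [h *: 1]mulr1.
  by apply: DeriveDef; rewrite /derivable /derive E.
have cg (t : R) : `|t| <= `|a| -> {for t, continuous g}.
  by move=> ta; apply/differentiable_continuous/derivable1_diffP; case: (dg _ ta).
have bnd (b c t : R) : b <= 0 <= c -> b <= t <= c -> `|b| + `|c| = `|a| -> `|t| <= `|a|.
  move=> /andP[b0 c0] /andP[bt tc] <-.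
  rewrite ler_norml (ler0_norm b0) (ger0_norm c0); apply/andP; split; lra.
have key (b c : R) : b <= 0 <= c -> `|b| + `|c| = `|a| ->
    exists2 t, `|t| <= `|a| & g c - g b = 'D_u f (v + t *: u) * (c - b).
  move=> bc e; have blec : b <= c by case/andP: bc; exact: le_trans.
  have [t|x|t tbc ->] := @MVT_segment _ g (fun t => 'D_u f (v + t *: u)) b c blec.
  - rewrite in_itv /= => /andP[bt tc]; apply: dg; apply: bnd bc _ e.
    by rewrite !ltW.
  - apply: continuous_in_subspaceT => y; rewrite inE /= in_itv /= => ybc.
    by apply: cg; exact: bnd bc ybc e.
  - by exists t => //; apply: bnd bc _ e; rewrite in_itv in tbc.
have g0 : g 0 = f v by rewrite /g scale0r addr0.
rewrite -g0 -/(g a); case: (leP 0 a) => a0.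
  have [||t ta ->] := key 0 a; rewrite ?lexx ?normr0 ?add0r //.
  by exists t => //; rewrite subr0 mulrC.
have [||t ta E] := key a 0; rewrite ?lexx ?(ltW a0) ?normr0 ?addr0 //.
by exists t => //; rewrite -opprB E sub0r mulrN opprK mulrC.
Qed.

Lemma row_norm_le m (u : 'rV[R]_m) j : `|u 0 j| <= `|u|.
Proof.
rewrite [leRHS]/Num.Def.normr /= mx_normrE.
exact: (le_bigmax _ (fun i => `|u i.1 i.2|) (0, j)).
Qed.

Lemma row_norm_lub m (u : 'rV[R]_m) (c : R) :
  0 <= c -> (forall j, `|u 0 j| <= c) -> `|u| <= c.
Proof.
move=> c0 uc; rewrite /Num.Def.normr /= mx_normrE.
by apply: bigmax_le => // -[i j] _ /=; rewrite ord1.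
Qed.

Lemma basis_vecE m (i j : 'I_m) : basis_vec R i 0 j = (j == i)%:R.
Proof. by rewrite mxE eqxx. Qed.

Lemma row_basis m (u : 'rV[R]_m) : u = \sum_j u 0 j *: basis_vec R j.
Proof. exact: row_sum_delta. Qed.

Definition row_trunc m (u : 'rV[R]_m) (k : nat) : 'rV[R]_m :=
  \row_j (if (j < k)%N then u 0 j else 0).

Lemma row_trunc0 m (u : 'rV[R]_m) : row_trunc u 0 = 0.
Proof. by apply/rowP => j; rewrite !mxE. Qed.

Lemma row_truncm m (u : 'rV[R]_m) : row_trunc u m = u.
Proof. by apply/rowP => j; rewrite !mxE ltn_ord. Qed.

Lemma row_truncS m (u : 'rV[R]_m) (j : 'I_m) :
  row_trunc u j.+1 = row_trunc u j + u 0 j *: basis_vec R j.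
Proof.
apply/rowP => i; rewrite !mxE eqxx /= ltnS leq_eqVlt eq_sym -val_eqE /= eq_sym.
by case: (ltngtP i j) => [||/val_inj ->]; rewrite ?mulr0 ?mulr1 ?addr0 ?add0r.
Qed.

(** A staircase from v to v + h changes one coordinate at a time ([row_trunc]). Each step is a mean
    value along one axis, whose intermediate point stays within |h| of v in the sup norm. *)
Lemma increment_bound m (f : 'rV[R]_m -> R) (v h : 'rV[R]_m) (e : R) :
  (forall w i, `|w| <= `|h| -> derivable f (v + w) (basis_vec R i)) ->
  (forall w i, `|w| <= `|h| -> `|partial i f (v + w) - partial i f v| <= e) ->
  `|f (v + h) - f v - \sum_j h 0 j * partial j f v| <= m%:R * e * `|h|.
Proof.
move=> df pf.
have tele : f (v + h) - f v = \sum_(j < m)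
    (f (v + row_trunc h j.+1) - f (v + row_trunc h j)).
  rewrite -(big_mkord xpredT (fun j => f (v + row_trunc h j.+1) - f (v + row_trunc h j))).
  by rewrite telescope_sumr // row_trunc0 row_truncm addr0.
rewrite tele -sumrB; apply: (le_trans (ler_norm_sum _ _ _)).
suff H (j : 'I_m) : `|f (v + row_trunc h j.+1) - f (v + row_trunc h j)
    - h 0 j * partial j f v| <= e * `|h|.
  apply: (le_trans (ler_sum _ (fun j _ => H j))).
  by rewrite sumr_const card_ord -mulrA mulr_natl.
have wb (t : R) : `|t| <= `|h 0 j| -> `|row_trunc h j + t *: basis_vec R j| <= `|h|.
  move=> th; apply: row_norm_lub => // i; rewrite !mxE eqxx /=.
  have [->|ij] := eqVneq i j.
    by rewrite ltnn add0r mulr1; apply: le_trans th (row_norm_le _ _).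
  rewrite mulr0 addr0; case: ifP => _; last by rewrite normr0.
  exact: row_norm_le.
rewrite row_truncS addrA.
have [t /wb tb|t /wb tb ->] := @mvt_dir _ f (v + row_trunc h j) (basis_vec R j) (h 0 j).
  by rewrite -addrA; apply: df.
rewrite -mulrBr normrM mulrC; apply: ler_pM => //; last exact: row_norm_le.
by rewrite -addrA; apply: pf.
Qed.

Lemma near_ball_shift m (v : 'rV[R]_m) (P : set 'rV[R]_m) :
  (\forall w \near v, P w) -> exists2 d : R, 0 < d & forall h, `|h| < d -> P (v + h).
Proof.
move=> /nbhs_normP[d /= d0 dP]; exists d => // h hd; apply: dP => /=.
by rewrite opprD addNKr normrN.
Qed.

Lemma differentiable_of_bound (V W : normedModType R) (f : V -> W)
    (L : {linear V -> W}) (v : V) : continuous L ->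
  (forall e : R, 0 < e ->
     \forall h \near 0, `|f (v + h) - f v - L h| <= e * `|h|) ->
  differentiable f v.
Proof.
move=> cL b.
have H : f \o shift v = cst (f v) + L +o_ 0 id.
  apply/eqaddoP => _/posnumP[e]; have := b _ [gt0 of e%:num].
  by apply: filterS => h /=; rewrite !fctE /= opprD addrA [v + h]addrC.
by apply/diff_locallyP; rewrite (diff_unique cL H).
Qed.

Lemma C1_differentiable m (f : 'rV[R]_m -> R) (v : 'rV[R]_m) :
  (\forall w \near v, forall i, derivable f w (basis_vec R i)) ->
  (forall i, {for v, continuous (partial i f)}) ->
  differentiable f v.
Proof.
move=> df cf.
pose L (h : 'rV[R]_m) : R := \sum_j h 0 j * partial j f v.
have linL : linear L.
  move=> a x y; rewrite /L scaler_sumr -big_split /=; apply: eq_bigr => j _.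
  by rewrite !mxE mulrDl -mulrA.
pose LL := GRing.isLinear.Build _ _ _ _ _ linL.
pose Lf : {linear 'rV[R]_m -> R} := HB.pack L LL.
have cL : continuous (Lf : _ -> _).
  move=> x; rewrite /Lf /= /L.
  have -> : (fun h : 'rV[R]_m => \sum_j h 0 j * partial j f v) =
     \sum_j (fun h : 'rV[R]_m => h 0 j * partial j f v).
    by apply/funext => h; rewrite fct_sumE.
  apply: differentiable_continuous; apply: differentiable_sum => j.
  have -> : (fun h : 'rV[R]_m => h 0 j * partial j f v) =
     (partial j f v) \*: (fun h : 'rV[R]_m => h 0 j).
    by apply/funext => h /=; rewrite mulrC.
  by apply: differentiableZ; exact: differentiable_coord.
apply: (differentiable_of_bound cL) => e e0.
(* [increment_bound] loses a factor m; dividing by m + 1 also covers m = 0. *)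
have e1 : 0 < e / (m%:R + 1) by rewrite divr_gt0 // ltr_wpDl.
have : \forall w \near v, (forall i, derivable f w (basis_vec R i)) /\
    forall i, `|partial i f w - partial i f v| <= e / (m%:R + 1).
  apply: filterI => //.
  have cf' i : \forall w \near v, `|partial i f w - partial i f v| <= e / (m%:R + 1).
    have /cvgrPdist_le /(_ _ e1) := cf i.
    by apply: filterS => w; rewrite distrC.
  exact: filter_forall cf'.
move=> /near_ball_shift[d d0 dP].
have := nbhs0_lt (V := 'rV[R]_m) d0; apply: filterS => h hd.
apply: le_trans (@increment_bound _ f v h (e / (m%:R + 1)) _ _) _.
- by move=> w i wh; case: (dP w (le_lt_trans wh hd)).
- by move=> w i wh; case: (dP w (le_lt_trans wh hd)).
- apply: ler_wpM2r => //; rewrite mulrCA ler_piMr ?(ltW e0) //.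
  by rewrite ler_pdivrMr ?ltr_wpDl // mul1r lerDl.
Qed.

End RnCalculus.

(** * Functions of class C^k: germs, chain rule, symmetry of second derivatives *)

Section RnSmooth.
Context {R : realType}.

Lemma continuous_row (T : topologicalType) m (f : T -> 'rV[R]_m) (v : T) :
  (forall j, {for v, continuous (fun w => f w 0 j)}) -> {for v, continuous f}.
Proof.
move=> cf; apply/cvgrPdist_le => e e0.
have cf' j : \forall w \near v, `|f v 0 j - f w 0 j| <= e.
  by have /cvgrPdist_le := cf j; exact.
have := filter_forall (nbhs_filter v) cf'; apply: filterS => w fw.
by apply: row_norm_lub => [|j]; [exact: ltW|rewrite !mxE; exact: fw].
Qed.

Lemma derive_dirE (V W : normedModType R) (F : V -> W) (v u : V) :
  'D_u F v = 'D_1 (fun t : R => F (t *: u + v)) 0.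
Proof.
rewrite /derive; set g1 := fun h => h^-1 *: _; set g2 := fun h => h^-1 *: _.
suff -> : g1 = g2 by [].
by rewrite funeqE /g1 /g2 => h /=; rewrite addr0 scale0r add0r [_%:A]mulr1.
Qed.

Lemma diff_partial m (f : 'rV[R]_m -> R) (x w : 'rV[R]_m) :
  differentiable f x -> 'd f x w = \sum_j w 0 j * partial j f x.
Proof.
move=> df; rewrite [in LHS](row_basis w) linear_sum; apply: eq_bigr => j _.
by rewrite linearZ /partial deriveE.
Qed.

Lemma derive_comp_row m (V : normedModType R) (T : V -> 'rV[R]_m)
    (f : 'rV[R]_m -> R) (v u : V) :
  differentiable f (T v) -> (forall j, derivable (fun w => T w 0 j) v u) ->
  derivable (f \o T) v u /\
  'D_u (f \o T) v = \sum_j partial j f (T v) * 'D_u (fun w => T w 0 j) v.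
Proof.
move=> df dT.
have dT' : derivable T v u by apply/derivable_mxP => i j; rewrite ord1.
pose g (t : R) := T (t *: u + v).
have g0 : g 0 = T v by rewrite /g scale0r add0r.
have dg : differentiable g 0.
  have /derivable1P := dT'; rewrite -/g => dg; exact: (derivable1_diffP _ _).1 dg.
have df' : differentiable f (g 0) by rewrite g0.
split.
  apply/derivable1P/derivable1_diffP.
  exact: (@differentiable_comp _ _ _ _ g f).
transitivity ('D_(1 : R) (f \o g) (0 : R)); first exact: derive_dirE.
rewrite deriveE; last exact: differentiable_comp.
have dgE : 'd g (0 : R) (1 : R) = 'D_u T v by rewrite [RHS]derive_dirE (deriveE _ dg).
rewrite diff_comp //= dgE diff_partial // g0.
by apply: eq_bigr => j _; rewrite derive_mx // !mxE mulrC.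
Qed.

Lemma partial_comp l m (T : 'rV[R]_l -> 'rV[R]_m) (f : 'rV[R]_m -> R) v i :
  differentiable f (T v) -> (forall j, derivable (fun w => T w 0 j) v (basis_vec R i)) ->
  derivable (f \o T) v (basis_vec R i) /\
  partial i (f \o T) v =
    \sum_j partial j f (T v) * partial i (fun w => T w 0 j) v.
Proof. exact: derive_comp_row. Qed.

Lemma near_eq_continuous_at (T U : topologicalType) (f g : T -> U) (v : T) :
  (\forall w \near v, f w = g w) ->
  {for v, continuous f} -> {for v, continuous g}.
Proof.
move=> fg cf; have fgv : f v = g v := nbhs_singleton fg.
rewrite /prop_for /continuous_at -fgv; apply: cvg_trans cf.
by apply: near_eq_cvg; apply: filterS fg => w ->.
Qed.

Section Ck.
Context {m : nat}.
Implicit Types (V : set 'rV[R]_m) (f g : 'rV[R]_m -> R).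

Lemma Ck_cont k V f : Ck k V f -> forall v, V v -> {for v, continuous f}.
Proof. by case: k => [|k] []. Qed.

Lemma Ck_deriv k V f i v : Ck k.+1 V f -> V v -> derivable f v (basis_vec R i).
Proof. by case=> _ /(_ i)[+ _]; exact. Qed.

Lemma Ck_partial k V f i : Ck k.+1 V f -> Ck k V (partial i f).
Proof. by case=> _ /(_ i)[]. Qed.

Lemma CkW k V f : Ck k.+1 V f -> Ck k V f.
Proof.
elim: k f => [|k IH] f H; first by split=> //; exact: (Ck_cont H).
split; first exact: (Ck_cont H).
by move=> i; split=> [v|]; [exact: Ck_deriv H|apply/IH/(Ck_partial _ H)].
Qed.

Lemma Ck_sub k V V' f : V' `<=` V -> Ck k V f -> Ck k V' f.
Proof.
move=> sV; elim: k f => [|k IH] f [cf df]; split=> //; try by move=> v /sV /cf.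
by move=> i; have [d1 d2] := df i; split=> [v /sV /d1 //|]; exact: IH.
Qed.

(** Each condition in [Ck] concerns the germ of a function at one point, so sets can be traded for
    singletons, where a function may be replaced by one with the same germ ([Ck_near_eq]). *)
Lemma Ck_pt k V f : Ck k V f <-> forall v, V v -> Ck k [set v] f.
Proof.
split=> [H v Vv|]; first by apply: Ck_sub H => w ->.
elim: k f => [|k IH] f H; first by split=> // v /H [+ _]; exact.
split=> [v /H [+ _]|i]; first exact.
split=> [v /H /Ck_deriv|]; first exact.
by apply: IH => v /H /Ck_partial.
Qed.

Lemma near_partial f g (v : 'rV[R]_m) i : (\forall w \near v, f w = g w) ->
  \forall w \near v, partial i f w = partial i g w.
Proof.
move=> fg; have /= := near_join fg; apply: filterS => w fgw.
exact: near_eq_derive fgw.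
Qed.

Lemma Ck_near_eq k f g (v : 'rV[R]_m) : (\forall w \near v, f w = g w) ->
  Ck k [set v] f -> Ck k [set v] g.
Proof.
elim: k f g v => [|k IH] f g v fg Hf.
  by split=> // _ ->; apply: near_eq_continuous_at fg _; exact: Ck_cont Hf _ _.
split=> [_ ->|i]; first by apply: near_eq_continuous_at fg _; exact: Ck_cont Hf _ _.
split=> [_ ->|].
  by apply: near_eq_derivable fg _; exact: Ck_deriv Hf _.
by apply: IH (Ck_partial i Hf); exact: near_partial.
Qed.

Lemma Ck_eq k V f g : open V -> (forall v, V v -> f v = g v) ->
  Ck k V f -> Ck k V g.
Proof.
move=> oV fg /Ck_pt H; apply/Ck_pt => v Vv; apply: Ck_near_eq (H v Vv).
by have := open_nbhs_nbhs (conj oV Vv); apply: filterS.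
Qed.

Lemma Ck_cst k V (c : R) : Ck k V (cst c).
Proof.
elim: k c => [|k IH] c; first by split=> // v _; exact: cst_continuous.
split=> [v _|i]; first exact: cst_continuous.
split=> [v _|]; first exact: derivable_cst.
suff -> : partial i (cst c : 'rV[R]_m -> R) = cst 0 by [].
by apply/funext => v; rewrite /partial derive_cst.
Qed.

Lemma derivable_coord (v : 'rV[R]_m) i j : derivable (fun w : 'rV[R]_m => w 0 j) v (basis_vec R i).
Proof. by apply/diff_derivable/differentiable_coord. Qed.

Lemma partial_coord i j : partial i (fun w : 'rV[R]_m => w 0 j) = cst (i == j)%:R.
Proof.
apply/funext => v; rewrite /partial.
have := @derive_mx R 'rV[R]_m 1 m id v (basis_vec R i) (@derivable_id _ _ _ _).
by rewrite derive_id => /matrixP /(_ 0 j); rewrite !mxE /= => <-; rewrite eq_sym.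
Qed.

Lemma Ck_coord k V j : Ck k V (fun w => w 0 j).
Proof.
have cc v : {for v, continuous (fun w : 'rV[R]_m => w 0 j)}.
  exact/differentiable_continuous/differentiable_coord.
case: k => [|k]; split=> // i; split=> [v _|]; first exact: derivable_coord.
by rewrite partial_coord; exact: Ck_cst.
Qed.

Lemma CkD k V f g : open V -> Ck k V f -> Ck k V g -> Ck k V (f \+ g).
Proof.
move=> oV; elim: k f g => [|k IH] f g Hf Hg.
  by split=> // v Vv; apply: continuousD; [exact: Ck_cont Hf _ _|exact: Ck_cont Hg _ _].
split=> [v Vv|i].
  by apply: continuousD; [exact: Ck_cont Hf _ _|exact: Ck_cont Hg _ _].
split=> [v Vv|].
  by apply: derivableD; [exact: Ck_deriv Hf _|exact: Ck_deriv Hg _].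
apply: Ck_eq (IH _ _ (Ck_partial i Hf) (Ck_partial i Hg)) => // v Vv /=.
by rewrite /partial deriveD //; [exact: Ck_deriv Hf _|exact: Ck_deriv Hg _].
Qed.

Lemma CkM k V f g : open V -> Ck k V f -> Ck k V g -> Ck k V (f \* g).
Proof.
move=> oV; elim: k f g => [|k IH] f g Hf Hg.
  by split=> // v Vv; apply: continuousM; [exact: Ck_cont Hf _ _|exact: Ck_cont Hg _ _].
split=> [v Vv|i].
  by apply: continuousM; [exact: Ck_cont Hf _ _|exact: Ck_cont Hg _ _].
split=> [v Vv|].
  by apply: derivableM; [exact: Ck_deriv Hf _|exact: Ck_deriv Hg _].
apply: (Ck_eq oV) (CkD oV (IH _ _ (CkW Hf) (Ck_partial i Hg))
  (IH _ _ (CkW Hg) (Ck_partial i Hf))) => v Vv /=.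
by rewrite /partial deriveM //; [exact: Ck_deriv Hf _|exact: Ck_deriv Hg _].
Qed.

Lemma Ck_sum k V (I : Type) (r : seq I) (F : I -> 'rV[R]_m -> R) : open V ->
  (forall i, Ck k V (F i)) -> Ck k V (fun v => \sum_(i <- r) F i v).
Proof.
move=> oV H; elim: r => [|i r IH].
  by apply: Ck_eq (Ck_cst k V 0) => // v _; rewrite big_nil.
by apply: Ck_eq (CkD oV (H i) IH) => // v _; rewrite big_cons.
Qed.

Lemma Ck_inv k V f : open V -> (forall v, V v -> f v != 0) ->
  Ck k V f -> Ck k V (fun v => (f v)^-1).
Proof.
move=> oV f0; elim: k => [|k IH] Hf.
  by split=> // v Vv; apply: continuousV; [exact: f0|exact: Ck_cont Hf _ _].
split=> [v Vv|i]; first by apply: continuousV; [exact: f0|exact: Ck_cont Hf _ _].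
split=> [v Vv|]; first by apply: derivableV; [exact: f0|exact: Ck_deriv Hf _].
have Hi := IH (CkW Hf).
apply: (Ck_eq oV) (CkM oV (CkM oV (Ck_cst k V (-1)) (Ck_partial i Hf)) (CkM oV Hi Hi)) => v Vv.
rewrite /= /partial deriveV; [|exact: f0|exact: Ck_deriv Hf _].
by rewrite -[_ *: _]/(_ * _) expr2 invfM /cst; ring.
Qed.

Lemma C1_open_differentiable V f (v : 'rV[R]_m) : open V -> Ck 1 V f -> V v -> differentiable f v.
Proof.
move=> oV Hf Vv; apply: C1_differentiable.
  by have := open_nbhs_nbhs (conj oV Vv); apply: filterS => w Vw i; exact: Ck_deriv Hf _.
by move=> i; exact: Ck_cont (Ck_partial i Hf) _ _.
Qed.

Lemma Ck_le k l V f : (l <= k)%N -> Ck k V f -> Ck l V f.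
Proof.
move=> lk; rewrite -(subnK lk); elim: (k - l)%N => [//|d IH].
by rewrite addSn => /CkW.
Qed.

End Ck.

Lemma Ck_comp k l m (V : set 'rV[R]_l) (W : set 'rV[R]_m)
    (T : 'rV[R]_l -> 'rV[R]_m) (f : 'rV[R]_m -> R) :
  open V -> open W -> (forall v, V v -> W (T v)) ->
  (forall j, Ck k V (fun v => T v 0 j)) -> Ck k W f -> Ck k V (f \o T).
Proof.
move=> oV oW VW; elim: k f => [|k IH] f HT Hf.
  split=> // v Vv; apply: continuous_comp.
    by apply: continuous_row => j; exact: Ck_cont (HT j) _ _.
  by apply: Ck_cont Hf _ _; exact: VW.
have df v : V v -> differentiable f (T v).
  by move=> /VW; apply: (C1_open_differentiable oW); exact: Ck_le Hf.
split=> [v Vv|i].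
  apply: continuous_comp.
    by apply: continuous_row => j; exact: Ck_cont (HT j) _ _.
  by apply: Ck_cont Hf _ _; exact: VW.
have chain v (Vv : V v) := @partial_comp l m T f v i (df v Vv)
  (fun j => Ck_deriv (HT j) Vv).
split=> [v /chain[] //|].
apply: (@Ck_eq _ _ _ (fun v => \sum_j (partial j f \o T) v *
    partial i (fun w => T w 0 j) v)) => //; first by move=> v /chain[].
apply: Ck_sum => // j; apply: CkM => //; last exact: Ck_partial (HT j).
by apply: IH => [j'|]; [exact: CkW (HT j')|exact: Ck_partial Hf].
Qed.

Lemma schwarz m (V : set 'rV[R]_m) (f : 'rV[R]_m -> R) v i j :
  open V -> Ck 2 V f -> V v ->
  partial i (partial j f) v = partial j (partial i f) v.
Proof.
move=> oV Hf Vv.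
pose e (i : 'I_m) := basis_vec R i.
have en i' : `|e i'| <= 1.
  by apply: row_norm_lub => // k; rewrite basis_vecE; case: eqP; rewrite ?normr0 ?normr1.
have /near_ball_shift[d d0 dV] : \forall w \near v, V w by exact: open_nbhs_nbhs.
have bound (a s t : R) i' j' : `|s| <= `|a| -> `|t| <= `|a| ->
    `|s *: e i' + t *: e j'| <= `|a| + `|a|.
  move=> sa ta; apply: (le_trans (ler_normD _ _)); rewrite !normrZ.
  by rewrite lerD // -[leRHS]mulr1 ler_pM.
(* The mean value theorem in both directions evaluates the second difference. *)
have diff2 i' j' a : 0 < a -> a + a < d -> exists2 w, `|w| <= a + a &
    f (v + a *: e i' + a *: e j') - f (v + a *: e i') - f (v + a *: e j') + f v
    = a * a * partial j' (partial i' f) (v + w).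
  move=> a0 ad.
  have na : `|a| = a by rewrite gtr0_norm.
  have inV s t : `|s| <= `|a| -> `|t| <= `|a| -> V (v + s *: e i' + t *: e j').
    move=> sa ta; rewrite -addrA; apply: dV; apply: le_lt_trans (bound a s t _ _ sa ta) _.
    by rewrite na.
  pose g w := f (w + a *: e j') - f w.
  have fshift w : derivable f (w + a *: e j') (e i') ->
      derivable (fun w => f (w + a *: e j')) w (e i') /\
      'D_(e i') (fun w => f (w + a *: e j')) w = 'D_(e i') f (w + a *: e j').
    rewrite /derivable /derive.
    have -> : (fun h : R => h^-1 *: (f (h *: e i' + (w + a *: e j')) - f (w + a *: e j'))) =
        (fun h : R => h^-1 *: (f (h *: e i' + w + a *: e j') - f (w + a *: e j'))).
      by apply/funext => h; rewrite addrA.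
    by [].
  have dg s : `|s| <= `|a| -> derivable g (v + s *: e i') (e i') /\
     'D_(e i') g (v + s *: e i') = partial i' f (v + s *: e i' + a *: e j')
        - partial i' f (v + s *: e i').
    move=> sa.
    have d1 : derivable f (v + s *: e i' + a *: e j') (e i').
      by apply: (Ck_deriv Hf); exact: inV.
    have d2 : derivable f (v + s *: e i') (e i').
      by apply: (Ck_deriv Hf); have := inV s 0; rewrite scale0r addr0 normr0; exact.
    have [d3 d4] := fshift _ d1.
    by split; [exact: derivableB d3 d2|rewrite (deriveB d3 d2) d4].
  have [|s sa Eg] := @mvt_dir R m g v (e i') a; first by move=> t /dg[].
  have [|t ta Ef] := @mvt_dir R m (partial i' f) (v + s *: e i') (e j') a.
    by move=> t ta; apply: (Ck_deriv (Ck_partial i' Hf)); exact: inV.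
  exists (s *: e i' + t *: e j'); first by rewrite -na; exact: bound.
  transitivity (g (v + a *: e i') - g v).
    by rewrite /g opprB addrA addrAC.
  by rewrite Eg (dg s sa).2 Ef mulrA addrA.
(* The second difference is symmetric in i and j, so the two mixed derivatives agree when taken at
   suitable points arbitrarily close to v; continuity at v costs eps / 2 for each. *)
apply/eqP; rewrite -subr_eq0 -normr_le0; apply/ler_addgt0Pr => eps eps0.
rewrite add0r.
have e2 : 0 < eps / 2 by rewrite divr_gt0.
have cont i' j' : \forall w \near v,
    `|partial i' (partial j' f) v - partial i' (partial j' f) w| <= eps / 2.
  have := Ck_cont (Ck_partial i' (Ck_partial j' Hf)) Vv.
  by move/cvgrPdist_le; exact.
have [d' d'0 dP] := near_ball_shift (filterI (cont i j) (cont j i)).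
pose a := Num.min d d' / 4.
have m0 : 0 < Num.min d d' by rewrite lt_min d0.
have a0 : 0 < a by rewrite divr_gt0.
have aa : a + a < Num.min d d' by rewrite /a; lra.
have [ad ad'] : a + a < d /\ a + a < d' by move: aa; rewrite lt_min => /andP[].
have [w1 w1a E1] := diff2 i j a a0 ad.
have [w2 w2a E2] := diff2 j i a a0 ad.
have [_ h1] := dP w1 (le_lt_trans w1a ad').
have [h2 _] := dP w2 (le_lt_trans w2a ad').
have E : partial j (partial i f) (v + w1) = partial i (partial j f) (v + w2).
  have : a * a * partial j (partial i f) (v + w1) = a * a * partial i (partial j f) (v + w2).
    have Es : v + a *: e j + a *: e i = v + a *: e i + a *: e j := addrAC _ _ _.
    apply: etrans (esym E1) _; apply: etrans _ E2; rewrite Es.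
    by congr (_ + _); exact: addrAC.
  by apply: mulfI; rewrite mulf_neq0 // gt_eqF.
rewrite [X in `|X|](_ : _ = (partial i (partial j f) v - partial i (partial j f) (v + w2))
   - (partial j (partial i f) v - partial j (partial i f) (v + w1))); last first.
  by rewrite E opprB addrA subrK.
rewrite (splitr eps); exact: le_trans (ler_normB _ _) (lerD h2 h1).
Qed.

End RnSmooth.

(** * Flat functions and cutoffs on R^n *)

Section Bump.
Context {R : realType}.
Implicit Types (p : {poly R}) (t : R).

(* The derivative of [p(1/t) exp(-1/t)] has the same shape, with [p] replaced by
   [X^2 (p - p')]. *)
Definition flat p t : R := if 0 < t then p.[t^-1] * expR (- t^-1) else 0.

Lemma flat0 p t : t <= 0 -> flat p t = 0.
Proof. by move=> t0; rewrite /flat ltNge t0. Qed.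

Lemma flat1_gt0 t : 0 < t -> 0 < flat 1 t.
Proof. by move=> t0; rewrite /flat t0 hornerE mul1r expR_gt0. Qed.

Lemma flat1_ge0 t : 0 <= flat 1 t.
Proof. by have [/flat0 ->|/flat1_gt0/ltW] := leP t 0. Qed.

(** With u = 1/t, the inequality exp(u) >= u^(i+1) / (i+1)! gives u^i exp(-u) <= (i+1)! t for each
    monomial of p. *)
Lemma flat_bound p : exists2 C : R, 0 <= C & forall t, `|flat p t| <= C * `|t|.
Proof.
exists (\sum_(i < size p) `|p`_i| * (i.+1)`!%:R).
  by apply: sumr_ge0 => i _; rewrite mulr_ge0.
move=> t; have [t0|t0] := leP t 0.
  rewrite flat0 // normr0 mulr_ge0 //; apply: sumr_ge0 => i _.
  by rewrite mulr_ge0.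
rewrite /flat t0 horner_coef mulr_suml mulr_suml.
apply: (le_trans (ler_norm_sum _ _ _)); apply: ler_sum => i _.
rewrite !normrM -!mulrA ler_wpM2l // (gtr0_norm t0) (gtr0_norm (expR_gt0 _)).
have u0 : 0 < t^-1 by rewrite invr_gt0.
rewrite (ger0_norm (exprn_ge0 _ (ltW u0))) expRN ler_pdivrMr ?expR_gt0 //.
have := expR_ge1Dxn i (ltW u0).
have f0 : (0 : R) < (i.+1)`!%:R by rewrite ltr0n fact_gt0.
move=> H; have {H} : t^-1 ^+ i.+1 / (i.+1)`!%:R <= expR t^-1.
  by apply: le_trans H; rewrite lerDr.
rewrite ler_pdivrMr // => H.
have -> : t^-1 ^+ i = t * t^-1 ^+ i.+1 by rewrite exprS mulrA mulfV ?mul1r // gt_eqF.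
rewrite [X in _ <= X](_ : _ = t * (expR t^-1 * (i.+1)`!%:R)); last by ring.
by rewrite ler_pM2l.
Qed.

Lemma is_derive_flat p t : is_derive t 1 (flat p) (flat ('X^2 * (p - p^`())) t).
Proof.
have [t0|t0|->] := ltgtP t 0.
- rewrite [X in is_derive _ _ _ X]flat0 ?ltW //.
  apply: (@near_eq_is_derive R R R (cst 0)).
  near=> s; rewrite flat0 //= ltW //; near: s; exact: lt_nbhsl.
- apply: (@near_eq_is_derive R R R (fun s => p.[s^-1] * expR (- s^-1))).
    near=> s; rewrite /flat ifT //; near: s; exact: lt_nbhsr.
  have tn0 : t != 0 by rewrite gt_eqF.
  have di : is_derive t (1 : R) (fun s : R => s^-1) (- t ^- 2 *: (1 : R)).
    by apply: is_deriveV => //; exact: is_derive_id.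
  have dp := @is_derive1_comp R (horner p) (fun s : R => s^-1) t _ _ (is_derive_poly p _) di.
  have de := @is_derive1_comp R expR (fun s : R => - s^-1) t _ _ (is_derive_expR _)
    (is_deriveN di).
  apply: (@is_derive_eq R R R _ t 1 _ _ (is_deriveM dp de)).
  have sm (x y : R) : x *: y = x * y by [].
  rewrite /flat t0 !hornerE /= !sm derivE exprVn; ring.
- rewrite [X in is_derive _ _ _ X]flat0 //.
  (* At 0 the difference quotient of [flat p] is [flat ('X * p)], which tends to 0 by
     [flat_bound]. *)
  have cv : h^-1 *: (flat p (h *: 1 + 0) - flat p 0) @[h --> (0 : R)^'] --> (0 : R).
    have [C C0 bC] := flat_bound ('X * p).
    apply/cvgrPdist_le => e e0.
    have e1 : 0 < e / (C + 1) by rewrite divr_gt0 // ltr_wpDl.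
    near=> h.
    have hd : `|h| < e / (C + 1) by near: h; exact: dnbhs0_lt.
    rewrite sub0r normrN (flat0 p (lexx 0)) subr0 addr0 [h *: 1]mulr1.
    have [h0|h0] := leP h 0; first by rewrite flat0 // scaler0 normr0 ltW.
    have -> : h^-1 *: flat p h = flat ('X * p) h.
      by rewrite /flat h0 hornerM hornerX -mulrA.
    apply: (le_trans (bC h)); apply: (le_trans (ler_wpM2l C0 (ltW hd))).
    rewrite mulrCA ler_piMr ?(ltW e0) // ler_pdivrMr ?ltr_wpDl // mul1r.
    by rewrite lerDl.
  by apply: DeriveDef; [apply/cvg_ex; exists 0|exact/cvg_lim].
Unshelve. all: by end_near. Qed.

(** Differentiation preserves the shape of [flat], so the induction on k runs over all p at once.
    Rows of length 1 stand for real numbers so that [Ck_comp] applies. *)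
Lemma Ck_flat k p : Ck k [set: 'rV[R]_1] (fun w => flat p (w 0 0)).
Proof.
have cf q : continuous (fun w : 'rV[R]_1 => flat q (w 0 0)).
  move=> w; apply: (@continuous_comp _ _ _ (fun w : 'rV[R]_1 => w 0 0) (flat q)).
    exact/differentiable_continuous/differentiable_coord.
  have [d _] := is_derive_flat q (w 0 0).
  exact/differentiable_continuous/derivable1_diffP.
elim: k p => [|k IH] p; first by split=> // v _; exact: cf.
split=> [v _|i]; first exact: cf.
have dd w : derivable (fun w : 'rV[R]_1 => flat p (w 0 0)) w (basis_vec R i) /\
   partial i (fun w : 'rV[R]_1 => flat p (w 0 0)) w = flat ('X^2 * (p - p^`())) (w 0 0).
  have [d1 d2] := is_derive_flat p (w 0 0).
  have E : (fun h : R => h^-1 *: (flat p ((h *: basis_vec R i + w) 0 0) - flat p (w 0 0)))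
     = (fun h : R => h^-1 *: (flat p (h *: 1 + w 0 0) - flat p (w 0 0))).
    by apply/funext => h; rewrite !mxE ord1 /= [h *: 1]mulr1 ?eqxx ?mulr1.
  by rewrite /partial -d2 /derivable /derive /= E.
split=> [v _|]; first by case: (dd v).
by apply: Ck_eq (IH _) => // [|w _]; [exact: openT|rewrite (dd w).2].
Qed.

Lemma smooth_on_flat m (V : set 'rV[R]_m) (u : 'rV[R]_m -> R) p : open V ->
  smooth_on V u -> smooth_on V (fun w => flat p (u w)).
Proof.
move=> oV Hu k.
have := @Ck_comp R k m 1 V setT (fun w => \row_(j < 1) u w)
   (fun w => flat p (w 0 0)) oV openT (fun _ _ => I) _ (Ck_flat k p).
rewrite /comp => H; apply: Ck_eq (H _) => // [w _|j]; first by rewrite mxE.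
by apply: Ck_eq (Hu k) => // w _; rewrite mxE.
Qed.

Lemma cutoff_row m (v : 'rV[R]_m) (r : R) : 0 < r ->
  exists chi : 'rV[R]_m -> R, [/\ smooth_on setT chi,
    \forall w \near v, chi w = 1 & forall w, r <= `|w - v| -> chi w = 0].
Proof.
move=> r0.
pose q (w : 'rV[R]_m) := \sum_j (w 0 j - v 0 j) * (w 0 j - v 0 j).
have sq : smooth_on setT q.
  move=> k; apply: Ck_sum => [|j]; first exact: openT.
  have H : Ck k setT (fun w : 'rV[R]_m => w 0 j - v 0 j).
    by apply: CkD; [exact: openT|exact: Ck_coord|exact: Ck_cst].
  by apply: CkM; [exact: openT| |].
(* With q the squared Euclidean distance to v, the cutoff a / (a + b) is 1 for q <= c and 0 for q >=
   2 c = r^2. A point at sup distance at least r has q >= r^2. *)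
pose c := r * r / 2.
have c0 : 0 < c by rewrite /c divr_gt0 // mulr_gt0.
pose a w := flat 1 (2 * c - q w).
pose b w := flat 1 (q w - c).
have sa : smooth_on setT a.
  apply: smooth_on_flat => // [|k]; first exact: openT.
  apply: Ck_eq (CkD openT (Ck_cst k setT (2 * c))
    (CkM openT (Ck_cst k setT (-1)) (sq k))) => // [|w _]; first exact: openT.
  by rewrite /= mulN1r.
have sb : smooth_on setT b.
  apply: smooth_on_flat => // [|k]; first exact: openT.
  exact: CkD openT (sq k) (Ck_cst k setT (- c)).
have ab0 w : 0 < a w + b w.
  have [qc|qc] := ltP (q w) (2 * c).
    by rewrite ltr_wpDr ?flat1_ge0 // flat1_gt0 // subr_gt0.
  rewrite ltr_wpDl ?flat1_ge0 // flat1_gt0 // subr_gt0; lra.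
exists (fun w => a w * (a w + b w)^-1); split.
- move=> k; apply: CkM; [exact: openT|exact: sa|].
  apply: Ck_inv => [|w _|]; [exact: openT|by rewrite gt_eqF|].
  by apply: CkD; [exact: openT|exact: sa|exact: sb].
- have cq : {for v, continuous q} := Ck_cont (sq 0%N) I.
  have qv : q v = 0 by rewrite /q big1 // => j _; rewrite subrr mul0r.
  have : \forall w \near v, q w < c.
    by apply: (cvgr_lt (q v)) cq _ _; rewrite qv.
  apply: filterS => w qc; have b0 : b w = 0 by rewrite /b flat0 // subr_le0 ltW.
  by have := ab0 w; rewrite b0 addr0 => a0; rewrite mulfV // gt_eqF.
- move=> w rw; rewrite /a flat0 ?mul0r // subr_le0 /c mulrCA mulfV // mulr1.
  have sj j : (w 0 j - v 0 j) ^+ 2 <= q w.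
    rewrite /q (bigD1 j) //= -expr2 lerDl; apply: sumr_ge0 => i _.
    by rewrite -expr2 sqr_ge0.
  have q0 : 0 <= q w by apply: sumr_ge0 => j _; rewrite -expr2 sqr_ge0.
  have : r <= Num.sqrt (q w).
    apply: (le_trans rw); apply: row_norm_lub => [|j]; first exact: sqrtr_ge0.
    by rewrite !mxE -sqrtr_sqr ler_wsqrtr.
  move=> rq; rewrite -(sqr_sqrtr q0) -expr2.
  by apply: lerXn2r => //; rewrite nnegrE ?sqrtr_ge0 ?ltW.
Qed.

End Bump.

(** * Manifolds *)

Section SmoothAt.
Context {R : realType}.

Definition smooth_at m (f : 'rV[R]_m -> R) (v : 'rV[R]_m) :=
  exists V, [/\ open V, V v & smooth_on V f].

(** Trades the choice of an open set for a statement about all nearby points, so that several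
    smoothness conditions combine by filter lemmas. *)
Lemma smooth_at_nearP m (f : 'rV[R]_m -> R) v :
  smooth_at f v <-> \forall w \near v, smooth_on [set w] f.
Proof.
split=> [[V [oV Vv sf]]|H].
  have := open_nbhs_nbhs (conj oV Vv); apply: filterS => w Vw k.
  by apply: Ck_sub (sf k) => _ ->.
exists [set w | smooth_on [set w] f]°; split => //; first exact: open_interior.
by move=> k; apply/Ck_pt => w /interior_subset; exact.
Qed.

Lemma smooth_on_at m (V : set 'rV[R]_m) f : open V ->
  smooth_on V f <-> forall v, V v -> smooth_at f v.
Proof.
move=> oV; split=> [sf v Vv|H k]; first by exists V.
apply/Ck_pt => v /H /smooth_at_nearP /nbhs_singleton; exact.
Qed.

Lemma smooth_at_pt m (f : 'rV[R]_m -> R) v : smooth_at f v -> smooth_on [set v] f.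
Proof. by move=> /smooth_at_nearP /nbhs_singleton. Qed.

Lemma smooth_at_eq m (f g : 'rV[R]_m -> R) v :
  (\forall w \near v, f w = g w) -> smooth_at f v -> smooth_at g v.
Proof.
move=> fg /smooth_at_nearP sf; apply/smooth_at_nearP.
have nfg : \forall w \near v, \forall w' \near w, f w' = g w' := near_join fg.
by apply: filterS2 nfg sf => w fgw sw k; exact: Ck_near_eq fgw (sw k).
Qed.

Section Ops.
Context {m : nat}.
Implicit Types (f g : 'rV[R]_m -> R) (v : 'rV[R]_m).

Lemma smooth_at_cst c v : smooth_at (cst c) v.
Proof. by exists setT; split => //; [exact: openT|move=> k; exact: Ck_cst]. Qed.

Lemma smooth_at_coord j v : smooth_at (fun w : 'rV[R]_m => w 0 j) v.
Proof. by exists setT; split => //; [exact: openT|move=> k; exact: Ck_coord]. Qed.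

Lemma smooth_atD f g v : smooth_at f v -> smooth_at g v -> smooth_at (f \+ g) v.
Proof.
move=> [V [oV Vv sf]] [W [oW Wv sg]]; exists (V `&` W).
have oVW := openI oV oW; split=> // k.
by apply: CkD => //; [apply: Ck_sub (sf k)|apply: Ck_sub (sg k)] => w [].
Qed.

Lemma smooth_atM f g v : smooth_at f v -> smooth_at g v -> smooth_at (f \* g) v.
Proof.
move=> [V [oV Vv sf]] [W [oW Wv sg]]; exists (V `&` W).
have oVW := openI oV oW; split=> // k.
by apply: CkM => //; [apply: Ck_sub (sf k)|apply: Ck_sub (sg k)] => w [].
Qed.

Lemma smooth_at_partial f v i : smooth_at f v -> smooth_at (partial i f) v.
Proof.
by move=> [V [oV Vv sf]]; exists V; split => // k; exact: Ck_partial (sf k.+1).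
Qed.

Lemma smooth_at_continuous f v : smooth_at f v -> {for v, continuous f}.
Proof. by move=> /smooth_at_pt /(_ 0%N) /Ck_cont; exact. Qed.

Lemma smooth_at_derivable f v i : smooth_at f v -> derivable f v (basis_vec R i).
Proof. by move=> /smooth_at_pt /(_ 1%N) /Ck_deriv; exact. Qed.

Lemma smooth_at_differentiable f v : smooth_at f v -> differentiable f v.
Proof. by move=> [V [oV Vv sf]]; exact: C1_open_differentiable oV (sf 1%N) Vv. Qed.

Lemma smooth_at_schwarz f v i j : smooth_at f v ->
  partial i (partial j f) v = partial j (partial i f) v.
Proof. by move=> [V [oV Vv sf]]; exact: schwarz oV (sf 2%N) Vv. Qed.

Lemma partialD f g v i : smooth_at f v -> smooth_at g v ->
  partial i (f \+ g) v = partial i f v + partial i g v.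
Proof. by move=> sf sg; rewrite /partial deriveD //; exact: smooth_at_derivable. Qed.

Lemma partialM f g v i : smooth_at f v -> smooth_at g v ->
  partial i (f \* g) v = f v * partial i g v + g v * partial i f v.
Proof. by move=> sf sg; rewrite /partial deriveM //; exact: smooth_at_derivable. Qed.

Lemma partial_cst i (c : R) v : partial i (cst c) v = 0.
Proof. by rewrite /partial derive_cst. Qed.

Lemma partial_near f g v i :
  (\forall w \near v, f w = g w) -> partial i f v = partial i g v.
Proof. exact: near_eq_derive. Qed.

End Ops.

Lemma smooth_at_comp l m (T : 'rV[R]_l -> 'rV[R]_m) (f : 'rV[R]_m -> R) v :
  (forall j, smooth_at (fun w => T w 0 j) v) -> smooth_at f (T v) ->
  smooth_at (f \o T) v.
Proof.
move=> sT [W [oW WT sf]].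
have nT' j : \forall w \near v, smooth_on [set w] (fun w => T w 0 j).
  exact/smooth_at_nearP.
have nT := filter_forall (nbhs_filter v) nT'.
have nW : \forall w \near v, W (T w).
  have cT : {for v, continuous T}.
    by apply: continuous_row => j; exact: smooth_at_continuous.
  by apply: (cT W); exact: open_nbhs_nbhs.
pose S := [set w | (forall j, smooth_on [set w] (fun w => T w 0 j)) /\ W (T w)].
have nS : nbhs v S := filterI nT nW.
exists S°; split; [exact: open_interior|exact: nS|move=> k].
apply: (@Ck_comp R k l m S° W) => //; first exact: open_interior.
  by move=> w /interior_subset [].
by move=> j; apply/Ck_pt => w /interior_subset [+ _] => /(_ j); exact.
Qed.

Lemma partial_comp_at l m (T : 'rV[R]_l -> 'rV[R]_m) (f : 'rV[R]_m -> R) v i :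
  (forall j, smooth_at (fun w => T w 0 j) v) -> smooth_at f (T v) ->
  partial i (f \o T) v =
    \sum_j partial j f (T v) * partial i (fun w => T w 0 j) v.
Proof.
move=> sT sf; apply: (partial_comp (smooth_at_differentiable sf) _).2 => j.
exact: smooth_at_derivable.
Qed.

End SmoothAt.

(** * Germs of smooth functions on a manifold, cutoffs, smooth maps *)

Section Manifolds.
Context {R : realType}.

Section OneManifold.
Context {n : nat} {M : manifold R n}.
Implicit Types (c : chart R M n) (f g : M -> R) (p q : M).

Lemma cimgP c v : cimg c v -> cdom c (cinv c v) /\ cmap c (cinv c v) = v.
Proof. by move=> [p cp <-]; rewrite cmapK. Qed.

Lemma cimg_cmap c p : cdom c p -> cimg c (cmap c p).
Proof. by move=> cp; exists p. Qed.

Lemma near_cdom c p : cdom c p -> \forall q \near p, cdom c q.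
Proof. by move=> cp; apply: open_nbhs_nbhs; split=> //; exact: cdom_open. Qed.

Lemma near_cimg c p : cdom c p -> \forall v \near cmap c p, cimg c v.
Proof.
by move=> cp; apply: open_nbhs_nbhs; split; [exact: cimg_open|exact: cimg_cmap].
Qed.

Lemma near_cinv c p (P : set M) : cdom c p -> (\forall q \near p, P q) ->
  \forall v \near cmap c p, P (cinv c v).
Proof.
move=> cp nP; have nP' : nbhs (cinv c (cmap c p)) P by rewrite cmapK.
exact: cinv_continuous (cimg_cmap cp) _ nP'.
Qed.

Lemma near_cmap c p (P : set 'rV[R]_n) : cdom c p ->
  (\forall v \near cmap c p, P v) -> \forall q \near p, P (cmap c q).
Proof. by move=> cp nP; exact: cmap_continuous cp _ nP. Qed.

Lemma atlas_max c : atlas c -> max_atlas c.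
Proof. by move=> ac c' ac'; split; exact: atlas_compat. Qed.

Lemma transition_at c c' p i : smooth_transition c c' -> cdom c p -> cdom c' p ->
  smooth_at (fun v => cmap c' (cinv c v) 0 i) (cmap c p).
Proof.
move=> st cp c'p; apply/smooth_at_nearP.
apply: filterS2 (near_cimg cp) (near_cinv cp (near_cdom c'p)) => v vc vc' k.
apply: Ck_sub (st i k) => _ ->.
by have [vd vv] := cimgP vc; exists (cinv c v).
Qed.

(** Charts of the maximal atlas are by definition compatible with those of the atlas; near p the
    transition between two of them factors through a chart c0 of the atlas. Affine coordinates are
    charts of this kind. *)
Lemma max_transition c c' p i : max_atlas c -> max_atlas c' ->
  cdom c p -> cdom c' p ->
  smooth_at (fun v => cmap c' (cinv c v) 0 i) (cmap c p).
Proof.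
move=> mc mc' cp c'p; have [c0 ac0 c0p] := atlas_cover p.
have s1 j := transition_at j (mc c0 ac0).1 cp c0p.
have s2 := transition_at i (mc' c0 ac0).2 c0p c'p.
have E : cmap c0 (cinv c (cmap c p)) = cmap c0 p by rewrite cmapK.
rewrite -E in s2; apply: smooth_at_eq (smooth_at_comp s1 s2).
have := near_cinv cp (near_cdom c0p); apply: filterS => v c0v.
by rewrite /= cmapK.
Qed.

Definition smf f p := exists2 c, max_atlas c &
  cdom c p /\ smooth_at (f \o cinv c) (cmap c p).

Lemma smf_chart c f p : max_atlas c -> cdom c p ->
  smf f p <-> smooth_at (f \o cinv c) (cmap c p).
Proof.
move=> mc cp; split=> [[c' mc' [c'p sf]]|sf]; last by exists c.
have s1 j := max_transition j mc mc' cp c'p.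
have E : cmap c' (cinv c (cmap c p)) = cmap c' p by rewrite cmapK.
rewrite -E in sf; apply: smooth_at_eq (smooth_at_comp s1 sf).
have := near_cinv cp (near_cdom c'p); apply: filterS => v c'v.
by rewrite /= cmapK.
Qed.

Lemma max_atlas_ex p : exists2 c, max_atlas c & cdom c p.
Proof. by have [c /atlas_max mc cp] := atlas_cover p; exists c. Qed.

Lemma CinfP f : Cinf f <-> forall p, smf f p.
Proof.
split=> [H p|H c ac].
  have [c ac cp] := atlas_cover p; exists c; first exact: atlas_max.
  split=> //; apply: (smooth_on_at _ _).1 (H c ac) _ (cimg_cmap cp).
  exact: cimg_open.
apply/smooth_on_at => [|_ [p cp <-]]; first exact: cimg_open.
by apply/smf_chart => //; exact: atlas_max.
Qed.

Lemma smf_eq f g p : (\forall q \near p, f q = g q) -> smf f p -> smf g p.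
Proof.
move=> fg [c mc [cp sf]]; exists c => //; split=> //.
by apply: smooth_at_eq sf; exact: (near_cinv cp fg).
Qed.

Lemma smf_continuous f p : smf f p -> {for p, continuous f}.
Proof.
move=> [c mc [cp sf]].
have : {for p, continuous ((f \o cinv c) \o cmap c)}.
  by apply: continuous_comp; [exact: cmap_continuous|exact: smooth_at_continuous].
apply: near_eq_continuous_at.
by have := near_cdom cp; apply: filterS => q cq; rewrite /= cmapK.
Qed.

Lemma smf_cst (a : R) p : smf (cst a) p.
Proof.
by have [c mc cp] := max_atlas_ex p; exists c => //; split=> //; exact: smooth_at_cst.
Qed.

Lemma smfD f g p : smf f p -> smf g p -> smf (f \+ g) p.
Proof.
have [c mc cp] := max_atlas_ex p => /(smf_chart _ mc cp) sf /(smf_chart _ mc cp) sg.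
by exists c => //; split=> //; exact: smooth_atD sf sg.
Qed.

Lemma smfM f g p : smf f p -> smf g p -> smf (f \* g) p.
Proof.
have [c mc cp] := max_atlas_ex p => /(smf_chart _ mc cp) sf /(smf_chart _ mc cp) sg.
by exists c => //; split=> //; exact: smooth_atM sf sg.
Qed.

Lemma smfZ (a : R) f p : smf f p -> smf (fun q => a * f q) p.
Proof. by move=> sf; apply: smfM sf; exact: smf_cst. Qed.

Lemma smfN f p : smf f p -> smf (fun q => - f q) p.
Proof.
by move=> /(smfZ (-1)); apply: smf_eq; apply: nearW => q; rewrite mulN1r.
Qed.

Lemma smfB f g p : smf f p -> smf g p -> smf (fun q => f q - g q) p.
Proof. by move=> sf /smfN; exact: smfD. Qed.

Lemma smf_sum (I : Type) (r : seq I) (F : I -> M -> R) p :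
  (forall i, smf (F i) p) -> smf (fun q => \sum_(i <- r) F i q) p.
Proof.
move=> H; elim: r => [|i r IH].
  by apply: smf_eq (smf_cst 0 p); apply: nearW => q; rewrite big_nil.
by apply: smf_eq (smfD (H i) IH); apply: nearW => q; rewrite big_cons.
Qed.

Lemma smf_coord c p i : max_atlas c -> cdom c p -> smf (fun q => cmap c q 0 i) p.
Proof.
move=> mc cp; exists c => //; split=> //.
apply: smooth_at_eq (smooth_at_coord i _).
by have := near_cimg cp; apply: filterS => v /cimgP[_ /= ->].
Qed.

Lemma smf_partial c f p i : max_atlas c -> cdom c p -> smf f p ->
  smf (fun q => partial i (f \o cinv c) (cmap c q)) p.
Proof.
move=> mc cp /(smf_chart _ mc cp) sf; exists c => //; split=> //.
apply: smooth_at_eq (smooth_at_partial i sf).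
by have := near_cimg cp; apply: filterS => v /cimgP[_ /= ->].
Qed.

Lemma smf_comp m (h : 'rV[R]_m -> R) (T : M -> 'rV[R]_m) p :
  (forall j, smf (fun q => T q 0 j) p) -> smooth_at h (T p) -> smf (h \o T) p.
Proof.
have [c mc cp] := max_atlas_ex p => sT sh.
exists c => //; split=> //.
have sT' j : smooth_at (fun v => (T \o cinv c) v 0 j) (cmap c p).
  by have /(smf_chart _ mc cp) := sT j.
by apply: (smooth_at_comp sT'); rewrite /= cmapK.
Qed.

(** Says that the closed support of chi lies in U, in the pointwise form that extension by zero
    uses: one case for each alternative. *)
Definition supported_in (chi : M -> R) (U : set M) :=
  forall q, U q \/ \forall q' \near q, chi q' = 0.

(** A cutoff of R^n is transported by a chart and extended by zero. The extension is smooth because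
    the image K of a closed ball is compact, hence closed in a Hausdorff space. *)
Lemma cutoff_ex (U : set M) p : open U -> U p ->
  exists chi, [/\ Cinf chi, \forall q \near p, chi q = 1 & supported_in chi U].
Proof.
move=> oU Up; have [c mc cp] := max_atlas_ex p.
have nU : \forall v \near cmap c p, cimg c v /\ U (cinv c v).
  apply: filterI; first exact: near_cimg.
  by apply: near_cinv => //; exact: open_nbhs_nbhs.
have [d d0 dU] := near_ball_shift nU.
pose r := d / 2; have r0 : 0 < r by rewrite divr_gt0.
have [chi0 [schi0 chi1 chi00]] := cutoff_row (cmap c p) r0.
pose B := [set v : 'rV[R]_n | `|v - cmap c p| <= r].
have BU v : B v -> cimg c v /\ U (cinv c v).
  move=> Bv; rewrite -(subrK (cmap c p) v) addrC; apply: dU.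
  by apply: le_lt_trans Bv _; rewrite /r; lra.
have cB : compact B.
  apply: bounded_closed_compact.
    exists (r + `|cmap c p|); split; first exact: num_real.
    move=> x rx v Bv /=; apply: ltW; apply: le_lt_trans rx.
    by rewrite -(subrK (cmap c p) v); apply: (le_trans (ler_normD _ _)); rewrite lerD2r.
  have -> : B = closed_ball_ Num.norm (cmap c p) r.
    by apply/seteqP; split=> v; rewrite /B /closed_ball_ /= distrC.
  exact: (@closed_closed_ball_ R 'rV[R]_n).
pose K := cinv c @` B.
have cK : closed K.
  apply: compact_closed; first exact: manifold_hausdorff.
  apply: continuous_compact => //; apply: continuous_in_subspaceT => v.
  by rewrite inE => /BU[vc _]; exact: cinv_continuous.
pose chi q := if pselect (cdom c q) then chi0 (cmap c q) else 0.
have chiE q : cdom c q -> chi q = chi0 (cmap c q) by rewrite /chi; case: pselect.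
have chiK q : ~ K q -> \forall q' \near q, chi q' = 0.
  move=> nKq; have : nbhs q (~` K).
    by apply: open_nbhs_nbhs; split=> //; exact: closed_openC.
  apply: filterS => q' nKq'; rewrite /chi; case: pselect => // cq'.
  apply: chi00; rewrite leNgt; apply/negP => lt; apply: nKq'.
  by exists (cmap c q'); [exact: ltW|exact: cmapK].
have KU q : K q -> cdom c q /\ U q by move=> [v /BU[/cimgP[vd vv] Uv] <-].
exists chi; split.
- apply/CinfP => q; have [cq|ncq] := pselect (cdom c q).
    have : smf (chi0 \o cmap c) q.
      apply: smf_comp => [j|]; first exact: smf_coord.
      by exists setT; split=> //; exact: openT.
    apply: smf_eq; have := near_cdom cq; apply: filterS => q' cq'.
    by rewrite chiE.
  apply: smf_eq (smf_cst 0 q); have : ~ K q by move=> /KU[].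
  by move=> /chiK; apply: filterS => q' ->.
- by apply: filterS2 (near_cdom cp) (near_cmap cp chi1) => q cq cq1; rewrite chiE.
- move=> q; have [Kq|/chiK] := pselect (K q); last by right.
  by left; case: (KU q Kq).
Qed.

Lemma Cinf_supported chi (U : set M) f : Cinf chi -> supported_in chi U ->
  (forall q, U q -> smf f q) -> Cinf (chi \* f).
Proof.
move=> /CinfP schi supp sf; apply/CinfP => q; have [Uq|chi0] := supp q.
  by apply: smfM => //; exact: sf.
apply: smf_eq (smf_cst 0 q); apply: filterS chi0 => q' /= ->.
by rewrite mul0r.
Qed.

Lemma Cinf_cst (a : R) : Cinf (cst a : M -> R).
Proof. by apply/CinfP => p; exact: smf_cst. Qed.

Lemma CinfD f g : Cinf f -> Cinf g -> Cinf (f \+ g).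
Proof. by move=> /CinfP sf /CinfP sg; apply/CinfP => p; exact: smfD. Qed.

Lemma CinfM f g : Cinf f -> Cinf g -> Cinf (f \* g).
Proof. by move=> /CinfP sf /CinfP sg; apply/CinfP => p; exact: smfM. Qed.

Lemma CinfB f g : Cinf f -> Cinf g -> Cinf (fun q => f q - g q).
Proof. by move=> /CinfP sf /CinfP sg; apply/CinfP => p; exact: smfB. Qed.

Lemma CinfN f : Cinf f -> Cinf (fun q => - f q).
Proof. by move=> /CinfP sf; apply/CinfP => p; exact: smfN. Qed.

Lemma Cinf_sum (I : Type) (r : seq I) (F : I -> M -> R) :
  (forall i, Cinf (F i)) -> Cinf (fun q => \sum_(i <- r) F i q).
Proof.
by move=> sF; apply/CinfP => p; apply: smf_sum => i; have /CinfP := sF i.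
Qed.

End OneManifold.

(** Smoothness is tested by pulling back germs of functions, so that composing with functions needs
    no coordinates. *)
Definition smooth_map_at m n (M : manifold R m) (N : manifold R n) (phi : M -> N)
    (p : M) :=
  {for p, continuous phi} /\ forall g, smf g (phi p) -> smf (g \o phi) p.

Lemma smooth_mapP m n (M : manifold R m) (N : manifold R n) (phi : M -> N) :
  smooth_map phi <-> forall p, smooth_map_at phi p.
Proof.
split=> [[cphi sphi] p|H].
  split=> [|g sg]; first exact: cphi.
  have [c ac cp] := atlas_cover p; have [c' ac' c'p] := atlas_cover (phi p).
  have nd : \forall q \near p, cdom c' (phi q).
    by apply: (cphi p); exact: near_cdom.
  have sT j : smf (fun q => cmap c' (phi q) 0 j) p.
    exists c; first exact: atlas_max.
    split=> //; apply/smooth_at_nearP.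
    apply: filterS2 (near_cimg cp) (near_cinv cp nd) => v vc vc' k.
    apply: Ck_sub (sphi c c' ac ac' j k) => _ ->.
    by have [vd vv] := cimgP vc; exists (cinv c v).
  have sg' : smooth_at (g \o cinv c') (cmap c' (phi p)).
    by apply/smf_chart => //; exact: atlas_max.
  apply: smf_eq (smf_comp sT sg').
  by apply: filterS nd => q c'q; rewrite /= cmapK.
split=> [p|c c' ac ac' i]; first by case: (H p).
move=> k; apply/Ck_pt => _ [p [cp c'p] <-].
apply: smooth_at_pt; have [cphi sphi] := H p.
have := sphi _ (smf_coord i (atlas_max ac') c'p).
by move/(smf_chart _ (atlas_max ac) cp).
Qed.

End Manifolds.

(** * AV-bundles *)

Section AVGeom.
Context {R : realType} {n : nat} {M : manifold R n} {Z : AVbundle M}.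
Implicit Types (c : chart R M n) (cz : chart R Z (n + 1)) (x y : M) (z : Z).

Definition sco cz z : R := cmap cz z 0 (rshift n ord0).

Section Affine.
Context {c : chart R M n} {cz : chart R Z (n + 1)} (ac : affine_coords c cz).

Lemma affine_max : max_atlas c. Proof. by case: ac. Qed.
Lemma affine_maxz : max_atlas cz. Proof. by case: ac. Qed.

Lemma cdomzE z : cdom cz z <-> cdom c (zeta z).
Proof. by case: ac => _ _ ->. Qed.

Lemma cmapz_l z j : cdom c (zeta z) -> cmap cz z 0 (lshift 1 j) = cmap c (zeta z) 0 j.
Proof. by case: ac => _ _ E H /cdomzE /H[<- _]; rewrite mxE. Qed.

Lemma lsub_cmapz z : cdom c (zeta z) -> lsubmx (cmap cz z) = cmap c (zeta z).
Proof. by case: ac => _ _ E H /cdomzE /H[]. Qed.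

Lemma scoD z t : cdom c (zeta z) -> sco cz (av_add z t) = sco cz z + t.
Proof.
case: ac => _ _ E H /cdomzE /H[_ /(_ t)]; rewrite /sco => ->.
by rewrite mxE row_mxEr mxE eqxx.
Qed.

Lemma cmapzE z : cdom c (zeta z) -> cmap cz z = row_mx (cmap c (zeta z)) (sco cz z)%:M.
Proof.
move=> cx; rewrite -[LHS]hsubmxK lsub_cmapz //; congr row_mx.
by apply/matrixP => i j; rewrite !ord1 !mxE eqxx.
Qed.

Lemma sco_sub z z' : zeta z' = zeta z -> cdom c (zeta z) ->
  av_sub z' z = sco cz z' - sco cz z.
Proof.
move=> e cx; have := scoD (av_sub z' z) cx; rewrite av_subK // => ->.
by rewrite addrC addKr.
Qed.

Lemma sco_smf z : cdom c (zeta z) -> smf (sco cz) z.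
Proof. by move=> cx; apply: smf_coord; [exact: affine_maxz|exact/cdomzE]. Qed.

Definition zero_section y : Z := cinv cz (row_mx (cmap c y) 0).

Lemma cimgzP y (s : R) : cdom c y -> cimg cz (row_mx (cmap c y) s%:M).
Proof.
move=> cy; have [z zy] := zeta_surj Z y.
exists (av_add z (s - sco cz z)); first by apply/cdomzE; rewrite zeta_av_add zy.
rewrite cmapzE ?zeta_av_add ?zy // scoD ?zy //.
by rewrite addrC subrK.
Qed.

Lemma cinvzP y (s : R) : cdom c y ->
  let z := cinv cz (row_mx (cmap c y) s%:M) in zeta z = y /\ sco cz z = s.
Proof.
move=> cy /=; have [zd zE] := cimgP (cimgzP s cy).
set z := cinv cz _ in zd zE *; move/cdomzE in zd.
have E := lsub_cmapz zd; split.
  by rewrite zE row_mxKl in E; rewrite -(cmapK zd) -E cmapK.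
by rewrite /sco zE row_mxEr mxE eqxx.
Qed.

Lemma zero_sectionP y : cdom c y -> zeta (zero_section y) = y /\ sco cz (zero_section y) = 0.
Proof.
by move=> cy; have := cinvzP 0 cy; rewrite /zero_section raddf0.
Qed.

End Affine.

Lemma affine_ex x : exists c cz, cdom c x /\ affine_coords c cz.
Proof. by have [c [cz cx ac]] := locally_trivial Z x; exists c, cz. Qed.

Lemma zeta_smooth z : smooth_map_at (@zeta _ _ _ Z) z.
Proof.
have [c [cz [cx ac]]] := affine_ex (zeta z).
have cz_z : cdom cz z by apply/(cdomzE ac).
have nd : \forall z' \near z, cdom c (zeta z').
  by apply: filterS (near_cdom cz_z) => z' /(cdomzE ac).
pose T (z' : Z) : 'rV[R]_n := lsubmx (cmap cz z').
have sT j : smf (fun z' => T z' 0 j) z.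
  apply: smf_eq (smf_coord (lshift 1 j) (affine_maxz ac) cz_z).
  by apply: nearW => z'; rewrite mxE.
have TE z' : cdom c (zeta z') -> T z' = cmap c (zeta z') by move=> /(lsub_cmapz ac).
split.
  have : {for z, continuous (cinv c \o T)}.
    apply: continuous_comp; first by apply: continuous_row => j; exact: smf_continuous.
    by rewrite TE //; apply: cinv_continuous; exact: cimg_cmap.
  apply: near_eq_continuous_at; apply: filterS nd => z' cz' /=.
  by rewrite TE // cmapK.
move=> g /(smf_chart _ (affine_max ac) cx) sg; rewrite -TE // in sg.
apply: smf_eq (smf_comp sT sg); apply: filterS nd => z' cz' /=.
by rewrite TE // cmapK.
Qed.

Lemma Cinf_zeta (h : M -> R) : Cinf h -> Cinf (h \o @zeta _ _ _ Z).
Proof. by move=> /CinfP sh; apply/CinfP => z; case: (zeta_smooth z) => _; exact. Qed.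

Lemma near_zeta z (P : set M) : (\forall x \near zeta z, P x) ->
  \forall z' \near z, P (zeta z').
Proof. by move=> nP; have [cz _] := zeta_smooth z; exact: cz. Qed.

(** Near x the section is [cinv cz] applied to the pair of [cmap c y] and u(y), so only its fibre
    coordinate u has to be smooth. *)
Lemma smooth_section_at c cz (sigma : M -> Z) (u : M -> R) x :
  affine_coords c cz -> cdom c x ->
  (\forall y \near x, zeta (sigma y) = y /\ sco cz (sigma y) = u y) ->
  smf u x -> smooth_map_at sigma x.
Proof.
move=> ac cx nsu su.
pose T (y : M) : 'rV[R]_(n + 1) := row_mx (cmap c y) (u y)%:M.
have nT : \forall y \near x, [/\ zeta (sigma y) = y, cdom cz (sigma y) &
    T y = cmap cz (sigma y)].
  apply: filterS2 (near_cdom cx) nsu => y cy [sy uy].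
  by split=> //; [apply/(cdomzE ac); rewrite sy|rewrite (cmapzE ac) sy // uy].
have sT j : smf (fun y => T y 0 j) x.
  have [j' ->|j' ->] := split_ordP j.
    apply: smf_eq (smf_coord j' (affine_max ac) cx).
    by apply: nearW => y; rewrite row_mxEl.
  by apply: smf_eq su; apply: nearW => y; rewrite row_mxEr ord1 mxE eqxx.
have [sx zx Tx] := nbhs_singleton nT.
split.
  have : {for x, continuous (cinv cz \o T)}.
    apply: continuous_comp; first by apply: continuous_row => j; exact: smf_continuous.
    by rewrite Tx; apply: cinv_continuous; exact: cimg_cmap.
  apply: near_eq_continuous_at; apply: filterS nT => y [_ zy Ty] /=.
  by rewrite Ty cmapK.
move=> g /(smf_chart _ (affine_maxz ac) zx) sg; rewrite -Tx in sg.
apply: smf_eq (smf_comp sT sg); apply: filterS nT => y [_ zy Ty] /=.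
by rewrite Ty cmapK.
Qed.

Lemma SecP (sigma : M -> Z) : Sec sigma <->
  (forall x, zeta (sigma x) = x) /\ forall x, smooth_map_at sigma x.
Proof. by split=> -[? /smooth_mapP]. Qed.

Lemma Sec_sco c cz (sigma : M -> Z) x : affine_coords c cz -> cdom c x ->
  Sec sigma -> smf (sco cz \o sigma) x.
Proof.
move=> ac cx /SecP[sx /(_ x)[_ ss]]; apply: ss; apply: (sco_smf ac).
by rewrite sx.
Qed.

Lemma Sec_comp (sigma : M -> Z) (g : Z -> R) : Sec sigma -> Cinf g -> Cinf (g \o sigma).
Proof.
move=> /SecP[sx ss] /CinfP sg; apply/CinfP => x; have [_ H] := ss x; exact: H.
Qed.

Lemma Sec_add (sigma : M -> Z) (h : M -> R) : Sec sigma -> Cinf h -> Sec (sec_add sigma h).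
Proof.
move=> Hs sh; have [sx ss] := (SecP _).1 Hs; apply/SecP.
split=> x; first by rewrite zeta_av_add.
have [c [cz [cx ac]]] := affine_ex x.
apply: (@smooth_section_at c cz _ (fun y => sco cz (sigma y) + h y)) => //.
  have := near_cdom cx; apply: filterS => y cy.
  by rewrite /sec_add zeta_av_add sx (scoD ac) ?sx.
apply: smfD; first exact: Sec_sco ac cx Hs.
by move/CinfP : sh; exact.
Qed.

Lemma FsecE c cz (sigma : M -> Z) z : affine_coords c cz -> cdom c (zeta z) ->
  (forall x, zeta (sigma x) = x) ->
  Fsec sigma z = sco cz (sigma (zeta z)) - sco cz z.
Proof. by move=> ac cx sx; rewrite /Fsec (sco_sub ac) // sx. Qed.

Lemma Cinf_Fsec (sigma : M -> Z) : Sec sigma -> Cinf (Fsec sigma).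
Proof.
move=> Hs; have [sx _] := (SecP _).1 Hs; apply/CinfP => z.
have [c [cz [cx ac]]] := affine_ex (zeta z).
have nE : \forall z' \near z, sco cz (sigma (zeta z')) - sco cz z' = Fsec sigma z'.
  by have := near_zeta (near_cdom cx); apply: filterS => z' /(FsecE ac) ->.
apply: smf_eq nE _; apply: smfB; last exact: sco_smf ac _ _.
by have [_ H] := zeta_smooth z; apply: (H (sco cz \o sigma)); exact: Sec_sco ac cx Hs.
Qed.

(** What survives globally of a local fibre coordinate: multiplied by the cutoff chi, it is affine
    on each fibre with slope chi. *)
Definition partial_coordinate (chi : M -> R) (S : Z -> R) :=
  [/\ Cinf chi, Cinf S & forall z t, S (av_add z t) = S z + chi (zeta z) * t].

Lemma partial_coordinate_ex x : exists chi S,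
  partial_coordinate chi S /\ \forall y \near x, chi y = 1.
Proof.
have [c [cz [cx ac]]] := affine_ex x.
have [chi [schi chi1 supp]] := cutoff_ex (cdom_open c) cx.
exists chi, ((chi \o @zeta _ _ _ Z) \* sco cz); split=> //; split=> //.
  apply: (@Cinf_supported _ _ _ (chi \o @zeta _ _ _ Z) [set z | cdom c (zeta z)]).
  - exact: Cinf_zeta.
  - by move=> z; have [cz'|/near_zeta] := supp (zeta z); [left|right].
  - by move=> z /= cz'; exact: sco_smf ac _ cz'.
move=> z t /=; rewrite zeta_av_add; have [cz'|/nbhs_singleton ->] := supp (zeta z).
  by rewrite (scoD ac) // mulrDr.
by rewrite !mul0r addr0.
Qed.

(** Second countability makes the cover a sequence. An injection into nat numbers the basic open
    sets, and k receives a coordinate whose cutoff is 1 on the set numbered k when there is one; the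
    zero coordinate fills the other indices. *)
Lemma partial_coordinate_cover : exists (chi : nat -> M -> R) (S : nat -> Z -> R),
  (forall k, partial_coordinate (chi k) (S k)) /\
  forall x, exists k, \forall y \near x, chi k y = 1.
Proof.
have [B /countable_injP[f finj] [Bo Bb]] := manifold_second_countable M.
pose good (k : nat) (d : (M -> R) * (Z -> R)) := exists b, [/\ B b, f b = k,
  partial_coordinate d.1 d.2 & forall y, b y -> d.1 y = 1].
have H k : {d : (M -> R) * (Z -> R) | partial_coordinate d.1 d.2 /\
    ((exists d', good k d') -> good k d)}.
  apply: cid; have [[d gd]|ng] := pselect (exists d', good k d').
    by exists d; split=> //; case: gd => b [].
  exists (cst 0, cst 0); split=> //; split; [exact: Cinf_cst|exact: Cinf_cst|].
  by move=> z t; rewrite /= mul0r addr0.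
exists (fun k => (sval (H k)).1), (fun k => (sval (H k)).2); split=> [k|x].
  by case: (svalP (H k)).
have [chi [S [pS chi1]]] := partial_coordinate_ex x.
have [b [Bb' bx] bsub] := Bb x _ chi1.
exists (f b); have [_ /(_ _)] := svalP (H (f b)).
case=> [|b' [Bb'' ff _ d1]]; first by exists (chi, S), b.
have e : b' = b by apply: finj; rewrite ?inE.
have := open_nbhs_nbhs (conj (Bo _ Bb') bx); apply: filterS => y by_.
by apply: d1; rewrite e.
Qed.

Lemma global_coordinate_ex : exists2 T : Z -> R, Cinf T &
  forall z t, T (av_add z t) = T z + t.
Proof.
have [chi [S [pS cov]]] := partial_coordinate_cover.
(* The weights [rho k * chi k] form a partition of unity, locally finite because
   [rho N] vanishes wherever [chi k = 1] for some [k < N]. *)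
pose rho N (x : M) := \prod_(j < N) (1 - chi j x).
have srho N : Cinf (rho N).
  elim: N => [|N IH].
    by have -> : rho 0%N = cst 1; [apply/funext => x; rewrite /rho big_ord0|exact: Cinf_cst].
  have -> : rho N.+1 = rho N \* (fun x => cst 1 x - chi N x).
    by apply/funext => x; rewrite /rho big_ord_recr.
  by apply: CinfM IH _; apply: CinfB; [exact: Cinf_cst|case: (pS N)].
pose T N (z : Z) := \sum_(k < N) rho k (zeta z) * S k z.
have sT N : Cinf (T N).
  apply: (@Cinf_sum _ _ _ 'I_N _ (fun k z => rho k (zeta z) * S k z)) => k.
  by apply: CinfM; [exact: Cinf_zeta|case: (pS k)].
(* The slopes rho k * chi k telescope: their sum over k < N is 1 - rho N. *)
have TD N z t : T N (av_add z t) = T N z + (1 - rho N (zeta z)) * t.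
  elim: N => [|N IH]; first by rewrite /T /rho !big_ord0 subrr mul0r addr0.
  rewrite /T big_ord_recr /= -/(T N _) IH zeta_av_add big_ord_recr /= -/(T N _).
  rewrite /rho big_ord_recr /= -/(rho N _); have [_ _ ->] := pS N; ring.
have rho0 k N x : chi k x = 1 -> (k < N)%N -> rho N x = 0.
  move=> e kN; rewrite /rho (bigD1 (Ordinal kN)) //= e subrr mul0r //.
have Tstab k N z : chi k (zeta z) = 1 -> (k < N)%N -> T N z = T k.+1 z.
  move=> e; elim: N => // N IH; rewrite ltnS leq_eqVlt => /orP[/eqP <- //|kN].
  by rewrite /T big_ord_recr /= (rho0 _ _ _ e kN) mul0r addr0 -/(T N z) IH.
have ex x : exists k, chi k x = 1.
  by have [k /nbhs_singleton] := cov x; exists k.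
(* The chosen index K x may jump with x. As [T N z] stops changing once N exceeds an index whose
   cutoff is 1, the values near a point are nevertheless those of a single smooth function
   [T k.+1]. *)
pose K x := sval (cid (ex x)).
have KP x : chi (K x) x = 1 by exact: svalP (cid (ex x)).
have TE k z : chi k (zeta z) = 1 -> T (K (zeta z)).+1 z = T k.+1 z.
  move=> e; transitivity (T (maxn k (K (zeta z))).+1 z).
    by symmetry; apply: Tstab; rewrite ?ltnS ?leq_maxr.
  by apply: Tstab; rewrite ?ltnS ?leq_maxl.
exists (fun z => T (K (zeta z)).+1 z).
  apply/CinfP => z; have [k chi1] := cov (zeta z).
  have /CinfP /(_ z) := sT k.+1; apply: smf_eq.
  by have := near_zeta chi1; apply: filterS => z' /TE ->.
move=> z t; rewrite zeta_av_add TD; rewrite (rho0 (K (zeta z))) //.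
by rewrite subr0 mul1r.
Qed.

(** The zero set of a global fibre coordinate T meets each fibre exactly once. The points rf x are
    chosen without continuity; smoothness shows in the fibre coordinate of the section, which is - T
    on the local zero section. *)
Lemma Sec_ex : exists sigma : M -> Z, Sec sigma.
Proof.
have [T sT TD] := global_coordinate_ex.
pose rf x := sval (cid (zeta_surj Z x)).
have rfP x : zeta (rf x) = x := svalP (cid (zeta_surj Z x)).
pose sigma x := av_add (rf x) (- T (rf x)).
have sx x : zeta (sigma x) = x by rewrite zeta_av_add.
exists sigma; apply/SecP; split=> // x.
have [c [cz [cx ac]]] := affine_ex x.
pose u y := - T (@zero_section c cz y).
apply: (smooth_section_at (u := u) ac cx).
  have := near_cdom cx; apply: filterS => y cy; split=> //.
  have [zy z0] := zero_sectionP ac cy.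
  rewrite /sigma (scoD ac) ?rfP // /u.
  have E : rf y = av_add (@zero_section c cz y) (av_sub (rf y) (@zero_section c cz y)).
    by rewrite av_subK // rfP.
  rewrite {2}E TD (sco_sub ac) ?zy ?rfP // z0; ring.
have [|_ H] := @smooth_section_at c cz (@zero_section c cz) (cst 0) x ac cx _ (smf_cst 0 x).
  by have := near_cdom cx; apply: filterS => y /(zero_sectionP ac)[].
by apply: smfN; apply: (H T); have /CinfP := sT; exact.
Qed.

(** A global section is shifted by minus its own fibre coordinate, cut off, which brings it to s = 0
    near x. *)
Lemma Sec_zero_ex c cz x : affine_coords c cz -> cdom c x ->
  exists2 sigma : M -> Z, Sec sigma & \forall y \near x, sco cz (sigma y) = 0.
Proof.
move=> ac cx; have [sigma Hs] := Sec_ex; have [sx _] := (SecP _).1 Hs.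
have [chi [schi chi1 supp]] := cutoff_ex (cdom_open c) cx.
pose h := chi \* (fun y => - sco cz (sigma y)).
have sh : Cinf h.
  apply: Cinf_supported schi supp _ => y cy.
  by apply: smfN; exact: (@Sec_sco c cz).
exists (sec_add sigma h); first exact: Sec_add.
apply: filterS2 chi1 (near_cdom cx) => y chi1 cy.
by rewrite /sec_add (scoD ac) ?sx // /h /= chi1 mul1r subrr.
Qed.

End AVGeom.

(** * First-order operators *)

Section FirstOrder.
Context {R : realType} {m : nat} {N : manifold R m}.
Implicit Types (c : chart R N m) (f g : N -> R) (p q : N).

Definition jet_functional c p (a : 'I_m -> R) (a0 : R) g : R :=
  \sum_i a i * partial i (g \o cinv c) (cmap c p) + a0 * g p.

Definition first_order_at (l : (N -> R) -> R) p :=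
  exists2 c, max_atlas c & cdom c p /\
    exists a a0, forall g, Cinf g -> l g = jet_functional c p a a0 g.

Lemma first_order_chart l p c : max_atlas c -> cdom c p -> first_order_at l p ->
  exists a a0, forall g, Cinf g -> l g = jet_functional c p a a0 g.
Proof.
move=> mc cp [c' mc' [c'p [b [b0 lE]]]].
pose tau j v := cmap c (cinv c' v) 0 j.
exists (fun j => \sum_i b i * partial i (tau j) (cmap c' p)), b0 => g sg.
rewrite lE // /jet_functional; congr (_ + _).
have st j : smooth_at (tau j) (cmap c' p) by exact: max_transition.
have E : cmap c (cinv c' (cmap c' p)) = cmap c p by rewrite cmapK.
have sg' : smooth_at (g \o cinv c) (cmap c (cinv c' (cmap c' p))).
  by rewrite E; apply/smf_chart => //; move/CinfP : sg; exact.
have step i : partial i (g \o cinv c') (cmap c' p) =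
    \sum_j partial j (g \o cinv c) (cmap c p) * partial i (tau j) (cmap c' p).
  rewrite -E -(@partial_comp_at R m m (fun v => cmap c (cinv c' v)) (g \o cinv c)) //.
  apply: partial_near.
  have := near_cinv c'p (near_cdom cp); apply: filterS => v cv.
  by rewrite /= cmapK.
under eq_bigr do rewrite step mulr_sumr.
rewrite exchange_big /=; apply: eq_bigr => j _.
by rewrite mulr_suml; apply: eq_bigr => i _; rewrite mulrCA mulrC.
Qed.

Lemma jet_functional_eq c p a a0 f g : cdom c p -> (\forall q \near p, f q = g q) ->
  jet_functional c p a a0 f = jet_functional c p a a0 g.
Proof.
move=> cp fg; rewrite /jet_functional (nbhs_singleton fg); congr (_ + _).
apply: eq_bigr => i _; congr (_ * _); apply: partial_near.
by have := near_cinv cp fg; apply: filterS => v.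
Qed.

Lemma jet_functional_cst c p a a0 (k : R) :
  jet_functional c p a a0 (cst k) = a0 * k.
Proof.
rewrite /jet_functional big1 ?add0r // => i _.
by rewrite -[_ \o _]/(cst k) partial_cst mulr0.
Qed.

Lemma jet_functional_coord c p a a0 f i : cdom c p ->
  (\forall q \near p, f q = cmap c q 0 i) ->
  jet_functional c p a a0 f = a i + a0 * cmap c p 0 i.
Proof.
move=> cp fi; rewrite (jet_functional_eq _ _ cp fi) /jet_functional; congr (_ + _).
have E j : partial j ((fun q => cmap c q 0 i) \o cinv c) (cmap c p) = (j == i)%:R.
  have -> : (j == i)%:R = partial j (fun w : 'rV[R]_m => w 0 i) (cmap c p).
    by rewrite partial_coord.
  by apply: partial_near; have := near_cimg cp; apply: filterS => v /cimgP[_ /= ->].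
rewrite (bigD1 i) //= E eqxx mulr1 big1 ?addr0 // => j ji.
by rewrite E (negbTE ji) mulr0.
Qed.

Lemma jet_functional_comb c p a a0 b b0 (x y : R) g :
  x * jet_functional c p a a0 g + y * jet_functional c p b b0 g =
  jet_functional c p (fun i => x * a i + y * b i) (x * a0 + y * b0) g.
Proof.
rewrite /jet_functional !mulrDr addrACA; congr (_ + _); last by ring.
by rewrite !mulr_sumr -big_split; apply: eq_bigr => i _ /=; ring.
Qed.

Lemma jet_functional_linear c p a a0 (x y : R) f g : max_atlas c -> cdom c p ->
  smf f p -> smf g p ->
  jet_functional c p a a0 (fun q => x * f q + y * g q) =
  x * jet_functional c p a a0 f + y * jet_functional c p a a0 g.
Proof.
move=> mc cp /(smf_chart _ mc cp) sf /(smf_chart _ mc cp) sg.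
rewrite /jet_functional !mulrDr addrACA; congr (_ + _); last by ring.
rewrite !mulr_sumr -big_split; apply: eq_bigr => i _ /=.
have sx h : smooth_at h (cmap c p) -> forall x : R,
    smooth_at (cst x \* h) (cmap c p) /\
    partial i (cst x \* h) (cmap c p) = x * partial i h (cmap c p).
  move=> sh x'; split; first exact: smooth_atM (smooth_at_cst _ _) sh.
  by rewrite partialM //; [rewrite partial_cst mulr0 addr0|exact: smooth_at_cst].
have [s1 e1] := sx _ sf x; have [s2 e2] := sx _ sg y.
have := partialD i s1 s2; rewrite e1 e2 => E.
by rewrite -[X in partial i X]/((cst x \* (f \o cinv c)) \+ (cst y \* (g \o cinv c))) E; ring.
Qed.

Lemma jet_functionalM c p a a0 f g : max_atlas c -> cdom c p ->
  smf f p -> smf g p ->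
  jet_functional c p a a0 (f \* g) = f p * jet_functional c p a a0 g
    + g p * jet_functional c p a a0 f - f p * g p * a0.
Proof.
move=> mc cp /(smf_chart _ mc cp) sf /(smf_chart _ mc cp) sg.
have -> : jet_functional c p a a0 (f \* g) =
    \sum_i (f p * (a i * partial i (g \o cinv c) (cmap c p)) +
     g p * (a i * partial i (f \o cinv c) (cmap c p))) + a0 * (f p * g p).
  rewrite /jet_functional; congr (_ + _); apply: eq_bigr => i _.
  rewrite -[X in partial i X]/((f \o cinv c) \* (g \o cinv c)) partialM //=.
  by rewrite cmapK //; ring.
by rewrite big_split /= -!mulr_sumr /jet_functional; ring.
Qed.

Section Functional.
Context {l : (N -> R) -> R} {p : N} (fo : first_order_at l p).

Lemma first_order_eq f g : Cinf f -> Cinf g ->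
  (\forall q \near p, f q = g q) -> l f = l g.
Proof.
move=> sf sg fg; have [c mc [cp [a [a0 lE]]]] := fo.
by rewrite !lE //; exact: jet_functional_eq.
Qed.

Lemma first_order_linear (x y : R) f g : Cinf f -> Cinf g ->
  l (fun q => x * f q + y * g q) = x * l f + y * l g.
Proof.
move=> sf sg; have [c mc [cp [a [a0 lE]]]] := fo.
have sfg : Cinf (fun q => x * f q + y * g q).
  by apply: CinfD; apply: CinfM => //; exact: Cinf_cst.
by rewrite !lE // jet_functional_linear //; move/CinfP: sf; move/CinfP: sg.
Qed.

Lemma first_orderD f g : Cinf f -> Cinf g -> l (f \+ g) = l f + l g.
Proof.
move=> sf sg; have := first_order_linear 1 1 sf sg; rewrite !mul1r => <-.
by congr l; apply/funext => q; rewrite !mul1r.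
Qed.

Lemma first_orderM f g : Cinf f -> Cinf g ->
  l (f \* g) = f p * l g + g p * l f - f p * g p * l (cst 1).
Proof.
move=> sf sg; have [c mc [cp [a [a0 lE]]]] := fo.
rewrite !lE //; [|exact: Cinf_cst|exact: CinfM].
rewrite jet_functional_cst mulr1 jet_functionalM //.
  by move/CinfP: sf.
by move/CinfP: sg.
Qed.

Lemma first_order_cst (k : R) : l (cst k) = k * l (cst 1).
Proof.
have [c mc [cp [a [a0 lE]]]] := fo.
rewrite (lE _ (Cinf_cst _)) (lE _ (Cinf_cst _)) !jet_functional_cst.
by rewrite mulr1 mulrC.
Qed.

End Functional.

Lemma first_order_comb l l' p (x y : R) :
  first_order_at l p -> first_order_at l' p ->
  first_order_at (fun g => x * l g + y * l' g) p.
Proof.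
have [c mc cp] := max_atlas_ex p.
move=> /(first_order_chart mc cp)[a [a0 lE]] /(first_order_chart mc cp)[b [b0 lE']].
exists c => //; split=> //; exists (fun i => x * a i + y * b i), (x * a0 + y * b0).
by move=> g sg; rewrite lE // lE' // jet_functional_comb.
Qed.

Definition first_order_op (D : (N -> R) -> N -> R) :=
  (forall g, Cinf g -> Cinf (D g)) /\ forall p, first_order_at (D^~ p) p.

(** The coefficients, obtained point by point, are smooth because D itself yields them: a0 is D(1),
    and a_i is D(x^i) - a0 x^i with x^i cut off. *)
Lemma first_order_coeffs D c : first_order_op D -> max_atlas c ->
  exists (a : 'I_m -> 'rV[R]_m -> R) (a0 : 'rV[R]_m -> R),
  [/\ forall v, cimg c v -> forall i, smooth_at (a i) v,
      forall v, cimg c v -> smooth_at a0 v &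
      forall g, Cinf g -> forall p, cdom c p ->
        D g p = jet_functional c p (a ^~ (cmap c p)) (a0 (cmap c p)) g].
Proof.
move=> [sD fD] mc.
have /choice[aa HE'] : forall v, exists aa : ('I_m -> R) * R, cimg c v ->
    forall g, Cinf g -> D g (cinv c v) = jet_functional c (cinv c v) aa.1 aa.2 g.
  move=> v; have [/cimgP[cv _]|nv] := pselect (cimg c v); last by exists (fun=> 0, 0).
  by have [a [a0 lE]] := first_order_chart mc cv (fD (cinv c v)); exists (a, a0).
pose a i v := (aa v).1 i; pose a0 v := (aa v).2.
have HE g p : cdom c p -> Cinf g ->
    D g p = jet_functional c p (a ^~ (cmap c p)) (a0 (cmap c p)) g.
  move=> cp sg; have := HE' (cmap c p) (cimg_cmap cp) g sg.
  by rewrite cmapK.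
have s1 : Cinf (cst 1 : N -> R) := Cinf_cst 1.
have E0 p : cdom c p -> a0 (cmap c p) = D (cst 1) p.
  by move=> cp; rewrite HE // jet_functional_cst mulr1.
have sa0 p : cdom c p -> smooth_at a0 (cmap c p).
  move=> cp; have : smooth_at (D (cst 1) \o cinv c) (cmap c p).
    by apply/smf_chart => //; have /CinfP := sD _ s1; exact.
  apply: smooth_at_eq; have := near_cimg cp; apply: filterS => v /cimgP[cv vE].
  by rewrite /= -E0 // vE.
have sa p i : cdom c p -> smooth_at (a i) (cmap c p).
  move=> cp; have [chi [schi chi1 supp]] := cutoff_ex (cdom_open c) cp.
  pose h := chi \* (fun q => cmap c q 0 i).
  have sh : Cinf h.
    by apply: Cinf_supported schi supp _ => q cq; exact: smf_coord.
  have : smf (fun q => D h q - a0 (cmap c q) * cmap c q 0 i) p.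
    apply: smfB; first by have /CinfP := sD _ sh; exact.
    apply: smfM; last exact: smf_coord.
    by apply: smf_comp => [j|]; [exact: smf_coord|exact: sa0].
  move/(smf_chart _ mc cp); apply: smooth_at_eq.
  have nE : \forall q \near p, D h q - a0 (cmap c q) * cmap c q 0 i = a i (cmap c q).
    have nchi : \forall q \near p, \forall q' \near q, chi q' = 1 := near_join chi1.
    apply: filterS2 nchi (near_cdom cp) => q chi1q cq.
    rewrite HE // (@jet_functional_coord _ _ _ _ _ i) ?addrK //.
    by apply: filterS chi1q => q' e; rewrite /h /= e mul1r.
  apply: filterS2 (near_cinv cp nE) (near_cimg cp) => v /= -> /cimgP[_ vE].
  by rewrite vE.
exists a, a0; split=> [v /cimgP[cv <-] i|v /cimgP[cv <-]|g sg p cp].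
- exact: sa.
- exact: sa0.
- exact: HE.
Qed.

(* The second-order terms cancel by the symmetry of second derivatives. *)
Lemma first_order_commutator D D' p : first_order_op D -> first_order_op D' ->
  first_order_at (fun g => D (D' g) p - D' (D g) p) p.
Proof.
move=> fD fD'; have [c mc cp] := max_atlas_ex p.
have [a [a0 [sa sa0 aE]]] := first_order_coeffs fD mc.
have [b [b0 [sb sb0 bE]]] := first_order_coeffs fD' mc.
have cip := cimg_cmap cp; set w := cmap c p in cip *.
pose d k (f : 'rV[R]_m -> R) := partial k f w.
exists c => //; split=> //.
exists (fun j => \sum_i (a i w * d i (b j) - b i w * d i (a j))).
exists (\sum_i (a i w * d i b0 - b i w * d i a0)) => g sg.
have sG v : cimg c v -> smooth_at (g \o cinv c) v.
  move=> /cimgP[cv <-]; apply/smf_chart => //.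
  by move/CinfP: sg; exact.
pose G := g \o cinv c; have sGw := sG _ cip.
have der (e : 'I_m -> 'rV[R]_m -> R) e0 (E : (N -> R) -> N -> R) i :
    (forall v, cimg c v -> forall i, smooth_at (e i) v) ->
    (forall v, cimg c v -> smooth_at e0 v) ->
    (forall g, Cinf g -> forall p, cdom c p ->
        E g p = jet_functional c p (e ^~ (cmap c p)) (e0 (cmap c p)) g) ->
    partial i (E g \o cinv c) w = \sum_j (e j w * d i (partial j G)
       + d j G * d i (e j)) + (e0 w * d i G + G w * d i e0).
  move=> se se0 eE.
  transitivity (partial i ((fun v => \sum_j (e j v * partial j G v)) \+ (e0 \* G)) w).
    apply: partial_near; apply: filterS (near_cimg cp) => v /cimgP[cv vE].
    by rewrite /= eE // /jet_functional vE.
  have st j : smooth_at (fun v => e j v * partial j G v) w.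
    by apply: smooth_atM; [exact: se|exact: smooth_at_partial].
  have ssum (r : seq 'I_m) : smooth_at (fun v => \sum_(j <- r) (e j v * partial j G v)) w.
    elim: r => [|j r IH].
      have -> : (fun v => \sum_(j <- [::]) (e j v * partial j G v)) = cst 0.
        by apply/funext => v; rewrite big_nil.
      exact: smooth_at_cst.
    have := smooth_atD (st j) IH; congr smooth_at.
    by apply/funext => v; rewrite big_cons.
  rewrite partialD; [|exact: ssum|by apply: smooth_atM; [exact: se0|]].
  rewrite partialM //; last exact: se0.
  congr (_ + _).
  elim: (index_enum _) => [|j r IH].
    rewrite big_nil; transitivity (partial i (cst 0 : 'rV[R]_m -> R) w).
      by congr (partial i _ w); apply/funext => v; rewrite big_nil.
    exact: partial_cst.
  rewrite big_cons -IH -(partialM i) //; [|exact: se|exact: smooth_at_partial].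
  rewrite -partialD; [|exact: st|exact: ssum]; congr (partial i _ w).
  by apply/funext => v; rewrite big_cons.
have gE : G w = g p by rewrite /G /w /= cmapK.
have dE : D g p = \sum_i a i w * d i G + a0 w * g p by rewrite aE.
have dE' : D' g p = \sum_i b i w * d i G + b0 w * g p by rewrite bE.
rewrite (aE (D' g)) ?(bE (D g)) //; [|exact: fD.1|exact: fD'.1].
rewrite /jet_functional -/w dE dE'.
under eq_bigr do rewrite (der b b0) //.
under [X in _ - (X + _)]eq_bigr do rewrite (der a a0) //.
have expand (x y : 'I_m -> 'rV[R]_m -> R) y0 :
   \sum_i x i w * (\sum_j (y j w * d i (partial j G) + d j G * d i (y j))
     + (y0 w * d i G + G w * d i y0)) =
   \sum_i \sum_j (x i w * y j w * d i (partial j G))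
   + \sum_j (\sum_i (x i w * d i (y j))) * d j G
   + y0 w * (\sum_i x i w * d i G) + (\sum_i x i w * d i y0) * G w.
  under [X in _ = _ + X + _ + _]eq_bigr do rewrite mulr_suml.
  rewrite [X in _ = _ + X + _ + _]exchange_big /= mulr_sumr mulr_suml -!big_split /=.
  apply: eq_bigr => i _; rewrite mulrDr mulr_sumr -big_split /= -addrA; congr (_ + _).
    by apply: eq_bigr => j _; ring.
  by ring.
rewrite !expand.
have -> : \sum_i \sum_j (b i w * a j w * d i (partial j G)) =
    \sum_i \sum_j (a i w * b j w * d i (partial j G)).
  rewrite exchange_big /=; apply: eq_bigr => i _; apply: eq_bigr => j _.
  by rewrite /d (smooth_at_schwarz j i sGw) mulrC [b j w * _]mulrC mulrC.
rewrite gE sumrB.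
under [X in _ = X + _]eq_bigr do rewrite sumrB mulrBl.
rewrite sumrB; ring.
Qed.

End FirstOrder.

(** * Sections of L~Z as operators compatible with the fibration *)

Section Operators.
Context {R : realType} {n : nat} {M : manifold R n} {Z : AVbundle M}.
Implicit Types (c : chart R M n) (cz : chart R Z (n + 1)) (x y : M) (z : Z)
  (D : op Z) (g : Z -> R) (h : M -> R) (sigma : M -> Z).

Local Notation zt := (@zeta _ _ _ Z).

Definition basic (g : Z -> R) := forall z z', zeta z = zeta z' -> g z = g z'.

(* An intrinsic description of the sections of L~Z: first-order operators that
   send functions on M and the functions F_sigma to functions on M. *)
Definition EL : set (op Z) := [set D | [/\ Cinf_op D, first_order_op D,
  forall h, Cinf h -> basic (D (h \o zt)) &
  forall sigma, Sec sigma -> basic (D (Fsec sigma))]].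

Definition ET : set (op Z) := [set D | EL D /\ forall z, D (cst 1) z = 0].

Definition cut_coord c (chi : M -> R) (i : 'I_n) : M -> R :=
  chi \* (fun y => cmap c y 0 i).

Lemma Cinf_cut_coord c chi i : max_atlas c -> Cinf chi -> supported_in chi (cdom c) ->
  Cinf (cut_coord c chi i).
Proof. by move=> mc schi supp; apply: Cinf_supported schi supp _ => q; exact: smf_coord. Qed.

Definition affine_functional cz z (f : 'I_n -> R) (alpha beta : R) (g : Z -> R) : R :=
  \sum_(a < n) f a * partial (lshift 1 a) (g \o cinv cz) (cmap cz z)
  - (alpha * sco cz z + beta) * partial (rshift n ord0) (g \o cinv cz) (cmap cz z)
  + alpha * g z.

Definition affine_coeff cz z (f : 'I_n -> R) (alpha beta : R) (i : 'I_(n + 1)) : R :=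
  match fintype.split i with inl a => f a | inr _ => - (alpha * sco cz z + beta) end.

Lemma jet_functional_split cz z (a : 'I_(n + 1) -> R) a0 g :
  jet_functional cz z a a0 g =
  \sum_(i < n) a (lshift 1 i) * partial (lshift 1 i) (g \o cinv cz) (cmap cz z)
  + a (rshift n ord0) * partial (rshift n ord0) (g \o cinv cz) (cmap cz z) + a0 * g z.
Proof. by rewrite /jet_functional big_split_ord /= big_ord1. Qed.

Lemma affine_functionalE cz z f alpha beta g :
  affine_functional cz z f alpha beta g =
  jet_functional cz z (affine_coeff cz z f alpha beta) alpha g.
Proof.
rewrite jet_functional_split /affine_functional /affine_coeff; congr (_ + _ + _).
  by apply: eq_bigr => i _; rewrite (unsplitK (inl _ i)).
by rewrite (unsplitK (inr _ ord0)) mulNr.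
Qed.

Section Chart.
Context {c : chart R M n} {cz : chart R Z (n + 1)} (ac : affine_coords c cz).
Context {z : Z} (cx : cdom c (zeta z)).

Let czz : cdom cz z. Proof. exact/(cdomzE ac). Qed.

Lemma near_cdom_zeta : \forall z' \near z, cdom c (zeta z').
Proof. by apply: near_zeta; exact: near_cdom. Qed.

Lemma smooth_at_chart h : smf h (zeta z) -> smooth_at (h \o cinv c) (cmap c (zeta z)).
Proof. by move/(smf_chart _ (affine_max ac) cx). Qed.

Lemma near_zeta_chart h :
  \forall v \near cmap cz z, (h \o zt \o cinv cz) v = (h \o cinv c \o lsubmx) v.
Proof.
apply: filterS (near_cimg czz) => v /cimgP[/(cdomzE ac) cv vE].
by rewrite /= -{2}vE (lsub_cmapz ac cv) cmapK.
Qed.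

Lemma partial_zeta h i : smf h (zeta z) ->
  partial i (h \o zt \o cinv cz) (cmap cz z) =
  match fintype.split i with inl a => partial a (h \o cinv c) (cmap c (zeta z)) | inr _ => 0 end.
Proof.
move=> /smooth_at_chart sh; rewrite (partial_near _ (near_zeta_chart h)).
have lE := lsub_cmapz ac cx.
rewrite -[X in partial i X]/((h \o cinv c) \o (@lsubmx R 1 n 1)).
have coordE j : (fun w : 'rV[R]_(n + 1) => lsubmx w 0 j) = (fun w => w 0 (lshift 1 j)).
  by apply/funext => w; rewrite mxE.
rewrite partial_comp_at; last 2 first.
- by move=> j; rewrite coordE; exact: smooth_at_coord.
- by rewrite lE.
rewrite lE; under eq_bigr do rewrite coordE partial_coord.
case: (split_ordP i) => k ->.
  rewrite (bigD1 k) //= eqxx mulr1 big1 ?addr0 // => j jk.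
  by rewrite (inj_eq (@lshift_inj _ _)) eq_sym (negbTE jk) mulr0.
rewrite big1 // => j _; rewrite (_ : (_ == _) = false) ?mulr0 //.
by apply/eqP => /(congr1 val) /= E; have := ltn_ord j; rewrite -E ltnNge leq_addr.
Qed.

Lemma affine_functional_zeta f alpha beta h : smf h (zeta z) ->
  affine_functional cz z f alpha beta (h \o zt) =
  \sum_a f a * partial a (h \o cinv c) (cmap c (zeta z)) + alpha * h (zeta z).
Proof.
move=> sh; rewrite /affine_functional (partial_zeta _ sh).
rewrite (unsplitK (inr _ ord0)) mulr0 subr0 /=; congr (_ + _).
by apply: eq_bigr => i _; rewrite (partial_zeta _ sh) (unsplitK (inl _ i)).
Qed.

(** F_sigma is u(x) - s. The d/ds term contributes alpha s + beta and the term of order zero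
    contributes alpha (u - s); s cancels, which makes the value constant on the fibre. *)
Lemma affine_functional_Fsec f alpha beta sigma : Sec sigma ->
  affine_functional cz z f alpha beta (Fsec sigma) =
  \sum_a f a * partial a (sco cz \o sigma \o cinv c) (cmap c (zeta z))
  + alpha * sco cz (sigma (zeta z)) + beta.
Proof.
move=> Hs; have [sx _] := (SecP _).1 Hs.
have su : smf (sco cz \o sigma) (zeta z) by exact: Sec_sco ac cx Hs.
have suz : smf ((sco cz \o sigma) \o zt) z by case: (zeta_smooth z) => _; exact.
have nE : \forall z' \near z, Fsec sigma z' =
    1 * ((sco cz \o sigma) \o zt) z' + (-1) * sco cz z'.
  apply: filterS near_cdom_zeta => z' cz'.
  by rewrite (FsecE ac cz') // mul1r mulN1r.
rewrite affine_functionalE (jet_functional_eq _ _ czz nE).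
rewrite jet_functional_linear //; [|exact: affine_maxz ac|exact: sco_smf ac _ cx].
rewrite -affine_functionalE affine_functional_zeta //.
rewrite (@jet_functional_coord _ _ _ _ _ _ _ _ (rshift n ord0)) //; last exact: nearW.
by rewrite /affine_coeff (unsplitK (inr _ ord0)) -/(sco cz z) /=; ring.
Qed.

Section Coeffs.
Context {l : (Z -> R) -> R} {a : 'I_(n + 1) -> R} {a0 : R}.
Context (lE : forall g, Cinf g -> l g = jet_functional cz z a a0 g).

Lemma affine_coeff0 : a0 = l (cst 1).
Proof. by rewrite lE ?jet_functional_cst ?mulr1 //; exact: Cinf_cst. Qed.

Lemma affine_coeff_base chi i : Cinf chi -> (\forall y \near zeta z, chi y = 1) ->
  supported_in chi (cdom c) ->
  a (lshift 1 i) = l (cut_coord c chi i \o zt) - l (cst 1) * cmap c (zeta z) 0 i.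
Proof.
move=> schi chi1 supp; rewrite -affine_coeff0 -(cmapz_l ac) // lE; last first.
  by apply: Cinf_zeta; apply: Cinf_cut_coord => //; exact: affine_max ac.
rewrite (@jet_functional_coord _ _ _ _ _ _ _ _ (lshift 1 i)) ?addrK //.
have nchi : \forall z' \near z, chi (zeta z') = 1 := near_zeta chi1.
apply: filterS2 nchi near_cdom_zeta => z' /= chi1z cz'.
by rewrite /cut_coord /= chi1z mul1r (cmapz_l ac).
Qed.

(** Where sigma is the local zero section, F_sigma is - s: it replaces the vertical coordinate,
    which is only local. *)
Lemma affine_coeff_fibre sigma : Sec sigma ->
  (\forall y \near zeta z, sco cz (sigma y) = 0) ->
  a (rshift n ord0) = - l (Fsec sigma) - l (cst 1) * sco cz z.
Proof.
move=> Hs s0; have [sx _] := (SecP _).1 Hs.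
have sF := Cinf_Fsec Hs; have mz := affine_maxz ac.
have sFz : smf (Fsec sigma) z by move/CinfP : sF; exact.
have -> : - l (Fsec sigma) =
    jet_functional cz z a a0 (fun z => (-1) * Fsec sigma z + 0 * Fsec sigma z).
  by rewrite (jet_functional_linear _ _ _ _ mz czz sFz sFz) lE // mulN1r mul0r addr0.
rewrite (@jet_functional_coord _ _ _ _ _ _ _ _ (rshift n ord0)) ?affine_coeff0 ?addrK //.
have ns0 : \forall z' \near z, sco cz (sigma (zeta z')) = 0 := near_zeta s0.
apply: filterS2 ns0 near_cdom_zeta => z' /= s0z cz'.
by rewrite (FsecE ac cz') // s0z sub0r mulN1r mul0r addr0 opprK.
Qed.

End Coeffs.
End Chart.

Lemma affine_cut_ex c cz x : affine_coords c cz -> cdom c x -> exists chi sigma,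
  [/\ Cinf chi, \forall y \near x, chi y = 1, supported_in chi (cdom c),
      Sec sigma & \forall y \near x, sco cz (sigma y) = 0].
Proof.
move=> ac cx; have [chi [s1 s2 s3]] := cutoff_ex (cdom_open c) cx.
by have [sigma s4 s5] := Sec_zero_ex ac cx; exists chi, sigma.
Qed.

(** Near z the functions 1, x^i and - s coincide with functions of the form h o zeta or F_sigma, and
    their values determine all coefficients of a first-order functional. *)
Lemma first_order_ext (l l' : (Z -> R) -> R) z :
  first_order_at l z -> first_order_at l' z ->
  (forall h, Cinf h -> l (h \o zt) = l' (h \o zt)) ->
  (forall sigma, Sec sigma -> l (Fsec sigma) = l' (Fsec sigma)) ->
  forall g, Cinf g -> l g = l' g.
Proof.
move=> fl fl' eh es g sg.
have [c [cz [cx ac]]] := @affine_ex _ _ _ Z (zeta z).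
have [chi [sigma [s1 s2 s3 s4 s5]]] := affine_cut_ex ac cx.
have czz : cdom cz z by apply/(cdomzE ac).
have [a [a0 lE]] := first_order_chart (affine_maxz ac) czz fl.
have [b [b0 lE']] := first_order_chart (affine_maxz ac) czz fl'.
have e1 : l (cst 1) = l' (cst 1) := eh _ (Cinf_cst 1).
rewrite lE // lE' // !jet_functional_split.
rewrite (affine_coeff0 lE) (affine_coeff0 lE') e1; congr (_ + _ + _).
  apply: eq_bigr => i _.
  rewrite (affine_coeff_base ac cx lE i s1 s2 s3) (affine_coeff_base ac cx lE' i s1 s2 s3).
  by rewrite e1 eh //; apply: Cinf_cut_coord => //; exact: affine_max ac.
by rewrite (affine_coeff_fibre ac cx lE s4 s5) (affine_coeff_fibre ac cx lE' s4 s5) e1 es.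
Qed.

Lemma secL_EL : secL Z `<=` EL.
Proof.
move=> D [cD HD].
have form z c cz : affine_coords c cz -> cdom c (zeta z) ->
    exists f alpha beta, forall z', zeta z' = zeta z -> forall g, Cinf g ->
    D g z' = affine_functional cz z' f alpha beta g.
  move=> ac cx; have [f [alpha [beta [_ _ _ H]]]] := HD c cz ac.
  exists (f ^~ (cmap c (zeta z))), (alpha (cmap c (zeta z))), (beta (cmap c (zeta z))).
  move=> z' zz' g sg.
  have cz' : cdom c (zeta z') by rewrite zz'.
  have czz' : cdom cz z' by apply/(cdomzE ac).
  have := H g sg _ (cimg_cmap czz').
  by rewrite /= cmapK // (lsub_cmapz ac cz') zz' mxE /affine_functional.
have fo z : first_order_at (fun g => D g z) z.
  have [c [cz [cx ac]]] := @affine_ex _ _ _ Z (zeta z).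
  have [f [alpha [beta H]]] := form z c cz ac cx.
  exists cz; first exact: affine_maxz ac.
  split; first exact/(cdomzE ac).
  by eexists; eexists => g sg; rewrite (H z) // affine_functionalE.
split=> //; first by split=> //; exact: cD.1.
- move=> h sh z z' zz'; have [c [cz [cx ac]]] := @affine_ex _ _ _ Z (zeta z).
  have [f [alpha [beta H]]] := form z c cz ac cx.
  have cx' : cdom c (zeta z') by rewrite -zz'.
  have shz y : smf h y by move/CinfP : sh; exact.
  rewrite !H //; try exact: Cinf_zeta.
  by rewrite (affine_functional_zeta ac cx) // (affine_functional_zeta ac cx') // zz'.
- move=> sigma Hs z z' zz'; have [c [cz [cx ac]]] := @affine_ex _ _ _ Z (zeta z).
  have [f [alpha [beta H]]] := form z c cz ac cx.
  have cx' : cdom c (zeta z') by rewrite -zz'.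
  rewrite !H //; try exact: Cinf_Fsec.
  by rewrite (affine_functional_Fsec ac cx) // (affine_functional_Fsec ac cx') // zz'.
Qed.

(** f, alpha and beta are read off on the slice s = 0. As D(1) and D(x^i) are constant on fibres, a0
    and the a_i do not depend on s; then D(F_sigma) makes the vertical coefficient affine in s with
    slope - a0. *)
Lemma EL_secL : EL `<=` secL Z.
Proof.
move=> D [cD fD Dh Ds]; split=> // c cz ac.
have [a [a0 [sa sa0 aE]]] := first_order_coeffs fD (affine_maxz ac).
pose T (v : 'rV[R]_n) : 'rV[R]_(n + 1) := row_mx v 0.
have cT v : cimg c v -> cimg cz (T v).
  by move=> [y cy <-]; have := cimgzP ac 0 cy; rewrite raddf0.
have sT v j : smooth_at (fun v => T v 0 j) v.
  have [j' ->|j' ->] := split_ordP j.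
    have -> : (fun v => T v 0 (lshift 1 j')) = (fun v => v 0 j').
      by apply/funext => w; rewrite row_mxEl.
    exact: smooth_at_coord.
  have -> : (fun v => T v 0 (rshift n j')) = cst 0.
    by apply/funext => w; rewrite row_mxEr mxE.
  exact: smooth_at_cst.
have sTc (e : 'rV[R]_(n + 1) -> R) :
    (forall v, cimg cz v -> smooth_at e v) -> smooth_on (cimg c) (e \o T).
  move=> se; apply/smooth_on_at; first exact: cimg_open.
  by move=> v vc; apply: smooth_at_comp => [j|]; [exact: sT|exact: se (cT v vc)].
exists (fun i => a (lshift 1 i) \o T), (a0 \o T), (fun v => - (a (rshift n ord0) \o T) v).
split=> [i||k|g sg w /cimgP[wd wE]].
- by apply: sTc => v vc; exact: sa.
- exact: sTc.
- have oc : open (cimg c) by exact: cimg_open.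
  have sn := sTc (a (rshift n ord0)) (fun v vc => sa v vc _).
  have := CkM oc (Ck_cst k (cimg c) (-1)) (sn k).
  by apply: Ck_eq => // v vc; rewrite /= mulN1r.
have wd' : cdom c (zeta (cinv cz w)) by apply/(cdomzE ac).
move: (cinv cz w) wd wd' wE => z zd cx wE.
have [chi [sigma [s1 s2 s3 s4 s5]]] := affine_cut_ex ac cx.
pose z0 := @zero_section _ _ _ _ c cz (zeta z).
have [z0z z00] := zero_sectionP ac cx.
have cx0 : cdom c (zeta z0) by rewrite z0z.
have z0d : cdom cz z0 by apply/(cdomzE ac).
have lE g' (sg' : Cinf g') := aE g' sg' z zd.
have lE0 g' (sg' : Cinf g') := aE g' sg' z0 z0d.
rewrite -wE.
have E0 : T (lsubmx (cmap cz z)) = cmap cz z0.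
  by rewrite (lsub_cmapz ac cx) (cmapzE ac cx0) z0z z00 raddf0.
have D1 : D (cst 1) z = D (cst 1) z0 by apply: (Dh (cst 1)); [exact: Cinf_cst|].
have a0E : a0 (cmap cz z) = a0 (cmap cz z0).
  by rewrite (affine_coeff0 lE) (affine_coeff0 lE0).
have aiE i : a (lshift 1 i) (cmap cz z) = a (lshift 1 i) (cmap cz z0).
  rewrite (affine_coeff_base ac cx lE i s1 s2 s3).
  have := affine_coeff_base ac cx0 lE0 i s1; rewrite !z0z => -> //.
  rewrite D1; congr (_ - _); apply: Dh => //.
  by apply: Cinf_cut_coord => //; exact: affine_max ac.
have anE : a (rshift n ord0) (cmap cz z) =
    a (rshift n ord0) (cmap cz z0) - a0 (cmap cz z0) * sco cz z.
  rewrite (affine_coeff_fibre ac cx lE s4 s5).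
  have := affine_coeff_fibre ac cx0 lE0 s4; rewrite !z0z => -> //.
  rewrite z00 mulr0 subr0 D1 (affine_coeff0 lE0); congr (- _ - _).
  exact: Ds.
rewrite /= aE // jet_functional_split E0 a0E anE mxE -/(sco cz z) /= cmapK //.
under eq_bigr do rewrite aiE.
by congr (_ + _); congr (_ + _); ring.
Qed.

Lemma secLE : secL Z = EL.
Proof. by apply/seteqP; split; [exact: secL_EL|exact: EL_secL]. Qed.

End Operators.

(** * The vertical field X_Z *)

Section VerticalField.
Context {R : realType} {n : nat} {M : manifold R n} {Z : AVbundle M}.
Implicit Types (c : chart R M n) (cz : chart R Z (n + 1)) (x y : M) (z : Z)
  (D : op Z) (g : Z -> R) (h : M -> R) (sigma : M -> Z).

Local Notation zt := (@zeta _ _ _ Z).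

Lemma Fsec_av_add sigma z t : (forall x, zeta (sigma x) = x) ->
  Fsec sigma (av_add z t) = Fsec sigma z - t.
Proof.
move=> sx; rewrite /Fsec zeta_av_add; set u := sigma _.
have zu : zeta z = zeta u by rewrite /u sx.
by rewrite -{1}(av_subK zu) -{1}(subrK t (av_sub u z)) addrC av_addD av_addK.
Qed.

Lemma Fsec_sec_add sigma h z : (forall x, zeta (sigma x) = x) ->
  Fsec (sec_add sigma h) z = Fsec sigma z + h (zeta z).
Proof.
move=> sx; rewrite /Fsec /sec_add; set u := sigma _.
have zu : zeta z = zeta u by rewrite /u sx.
by rewrite -{1}(av_subK zu) -av_addD av_addK.
Qed.

(** In affine coordinates the orbit t |-> z - t is a straight line in the direction of - d/ds. *)
Lemma is_derive_fibre c cz g z : affine_coords c cz -> cdom c (zeta z) -> smf g z ->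
  is_derive (0 : R) 1 (fun t => g (av_add z (- t)))
    (- partial (rshift n ord0) (g \o cinv cz) (cmap cz z)).
Proof.
move=> ac cx sg; have czz : cdom cz z by apply/(cdomzE ac).
set G := g \o cinv cz; set w := cmap cz z; pose e : 'rV[R]_(n + 1) := basis_vec R (rshift n ord0).
have sG : smooth_at G w by apply/smf_chart => //; exact: affine_maxz ac.
have wE t : G (t *: (- e) + w) = g (av_add z (- t)).
  have cx' : cdom c (zeta (av_add z (- t))) by rewrite zeta_av_add.
  rewrite /G /= -[RHS](congr1 g (cmapK ((cdomzE ac _).2 cx'))).
  congr (g (cinv cz _)); rewrite (cmapzE ac cx') zeta_av_add (scoD ac _ cx).
  rewrite /w (cmapzE ac cx); apply/rowP => j.
  have [k ->|k ->] := split_ordP j.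
    rewrite [LHS]mxE !row_mxEl 2!mxE basis_vecE (_ : (_ == _) = false).
      by rewrite oppr0 mulr0 add0r.
    by apply/eqP => /(congr1 val) /= E; have := ltn_ord k; rewrite E ltnNge leq_addr.
  rewrite [LHS]mxE !row_mxEr ord1 2!mxE basis_vecE !mxE !eqxx /= !mulr1n.
  by ring.
have -> : (fun t => g (av_add z (- t))) = (fun t => G (t *: (- e) + w)).
  by apply/funext => t; rewrite wE.
have dG := smooth_at_differentiable sG.
have dGe : derivable G w (- e) by exact: diff_derivable.
apply: DeriveDef; first by have /derivable1P := dGe.
by rewrite -derive_dirE /partial !deriveE // linearN.
Qed.

Lemma XZ_chart c cz g z : affine_coords c cz -> cdom c (zeta z) -> smf g z ->
  XZ g z = - partial (rshift n ord0) (g \o cinv cz) (cmap cz z).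
Proof. by move=> ac cx /(is_derive_fibre ac cx) d; rewrite /XZ derive1E derive_val. Qed.

Lemma XZ_first_order : first_order_op (@XZ _ _ _ Z).
Proof.
split=> [g /CinfP sg|z].
  apply/CinfP => z; have [c [cz [cx ac]]] := @affine_ex _ _ _ Z (zeta z).
  have czz : cdom cz z by apply/(cdomzE ac).
  apply: smf_eq (smfN (smf_partial (rshift n ord0) (affine_maxz ac) czz (sg z))).
  have : \forall z' \near z, cdom c (zeta z') by apply: near_zeta; exact: near_cdom.
  by apply: filterS => z' cz'; rewrite (XZ_chart ac).
have [c [cz [cx ac]]] := @affine_ex _ _ _ Z (zeta z).
exists cz; first exact: affine_maxz ac.
split; first exact/(cdomzE ac).
exists (affine_coeff cz z (fun=> 0) 0 1), 0 => g /CinfP sg.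
rewrite (XZ_chart ac) // -affine_functionalE /affine_functional big1 => [|i _].
  by rewrite !mul0r !add0r addr0 mul1r.
by rewrite mul0r.
Qed.

Lemma XZ_zeta h : XZ (h \o zt) = cst 0.
Proof.
apply/funext => z; rewrite /XZ (_ : (fun t => _) = cst (h (zeta z))).
  by rewrite derive1_cst.
by apply/funext => t; rewrite /= zeta_av_add.
Qed.

Lemma XZ_Fsec sigma : (forall x, zeta (sigma x) = x) -> XZ (Fsec sigma) = cst 1.
Proof.
move=> sx; apply/funext => z; rewrite /XZ derive1E.
rewrite (_ : (fun t => _) = (fun t : R => t + Fsec sigma z)).
  exact: (congr1 (fun f => f 0) (derive_shift (1 : R) (Fsec sigma z))).
by apply/funext => t; rewrite Fsec_av_add // opprK addrC.
Qed.

(** The flow property turns the derivative at time t into the derivative at time 0 at the shifted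
    point, so g has zero derivative along the whole fibre. *)
Lemma XZ0_basic g : Cinf g -> XZ g = cst 0 -> basic g.
Proof.
move=> /CinfP sg X0 z z' zz'.
pose phi (t : R) := g (av_add z (- t)).
have d t : is_derive t (1 : R) phi 0.
  pose psi (s : R) := g (av_add (av_add z (- t)) (- s)).
  have E : (fun h : R => h^-1 *: (phi (h *: 1 + t) - phi t)) =
      (fun h : R => h^-1 *: (psi (h *: 1 + 0) - psi 0)).
    apply/funext => h; rewrite /phi /psi -!av_addD; congr (_ *: (g (av_add z _) - g (av_add z _))).
      by rewrite addr0 opprD addrC.
    by rewrite oppr0 addr0.
  have [c [cz [cx ac]]] := @affine_ex _ _ _ Z (zeta (av_add z (- t))).
  have := is_derive_fibre ac cx (sg _); rewrite -(XZ_chart ac cx (sg _)) X0 /= => -[d1 d2].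
  by apply: DeriveDef; [rewrite /derivable E|rewrite /derive E].
have := is_derive_0_is_cst 0 (- av_sub z' z) d.
by rewrite /phi oppr0 av_add0 opprK av_subK.
Qed.

End VerticalField.

(** * The two algebroids: commutators, linear parts, phi^0 and local frames *)

Section Algebroids.
Context {R : realType} {n : nat} {M : manifold R n} {Z : AVbundle M}.
Implicit Types (c : chart R M n) (cz : chart R Z (n + 1)) (x y : M) (z : Z)
  (D : op Z) (g : Z -> R) (h : M -> R) (sigma : M -> Z).

Local Notation zt := (@zeta _ _ _ Z).

Lemma first_order_op_cst D : first_order_op D -> D (cst 0) = cst 0.
Proof.
by move=> [_ fD]; apply/funext => z; rewrite (first_order_cst (fD z)) mul0r.
Qed.

(** X_Z kills D(h o zeta) and D(F_sigma), because D commutes with X_Z, X_Z(h o zeta) = 0,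
    X_Z(F_sigma) = 1 and D(1) = 0. *)
Lemma secT_ET : secT Z `<=` ET.
Proof.
move=> D [[cD vD] DX].
have fo z : first_order_at (fun g => D g z) z.
  have [c acl cz] := atlas_cover z; have [a _ aE] := vD c acl.
  exists c; first exact: atlas_max.
  split=> //; exists (a ^~ (cmap c z)), 0 => g sg.
  have := aE g sg _ (cimg_cmap cz); rewrite cmapK // => ->.
  by rewrite /jet_functional mul0r addr0.
have fD : first_order_op D by split=> //; exact: cD.1.
have D1 z : D (cst 1) z = 0.
  have [c acl cz] := atlas_cover z; have [a _ aE] := vD c acl.
  have := aE _ (Cinf_cst 1) _ (cimg_cmap cz); rewrite cmapK // => ->.
  by apply: big1 => i _; rewrite -[X in partial i X]/(cst 1) partial_cst mulr0.
split=> //; split=> // [h sh|sigma Hs].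
  apply: XZ0_basic; first by apply: cD.1; exact: Cinf_zeta.
  rewrite -DX; last exact: Cinf_zeta.
  by rewrite XZ_zeta first_order_op_cst.
have sF := Cinf_Fsec Hs; apply: XZ0_basic; first exact: cD.1.
have [sx _] := (SecP _).1 Hs.
by rewrite -DX // XZ_Fsec //; apply/funext => z; rewrite D1.
Qed.

(** [D, X_Z] is again of first order and vanishes on the functions h o zeta and F_sigma, so
    [first_order_ext] makes it zero. *)
Lemma ET_secT : ET `<=` secT Z.
Proof.
move=> D [[cD fD Dh Ds] D1]; split; first split=> //.
  move=> c acl; have mc := atlas_max acl.
  have [a [a0 [sa sa0 aE]]] := first_order_coeffs fD mc.
  exists a.
    move=> i; apply/smooth_on_at; first exact: cimg_open.
    by move=> v vc; exact: sa.
  move=> g sg v /cimgP[cv vE]; rewrite aE //.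
  have := aE _ (Cinf_cst 1) _ cv; rewrite jet_functional_cst mulr1 D1 => <-.
  by rewrite /jet_functional mul0r addr0 vE.
move=> g sg; apply/funext => z; apply/eqP; rewrite -subr_eq0; apply/eqP.
have zero : first_order_at (fun _ : Z -> R => 0) z.
  have [c mc cz] := max_atlas_ex z; exists c => //; split=> //.
  exists (fun=> 0), 0 => f _; rewrite /jet_functional mul0r addr0 big1 // => i _.
  by rewrite mul0r.
apply: (first_order_ext (first_order_commutator z fD XZ_first_order) zero _ _ sg).
  move=> h sh; rewrite XZ_zeta (first_order_op_cst fD) /=.
  have -> : D (h \o zt) = (fun x => D (h \o zt) (sval (cid (zeta_surj Z x)))) \o zt.
    apply/funext => z' /=; apply: Dh => //.
    by rewrite (svalP (cid (zeta_surj Z (zeta z')))).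
  by rewrite XZ_zeta subr0.
move=> sigma Hs; have [sx _] := (SecP _).1 Hs.
rewrite XZ_Fsec // D1.
have -> : D (Fsec sigma) = (fun x => D (Fsec sigma) (sigma x)) \o zt.
  by apply/funext => z' /=; apply: Ds => //; rewrite sx.
by rewrite XZ_zeta subr0.
Qed.

Lemma secTE : secT Z = ET.
Proof. by apply/seteqP; split; [exact: secT_ET|exact: ET_secT]. Qed.

Lemma EL_comb f D f' D' : Cinf f -> Cinf f' -> EL D -> EL D' -> EL (op_comb f D f' D').
Proof.
move=> sf sf' [cD fD Dh Ds] [cD' fD' Dh' Ds'].
have sfz := Cinf_zeta (Z := Z) sf; have sfz' := Cinf_zeta (Z := Z) sf'.
have cC g : Cinf g -> Cinf (op_comb f D f' D' g).
  move=> sg; have := CinfD (CinfM sfz (cD.1 g sg)) (CinfM sfz' (cD'.1 g sg)).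
  by [].
split.
- split=> // g ng; apply/funext => z.
  by rewrite /op_comb cD.2 // cD'.2 //= !mulr0 addr0.
- by split=> // z; apply: first_order_comb; [exact: fD.2|exact: fD'.2].
- by move=> h sh z z' e; rewrite /op_comb e (Dh h sh z z') // (Dh' h sh z z').
- by move=> h sh z z' e; rewrite /op_comb e (Ds h sh z z') // (Ds' h sh z z').
Qed.

Lemma ET_comb f D f' D' : Cinf f -> Cinf f' -> ET D -> ET D' -> ET (op_comb f D f' D').
Proof.
move=> sf sf' [ED D1] [ED' D1']; split; first exact: EL_comb.
by move=> z; rewrite /op_comb D1 D1' !mulr0 addr0.
Qed.

Definition fibre_point x : Z := sval (cid (zeta_surj Z x)).

Lemma fibre_pointK x : zeta (fibre_point x) = x.
Proof. exact: svalP (cid (zeta_surj Z x)). Qed.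

(* The linear part of the affine map sigma |-> D(sigma). *)
Definition lin D h : M -> R := fun x => D (h \o zt) (fibre_point x).

Lemma lin_zeta D h : EL D -> Cinf h -> D (h \o zt) = lin D h \o zt.
Proof.
by move=> [_ _ Dh _] sh; apply/funext => z; apply: Dh => //; rewrite fibre_pointK.
Qed.

Lemma act_zeta D sigma : EL D -> Sec sigma -> D (Fsec sigma) = act D sigma \o zt.
Proof.
move=> [_ _ _ Ds] Hs; have [sx _] := (SecP _).1 Hs.
by apply/funext => z; apply: Ds => //; rewrite sx.
Qed.

Lemma Cinf_act D sigma : EL D -> Sec sigma -> Cinf (act D sigma).
Proof.
move=> ED Hs; have [cD _ _ _] := ED.
apply: (Sec_comp (g := D (Fsec sigma)) Hs); apply: cD.1; exact: Cinf_Fsec.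
Qed.

Lemma act_add D sigma h x : EL D -> Sec sigma -> Cinf h ->
  act D (sec_add sigma h) x = act D sigma x + lin D h x.
Proof.
move=> ED Hs sh; have [sx _] := (SecP _).1 Hs; have [_ [_ fD] _ _] := ED.
have E : Fsec (sec_add sigma h) = Fsec sigma \+ (h \o zt).
  by apply/funext => z; rewrite Fsec_sec_add.
rewrite /act E (first_orderD (fD _)) ?(lin_zeta ED) //; last first.
- exact: Cinf_zeta.
- exact: Cinf_Fsec.
by rewrite (act_zeta ED) //= /sec_add zeta_av_add sx.
Qed.

(** [lin] goes through points of the fibres chosen without continuity; its smoothness comes from
    writing it as a difference of two values of [act D]. *)
Lemma Cinf_lin D h : EL D -> Cinf h -> Cinf (lin D h).
Proof.
move=> ED sh; have [sigma Hs] := @Sec_ex _ _ _ Z.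
have : Cinf (fun x => act D (sec_add sigma h) x - act D sigma x).
  by apply: CinfB; apply: Cinf_act => //; exact: Sec_add.
congr Cinf; apply/funext => x.
by rewrite act_add // addrC addKr.
Qed.

Section Lin.
Context {D : op Z} (ED : EL D).

Let fD x : first_order_at (fun g => D g (fibre_point x)) (fibre_point x).
Proof. by case: ED => _ [_ +] _ _; exact. Qed.

Lemma linM f h x : Cinf f -> Cinf h ->
  lin D (f \* h) x = f x * lin D h x + h x * lin D f x - f x * h x * lin D (cst 1) x.
Proof.
move=> sf sh; rewrite /lin -[X in D X _]/((f \o zt) \* (h \o zt)).
rewrite (first_orderM (fD x)); [|exact: Cinf_zeta|exact: Cinf_zeta].
by rewrite /= !fibre_pointK.
Qed.

Lemma lin_linear (a b : R) f h x : Cinf f -> Cinf h ->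
  lin D (fun y => a * f y + b * h y) x = a * lin D f x + b * lin D h x.
Proof.
move=> sf sh; rewrite /lin -(first_order_linear (fD x)) //.
  exact: Cinf_zeta.
exact: Cinf_zeta.
Qed.

Lemma lin_local f h x : Cinf f -> Cinf h -> (\forall y \near x, f y = h y) ->
  lin D f x = lin D h x.
Proof.
move=> sf sh fh; apply: (first_order_eq (fD x)); try exact: Cinf_zeta.
have nz : \forall y \near zt (fibre_point x), f y = h y by rewrite fibre_pointK.
exact: near_zeta nz.
Qed.

Lemma lin_cst (a : R) x : lin D (cst a) x = a * lin D (cst 1) x.
Proof. exact: first_order_cst (fD x) a. Qed.

Lemma lin_sum (I : Type) (r : seq I) (F : I -> M -> R) x : (forall i, Cinf (F i)) ->
  lin D (fun y => \sum_(i <- r) F i y) x = \sum_(i <- r) lin D (F i) x.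
Proof.
move=> sF; elim: r => [|i r IH].
  rewrite big_nil; transitivity (lin D (cst 0) x); last by rewrite lin_cst mul0r.
  by congr (lin D _ x); apply/funext => y; rewrite big_nil.
rewrite big_cons -IH -[in RHS](mul1r (lin D (F i) x)) -[X in _ = _ + X]mul1r.
rewrite -lin_linear //; last exact: Cinf_sum.
by congr (lin D _ x); apply/funext => y; rewrite big_cons !mul1r.
Qed.

End Lin.

Lemma lin_comb f D f' D' h x :
  lin (op_comb f D f' D') h x = f x * lin D h x + f' x * lin D' h x.
Proof. by rewrite /lin /op_comb fibre_pointK. Qed.

Lemma act_comb f D f' D' sigma x : Sec sigma ->
  act (op_comb f D f' D') sigma x = f x * act D sigma x + f' x * act D' sigma x.
Proof. by move=> /SecP[sx _]; rewrite /act /op_comb sx. Qed.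

Lemma act_commutator D D' sigma x : EL D -> EL D' -> Sec sigma ->
  act (commutator D D') sigma x = lin D (act D' sigma) x - lin D' (act D sigma) x.
Proof.
move=> ED ED' Hs; have [sx _] := (SecP _).1 Hs.
rewrite -[LHS]/(commutator D D' (Fsec sigma) (sigma x)) /commutator.
rewrite (act_zeta ED) // (act_zeta ED') //.
rewrite (lin_zeta ED) ?(lin_zeta ED') //=; try exact: Cinf_act.
by rewrite sx.
Qed.

Lemma EL_commutator D D' : EL D -> EL D' -> EL (commutator D D').
Proof.
move=> ED ED'; have [cD fD _ _] := ED; have [cD' fD' _ _] := ED'.
have cC g : Cinf g -> Cinf (commutator D D' g).
  by move=> sg; apply: CinfB; [apply/cD.1/cD'.1|apply/cD'.1/cD.1].
split.
- split=> // g ng; apply/funext => z.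
  rewrite /commutator (cD.2 g ng) (cD'.2 g ng).
  by rewrite (first_order_op_cst fD) (first_order_op_cst fD') subrr.
- by split=> // z; exact: first_order_commutator.
- move=> h sh z z' e; rewrite /commutator (lin_zeta ED) // (lin_zeta ED') //.
  by rewrite (lin_zeta ED) ?(lin_zeta ED') /= ?e //; exact: Cinf_lin.
- move=> h sh z z' e; rewrite /commutator (act_zeta ED) // (act_zeta ED') //.
  by rewrite (lin_zeta ED) ?(lin_zeta ED') /= ?e //; exact: Cinf_act.
Qed.

Lemma ET_commutator D D' : ET D -> ET D' -> ET (commutator D D').
Proof.
move=> [ED D1] [ED' D1']; split; first exact: EL_commutator.
have [_ fD _ _] := ED; have [_ fD' _ _] := ED'.
have D1c : D (cst 1) = cst 0 by apply/funext => z; rewrite D1.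
have D1c' : D' (cst 1) = cst 0 by apply/funext => z; rewrite D1'.
by move=> z; rewrite /commutator D1c D1c' (first_order_op_cst fD) (first_order_op_cst fD') subrr.
Qed.

(** Both sides are of first order in g; they vanish on h o zeta and equal D(1) on F_sigma. *)
Lemma commutator_XZ D g z : EL D -> Cinf g ->
  commutator D (@XZ _ _ _ Z) g z = lin D (cst 1) (zeta z) * XZ g z.
Proof.
move=> ED sg; have [_ fD _ _] := ED.
(* A summand 0 * X_Z(g) gives the right-hand side the shape of [first_order_comb]. *)
rewrite -[RHS]addr0 -[X in _ = _ + X](mul0r (XZ g z)).
apply: (first_order_ext (first_order_commutator z fD XZ_first_order)
  (first_order_comb (lin D (cst 1) (zeta z)) 0 (XZ_first_order.2 z) (XZ_first_order.2 z))
  _ _ sg).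
  move=> h sh; rewrite (lin_zeta ED) // !XZ_zeta (first_order_op_cst fD) /=.
  by rewrite subrr !mulr0 addr0.
move=> sigma Hs; have [sx _] := (SecP _).1 Hs.
rewrite (act_zeta ED) // XZ_zeta XZ_Fsec // subr0 mul0r addr0 mulr1.
by rewrite -[cst 1]/(cst 1 \o zt) (lin_zeta ED) //; exact: Cinf_cst.
Qed.

(** Since X_Z(F_sigma) = 1, a single test function F_sigma determines the number chosen in
    [phi0]. *)
Lemma phi0E D x : EL D -> phi0 Z D x = lin D (cst 1) x.
Proof.
move=> ED; rewrite /phi0 patchE mem_set ?secLE //.
have [sigma Hs] := @Sec_ex _ _ _ Z; have [sx _] := (SecP _).1 Hs.
case: xgetP => [a _ Ha|/(_ (lin D (cst 1) x))[]]; last first.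
  by move=> g z sg zx; rewrite commutator_XZ // zx.
have := Ha (Fsec sigma) (sigma x) (Cinf_Fsec Hs) (sx x).
rewrite commutator_XZ //; last exact: Cinf_Fsec.
by rewrite XZ_Fsec // sx /= !mulr1.
Qed.

(** A local section of L~Z made global by a cutoff. The value 0 on functions that are not smooth is
    the convention of [Cinf_op]. *)
Definition gen c cz (chi : M -> R) (f : 'I_n -> M -> R) (alpha beta : R) : op Z :=
  fun g z => if pselect (Cinf g) then
    chi (zeta z) * affine_functional cz z (f ^~ (zeta z)) alpha beta g else 0.

Section Gen.
Context {c : chart R M n} {cz : chart R Z (n + 1)} (ac : affine_coords c cz).
Context {chi : M -> R} (schi : Cinf chi) (supp : supported_in chi (cdom c)).
Context {f : 'I_n -> M -> R} (sf : forall i y, cdom c y -> smf (f i) y).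
Context (alpha beta : R).

Let D := gen c cz chi f alpha beta.

Lemma genE g z : Cinf g ->
  D g z = chi (zeta z) * affine_functional cz z (f ^~ (zeta z)) alpha beta g.
Proof. by rewrite /D /gen; case: pselect. Qed.

Lemma chi_out y : ~ cdom c y -> chi y = 0.
Proof. by move=> nc; have [//|/nbhs_singleton] := supp y. Qed.

Lemma gen_EL : EL D.
Proof.
have cD g : Cinf g -> Cinf (D g).
  move=> sg; have /CinfP sg' := sg.
  have -> : D g = (chi \o zt) \*
      (fun z => affine_functional cz z (f ^~ (zeta z)) alpha beta g).
    by apply/funext => z; rewrite genE.
  apply: (@Cinf_supported _ _ _ _ (zt @^-1` cdom c)).
  - exact: Cinf_zeta.
  - by move=> z; have [?|/near_zeta] := supp (zeta z); [left|right].
  move=> z /= cx; have czz : cdom cz z by apply/(cdomzE ac).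
  have mz := affine_maxz ac.
  have sfz i : smf (f i \o zt) z by case: (zeta_smooth z) => _; apply; exact: sf.
  apply: smfD; last by apply: smfZ.
  apply: smfB.
    apply: (@smf_sum _ _ _ 'I_n _ (fun i z => f i (zeta z) *
      partial (lshift 1 i) (g \o cinv cz) (cmap cz z))) => i.
    by apply: smfM; [exact: sfz|exact: smf_partial].
  apply: smfM; last exact: smf_partial.
  apply: smfD; last exact: smf_cst.
  by apply: smfZ; exact: sco_smf ac _ cx.
split.
- by split=> // g ng; apply/funext => z; rewrite /D /gen; case: pselect.
- split=> // z; have [cx|ncx] := pselect (cdom c (zeta z)).
    exists cz; first exact: affine_maxz ac.
    split; first exact/(cdomzE ac).
    eexists; eexists => g sg; rewrite genE // affine_functionalE.
    by rewrite -[LHS]addr0 -[X in _ + X](mul0r (jet_functional cz z (fun=> 0) 0 g))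
      jet_functional_comb.
  have [c' mc c'z] := max_atlas_ex z; exists c' => //; split=> //.
  exists (fun=> 0), 0 => g sg; rewrite genE // chi_out // mul0r.
  by rewrite /jet_functional mul0r addr0 big1 // => i _; rewrite mul0r.
- move=> h sh z z' e; rewrite !genE; try exact: Cinf_zeta.
  have [cx|ncx] := pselect (cdom c (zeta z)); last by rewrite -e chi_out // !mul0r.
  have cx' : cdom c (zeta z') by rewrite -e.
  have shz y : smf h y by move/CinfP : sh; exact.
  by rewrite (affine_functional_zeta ac cx) // (affine_functional_zeta ac cx') // e.
- move=> sigma Hs z z' e; rewrite !genE; try exact: Cinf_Fsec.
  have [cx|ncx] := pselect (cdom c (zeta z)); last by rewrite -e chi_out // !mul0r.
  have cx' : cdom c (zeta z') by rewrite -e.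
  by rewrite (affine_functional_Fsec ac cx) // (affine_functional_Fsec ac cx') // e.
Qed.

Lemma gen_cst z : D (cst 1) z = chi (zeta z) * alpha.
Proof.
rewrite genE; last exact: Cinf_cst.
by rewrite affine_functionalE jet_functional_cst mulr1.
Qed.

End Gen.

(* A local frame whose dual frame consists of the sections D |-> D(sigma_k). *)
Definition framed (E : set (op Z)) := forall x,
  exists U (K : finType) (s : K -> M -> Z) (Dk : K -> op Z),
  [/\ open U, U x, forall k, Sec (s k), forall k, E (Dk k) &
      forall D, E D -> forall g, Cinf g -> forall z, U (zeta z) ->
        D g z = \sum_k act D (s k) (zeta z) * Dk k g z].

(* [e] is 1 for L~Z and 0 for T~Z, where D(1) = 0. *)
Lemma framed_of (E : set (op Z)) (e : R) : e * e = e -> E `<=` EL ->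
  (forall D, EL D -> (forall z, D (cst 1) z = e * D (cst 1) z) -> E D) ->
  (forall D, E D -> forall x, lin D (cst 1) x = e * lin D (cst 1) x) ->
  framed E.
Proof.
move=> ee EsubEL ELE E1 x; have [c [cz [cx ac]]] := @affine_ex _ _ _ Z x.
have [chi [sigma [s1 s2 s3 s4 s5]]] := affine_cut_ex ac cx.
have mc := affine_max ac.
pose xi i : M -> R := cut_coord c chi i.
have sxi i : Cinf (xi i) by exact: Cinf_cut_coord.
(* With sigma at s = 0, an operator with coefficients f, alpha, beta takes the values f_i + alpha
   x^i + beta, alpha + beta and beta on sigma + x^i, sigma + 1 and sigma. Solving for f, alpha and
   beta gives the dual operators below. Since alpha = e alpha on E, every term that carries alpha
   gets a factor e; for e = 0 the operator of index [inr true] is zero. *)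
pose s (k : 'I_n + bool) := match k with
  | inl i => sec_add sigma (xi i)
  | inr true => sec_add sigma (cst 1)
  | inr false => sigma end.
pose f (k : 'I_n + bool) (i : 'I_n) (y : M) : R := match k with
  | inl j => (i == j)%:R
  | inr true => - (e * cmap c y 0 i)
  | inr false => -1 + e * cmap c y 0 i end.
pose al (k : 'I_n + bool) : R := match k with
  | inl _ => 0 | inr true => e | inr false => - e end.
pose be (k : 'I_n + bool) : R := match k with
  | inl _ => 0 | inr true => 0 | inr false => 1 end.
have sf k i y : cdom c y -> smf (f k i) y.
  move=> cy; case: k => [j|[|]] /=; first exact: smf_cst.
    by apply: smfN; apply: smfZ; exact: smf_coord.
  by apply: smfD; [exact: smf_cst|apply: smfZ; exact: smf_coord].
(* The coefficient formulas need chi = 1 and sigma at s = 0 on a neighbourhood of the point and not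
   just at it; [near_join] supplies this at all points close to x. *)
pose P := [set y | [/\ cdom c y, (\forall y' \near y, chi y' = 1) &
  \forall y' \near y, sco cz (sigma y') = 0]].
have nP : nbhs x P.
  have n2 : \forall y \near x, \forall y' \near y, chi y' = 1 := near_join s2.
  have n5 : \forall y \near x, \forall y' \near y, sco cz (sigma y') = 0 := near_join s5.
  by apply: filterS3 (near_cdom cx) n2 n5 => y y1 y2 y3.
exists P°, ('I_n + bool)%type, s, (fun k => gen c cz chi (f k) (al k) (be k)).
split; [exact: open_interior|exact: nP| | |].
- by case=> [i|[|]] //=; apply: Sec_add => //; exact: Cinf_cst.
- move=> k; apply: ELE; first exact: (gen_EL ac s1 s3 (sf k)).
  move=> z; rewrite gen_cst; case: k => [i|[|]] /=.
  - by rewrite !mulr0.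
  - by rewrite mulrCA ee.
  - by rewrite !mulrN mulrCA ee.
move=> D ED g sg z /interior_subset[cy n2 n5].
have czz : cdom cz z by apply/(cdomzE ac).
have EL_D := EsubEL _ ED; have [_ fD _ _] := EL_D.
have [a [a0 lE]] := first_order_chart (affine_maxz ac) czz (fD.2 z).
rewrite lE // jet_functional_split (affine_coeff0 lE) (affine_coeff_fibre ac cy lE s4 n5).
under eq_bigr => i _ do rewrite (affine_coeff_base ac cy lE i s1 n2 s3) (lin_zeta EL_D) //=.
have -> : D (cst 1) z = lin D (cst 1) (zeta z).
  by rewrite -[cst 1]/(cst 1 \o zt) (lin_zeta EL_D) //; exact: Cinf_cst.
rewrite (act_zeta EL_D) //=.
under [RHS]eq_bigr => k _ do rewrite genE // (nbhs_singleton n2) mul1r.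
rewrite big_sumType /= big_bool /= !act_add //; last exact: Cinf_cst.
under [X in _ = X + _]eq_bigr => i _ do rewrite act_add //.
have := E1 _ ED (zeta z); set l1 := lin D (cst 1) (zeta z) => l1E.
set A := act D sigma (zeta z); set y := zeta z.
rewrite /affine_functional /=.
set S := partial (rshift n ord0) _ _.
pose p i := partial (lshift 1 i) (g \o cinv cz) (cmap cz z).
have E3 (i : 'I_n) : \sum_(a < n) (a == i)%:R * p a = p i.
  by rewrite (bigD1 i) //= eqxx mul1r big1 ?addr0 // => j ji; rewrite (negbTE ji) mul0r.
under [X in _ = X + _]eq_bigr => i _ do rewrite E3 !mul0r !addr0 mul0r subr0.
under [X in _ = _ + (_ * (X - _ + _) + _)]eq_bigr => i _ do rewrite mulNr -mulrA.
under [X in _ = _ + (_ + _ * (X - _ + _))]eq_bigr => i _ do rewrite mulrDl mulN1r -mulrA.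
rewrite big_split /= !sumrN -mulr_sumr.
under [X in X + _ + _ = _]eq_bigr => i _ do rewrite mulrBl.
under [X in _ = X + _]eq_bigr => i _ do rewrite mulrDl.
rewrite sumrB big_split /= -mulr_sumr.
have -> : \sum_(i < n) l1 * cmap c y 0 i * p i = e * l1 * \sum_(i < n) cmap c y 0 i * p i.
  by rewrite mulr_sumr; apply: eq_bigr => i _; rewrite {1}l1E; ring.
rewrite -/p.
move: (\sum_(i < n) cmap c y 0 i * p i) (\sum_(i < n) p i) => X1 X2.
move: (\sum_(i < n) _) => X3.
(* The difference of the two sides carries the factor alpha - e alpha, which is zero on E. *)
apply/eqP; rewrite -subr_eq0; apply/eqP.
transitivity ((l1 - e * l1) * (g z - sco cz z * S)); first by ring.
by rewrite -l1E subrr mul0r.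
Qed.

Lemma framed_secL : framed (secL Z).
Proof.
rewrite secLE; apply: (@framed_of _ 1); rewrite ?mulr1 // => D _ x.
by rewrite mul1r.
Qed.

Lemma framed_secT : framed (secT Z).
Proof.
rewrite secTE; apply: (@framed_of _ 0) => [|D []//|D ED D1|D [ED D1] x]; first by rewrite mulr0.
  by split=> // z; rewrite D1 mul0r.
by rewrite mul0r /lin D1.
Qed.

End Algebroids.

(** * Schouten brackets *)

Section Det3.
Context {R : realType}.

Definition i30 : 'I_3 := ord0.
Definition i31 : 'I_3 := lift ord0 ord0.
Definition i32 : 'I_3 := lift ord0 (lift ord0 ord0).
Definition i20 : 'I_2 := ord0.
Definition i21 : 'I_2 := lift ord0 ord0.

Lemma ord3P (P : 'I_3 -> Prop) : P i30 -> P i31 -> P i32 -> forall i, P i.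
Proof.
move=> P0 P1 P2 [[|[|[|//]]] Hi].
- by rewrite (_ : Ordinal _ = i30) //; exact: val_inj.
- by rewrite (_ : Ordinal _ = i31) //; exact: val_inj.
- by rewrite (_ : Ordinal _ = i32) //; exact: val_inj.
Qed.

Lemma ord2P (P : 'I_2 -> Prop) : P i20 -> P i21 -> forall i, P i.
Proof.
move=> P0 P1 [[|[|//]] Hi].
- by rewrite (_ : Ordinal _ = i20) //; exact: val_inj.
- by rewrite (_ : Ordinal _ = i21) //; exact: val_inj.
Qed.

(** Indices in nat let the minors reduce by computation; [det_ord2] and [det_ord3] return to
    ordinals through [inord]. *)
Lemma det_nat2 (f : nat -> nat -> R) :
  \det (\matrix_(i < 2, j < 2) f i j) = f 0%N 0%N * f 1%N 1%N - f 0%N 1%N * f 1%N 0%N.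
Proof.
rewrite (expand_det_row _ ord0) !big_ord_recl big_ord0 /cofactor !det_mx11 !mxE /=.
by rewrite /bump /=; ring.
Qed.

Lemma det_nat3 (f : nat -> nat -> R) :
  \det (\matrix_(i < 3, j < 3) f i j) =
    f 0%N 0%N * (f 1%N 1%N * f 2%N 2%N - f 1%N 2%N * f 2%N 1%N)
  - f 0%N 1%N * (f 1%N 0%N * f 2%N 2%N - f 1%N 2%N * f 2%N 0%N)
  + f 0%N 2%N * (f 1%N 0%N * f 2%N 1%N - f 1%N 1%N * f 2%N 0%N).
Proof.
rewrite (expand_det_row _ ord0) !big_ord_recl big_ord0 /cofactor.
have E (j : 'I_3) : \det (row' ord0 (col' j (\matrix_(i < 3, j < 3) f i j))) =
    f 1%N (bump j 0) * f 2%N (bump j 1) - f 1%N (bump j 1) * f 2%N (bump j 0).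
  rewrite -(det_nat2 (fun i k => f i.+1 (bump j k))); congr (\det _).
  by apply/matrixP => i k; rewrite !mxE.
by rewrite !E !mxE /= /bump /=; ring.
Qed.

Lemma det_ord2 (m : 'I_2 -> 'I_2 -> R) :
  \det (\matrix_(i < 2, j < 2) m i j) = m i20 i20 * m i21 i21 - m i20 i21 * m i21 i20.
Proof.
have -> : \matrix_(i < 2, j < 2) m i j =
    \matrix_(i < 2, j < 2) (fun i j => m (inord i) (inord j)) i j.
  by apply/matrixP => i j; rewrite !mxE !inord_val.
rewrite (det_nat2 (fun i j => m (inord i) (inord j))).
have -> : inord 0 = i20 by apply: val_inj; rewrite /= inordK.
by have -> : inord 1 = i21 by apply: val_inj; rewrite /= inordK.
Qed.

Lemma det_ord3 (m : 'I_3 -> 'I_3 -> R) :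
  \det (\matrix_(i < 3, j < 3) m i j) =
    m i30 i30 * (m i31 i31 * m i32 i32 - m i31 i32 * m i32 i31)
  - m i30 i31 * (m i31 i30 * m i32 i32 - m i31 i32 * m i32 i30)
  + m i30 i32 * (m i31 i30 * m i32 i31 - m i31 i31 * m i32 i30).
Proof.
have -> : \matrix_(i < 3, j < 3) m i j =
    \matrix_(i < 3, j < 3) (fun i j => m (inord i) (inord j)) i j.
  by apply/matrixP => i j; rewrite !mxE !inord_val.
rewrite (det_nat3 (fun i j => m (inord i) (inord j))).
have -> : inord 0 = i30 by apply: val_inj; rewrite /= inordK.
have -> : inord 1 = i31 by apply: val_inj; rewrite /= inordK.
by have -> : inord 2 = i32 by apply: val_inj; rewrite /= inordK.
Qed.

Definition perms3 : seq 'S_3 :=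
  [:: 1%g; tperm i31 i32; (tperm i30 i31 * tperm i30 i32)%g; tperm i30 i31;
      (tperm i30 i32 * tperm i30 i31)%g; tperm i30 i32].

Definition perm3_values (s : 'S_3) := [:: s i30; s i31; s i32].

Lemma perms3_values : map perm3_values perms3 =
  [:: [:: i30; i31; i32]; [:: i30; i32; i31]; [:: i31; i32; i30];
      [:: i31; i30; i32]; [:: i32; i30; i31]; [:: i32; i31; i30]].
Proof.
by rewrite /perms3 /= /perm3_values !permM !perm1 !permE.
Qed.

(** The six permutations have distinct lists of values, and 'S_3 has 3! elements. *)
Lemma perms3P : perm_eq (index_enum 'S_3) perms3.
Proof.
have u : uniq perms3 by apply: (@map_uniq _ _ perm3_values); rewrite perms3_values.
apply: uniq_perm => //; first exact: index_enum_uniq.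
have [] := @uniq_min_size _ perms3 (index_enum 'S_3) u.
- by move=> s _; rewrite mem_index_enum.
- rewrite -(card_uniqP (index_enum_uniq _)); apply: leq_trans (max_card _) _.
  by rewrite card_Sn.
by move=> _ E s; rewrite E.
Qed.

Lemma sum_perm3 (F : 'I_3 -> 'I_3 -> 'I_3 -> R) :
  \sum_(s : 'S_3) (-1) ^+ s * F (s i30) (s i31) (s i32) =
    F i30 i31 i32 - F i30 i32 i31 + F i31 i32 i30 - F i31 i30 i32
    + F i32 i30 i31 - F i32 i31 i30.
Proof.
rewrite (perm_big _ perms3P) /perms3 !big_cons big_nil.
have := perms3_values; rewrite /perms3 /= /perm3_values.
move=> [-> -> ->] [-> -> ->] [-> -> ->] [-> -> ->] [-> -> ->] [-> -> ->].
rewrite !odd_permM odd_perm1 !odd_tperm /= expr0 expr1; ring.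
Qed.

End Det3.

(** * Bivectors over an algebroid E inside L~Z *)

Section Algebra.
Context {R : realType} {n : nat} {M : manifold R n} {Z : AVbundle M}.
Context {E : set (op Z)}.
Context (EEL : E `<=` EL).
Context (Ecomb : forall f D f' D', Cinf f -> Cinf f' -> E D -> E D' ->
  E (op_comb f D f' D')).
Context (Ecomm : forall D D', E D -> E D' -> E (commutator D D')).
Context (Eframe : framed E).
Implicit Types (x y : M) (D : op Z) (h : M -> R) (sigma : M -> Z) (a b : dform Z).

Local Notation jetE := (jet E).

Lemma jetP sigma D : E D -> jetE sigma D = act D sigma.
Proof. by move=> ED; rewrite /jet patchE mem_set. Qed.

Lemma jet_out sigma D : ~ E D -> jetE sigma D = cst 0.
Proof. by move=> ED; rewrite /jet patchE memNset. Qed.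

Lemma jet_dual sigma : Sec sigma -> dual_sec E (jetE sigma).
Proof.
move=> Hs; split=> [D ED|D nED|f D f' D' sf sf' ED ED' x].
- by rewrite jetP //; exact: Cinf_act (EEL ED) Hs.
- exact: jet_out.
- by rewrite !jetP //; [exact: act_comb|exact: Ecomb].
Qed.

(* The 1-jet of [h], as a section of the dual bundle. *)
Definition dlin h : dform Z := patch (cst 0) E (fun D => lin D h).

Lemma dlinP h D : E D -> dlin h D = lin D h.
Proof. by move=> ED; rewrite /dlin patchE mem_set. Qed.

Lemma dlin_out h D : ~ E D -> dlin h D = cst 0.
Proof. by move=> ED; rewrite /dlin patchE memNset. Qed.

Lemma dlin_dual h : Cinf h -> dual_sec E (dlin h).
Proof.
move=> sh; split=> [D ED|D nED|f D f' D' sf sf' ED ED' x].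
- by rewrite dlinP //; exact: Cinf_lin (EEL ED) sh.
- exact: dlin_out.
- by rewrite !dlinP //; [exact: lin_comb|exact: Ecomb].
Qed.

Definition dcomb (f : M -> R) a (f' : M -> R) b : dform Z :=
  fun D y => f y * a D y + f' y * b D y.

Lemma jet_sec_add sigma h : Sec sigma -> Cinf h ->
  jetE (sec_add sigma h) = dcomb (cst 1) (jetE sigma) (cst 1) (dlin h).
Proof.
move=> Hs sh; apply/funext => D; apply/funext => y; rewrite /dcomb !mul1r.
have [ED|nED] := pselect (E D); last by rewrite !jet_out // dlin_out //= addr0.
by rewrite !jetP // dlinP // act_add //; exact: EEL.
Qed.

Lemma dual_comb f a f' b : Cinf f -> Cinf f' -> dual_sec E a -> dual_sec E b ->
  dual_sec E (dcomb f a f' b).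
Proof.
move=> sf sf' [a1 a2 a3] [b1 b2 b3]; split=> [D ED|D nED|g D g' D' sg sg' ED ED' x].
- by apply: CinfD; apply: CinfM => //; [exact: a1|exact: b1].
- by apply/funext => y; rewrite /dcomb a2 // b2 //= !mulr0 addr0.
- by rewrite /dcomb a3 // b3 //; ring.
Qed.

Section Dual.
Context {a : dform Z} (da : dual_sec E a).

(** Linearity over functions forces locality: for a cutoff chi supported in U, chi D - chi D' is the
    zero operator, written 0 D + 0 D so that linearity applies to it as well. *)
Lemma dual_local D D' (U : set M) x : open U -> U x -> E D -> E D' ->
  (forall g z, Cinf g -> U (zeta z) -> D g z = D' g z) -> a D x = a D' x.
Proof.
move=> oU Ux ED ED' DD'; have [_ _ a3] := da.
have [chi [schi chi1 supp]] := cutoff_ex oU Ux.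
have z0 : Cinf (cst 0 : M -> R) := Cinf_cst 0.
have e : op_comb chi D (fun y => - chi y) D' = op_comb (cst 0) D (cst 0) D.
  apply/funext => g; apply/funext => z; rewrite /op_comb /= !mul0r addr0.
  have [sg|ng] := pselect (Cinf g); last first.
    have [[_ c1] _ _ _] := EEL ED; have [[_ c2] _ _ _] := EEL ED'.
    by rewrite c1 // c2 //= !mulr0 addr0.
  have [Uz|/nbhs_singleton ->] := supp (zeta z); last by rewrite oppr0 !mul0r addr0.
  by rewrite DD' // mulNr subrr.
have := a3 chi D (fun y => - chi y) D' schi (CinfN schi) ED ED' x.
rewrite e a3 // (nbhs_singleton chi1) !mul0r addr0 mul1r mulN1r => /esym /eqP.
by rewrite subr_eq0 => /eqP.
Qed.

Definition op_sum (K : finType) (f : K -> M -> R) (Dk : K -> op Z) (r : seq K) : op Z :=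
  fun g z => \sum_(k <- r) f k (zeta z) * Dk k g z.

(** [D] provides the empty sum, as the combination 0 D + 0 D in E. *)
Lemma op_sumP (K : finType) (f : K -> M -> R) (Dk : K -> op Z) (r : seq K) D :
  E D -> (forall k, Cinf (f k)) -> (forall k, E (Dk k)) ->
  E (op_sum f Dk r) /\ forall x, a (op_sum f Dk r) x = \sum_(k <- r) f k x * a (Dk k) x.
Proof.
move=> ED sf EDk; have [_ _ a3] := da.
have c0 : Cinf (cst 0 : M -> R) := Cinf_cst 0.
have c1 : Cinf (cst 1 : M -> R) := Cinf_cst 1.
elim: r => [|k r [IH1 IH2]].
  have -> : op_sum f Dk [::] = op_comb (cst 0) D (cst 0) D.
    apply/funext => g; apply/funext => z.
    by rewrite /op_sum /op_comb big_nil /= !mul0r addr0.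
  split=> [|x]; first exact: Ecomb.
  by rewrite a3 // big_nil !mul0r addr0.
have -> : op_sum f Dk (k :: r) = op_comb (f k) (Dk k) (cst 1) (op_sum f Dk r).
  apply/funext => g; apply/funext => z.
  by rewrite /op_sum /op_comb big_cons /= mul1r.
split=> [|x]; first exact: Ecomb.
by rewrite a3 // big_cons IH2 mul1r.
Qed.

End Dual.

Definition frame_at (U : set M) (K : finType) (s : K -> M -> Z) (Dk : K -> op Z) :=
  [/\ open U, forall k, Sec (s k), forall k, E (Dk k) &
      forall D, E D -> forall g, Cinf g -> forall z, U (zeta z) ->
        D g z = \sum_k act D (s k) (zeta z) * Dk k g z].

(** The coefficients of D in the frame are the values D(s_k), so applying a to the expansion of D
    expands a in the jets of the s_k. *)
Lemma dual_expand U K s Dk a D x : @frame_at U K s Dk -> dual_sec E a -> E D -> U x ->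
  a D x = \sum_k a (Dk k) x * jetE (s k) D x.
Proof.
move=> [oU Hs EDk fr] da ED Ux.
have [ES aS] := op_sumP da (index_enum K) ED (fun k => Cinf_act (EEL ED) (Hs k)) EDk.
rewrite (dual_local da oU Ux ED ES); last by move=> g z sg Uz; rewrite fr.
by rewrite aS; apply: eq_bigr => k _; rewrite jetP // mulrC.
Qed.

Section Bivector.
Context {P : multi Z 2} (HP : multisection E P).

Definition pair2 a b : 'I_2 -> dform Z := fun i => if i == ord0 then a else b.

Definition P2 a b : M -> R := P (pair2 a b).

Lemma P2E theta : P theta = P2 (theta i20) (theta i21).
Proof. by congr P; apply/funext; apply: ord2P. Qed.

Lemma pair2_dual a b : dual_sec E a -> dual_sec E b -> dual_secs E (pair2 a b).
Proof. by move=> da db; apply: ord2P. Qed.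

Lemma Cinf_P2 a b : dual_sec E a -> dual_sec E b -> Cinf (P2 a b).
Proof. by move=> da db; case: HP => + _ _; apply; exact: pair2_dual. Qed.

Lemma P2_combl f a f' a' b x : Cinf f -> Cinf f' ->
  dual_sec E a -> dual_sec E a' -> dual_sec E b ->
  P2 (dcomb f a f' a') b x = f x * P2 a b x + f' x * P2 a' b x.
Proof.
move=> sf sf' da da' db; have [_ H _] := HP.
have := H (pair2 a b) i20 f a f' a' (pair2_dual da db) sf sf' da da' x.
have e c : ([eta pair2 a b with i20 |-> c] : 'I_2 -> dform Z) = pair2 c b.
  by apply/funext; apply: ord2P.
by rewrite !e.
Qed.

Lemma P2_combr f a f' a' b x : Cinf f -> Cinf f' ->
  dual_sec E a -> dual_sec E a' -> dual_sec E b ->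
  P2 b (dcomb f a f' a') x = f x * P2 b a x + f' x * P2 b a' x.
Proof.
move=> sf sf' da da' db; have [_ H _] := HP.
have := H (pair2 b a) i21 f a f' a' (pair2_dual db da) sf sf' da da' x.
have e c : ([eta pair2 b a with i21 |-> c] : 'I_2 -> dform Z) = pair2 b c.
  by apply/funext; apply: ord2P.
by rewrite !e.
Qed.

Lemma P2_alt a x : dual_sec E a -> P2 a a x = 0.
Proof.
move=> da; have [_ _ H] := HP.
by rewrite /P2 (H _ i20 i21) //; exact: pair2_dual.
Qed.

Lemma P2_skew a b x : dual_sec E a -> dual_sec E b -> P2 a b x = - P2 b a x.
Proof.
move=> da db; have c1 : Cinf (cst 1 : M -> R) := Cinf_cst 1.
have := P2_alt x (dual_comb c1 c1 da db).
rewrite P2_combl ?P2_combr //; try exact: dual_comb.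
rewrite !P2_alt // !mul1r add0r addr0 => /eqP.
by rewrite addrC addr_eq0 => /eqP ->; rewrite opprK.
Qed.

Definition dsum (K : finType) (f : K -> M -> R) (ak : K -> dform Z) (r : seq K) : dform Z :=
  fun D y => \sum_(k <- r) f k y * ak k D y.

Lemma P2_suml (K : finType) (f : K -> M -> R) (ak : K -> dform Z) (r : seq K) b :
  (forall k, Cinf (f k)) -> (forall k, dual_sec E (ak k)) -> dual_sec E b ->
  dual_sec E (dsum f ak r) /\
  forall x, P2 (dsum f ak r) b x = \sum_(k <- r) f k x * P2 (ak k) b x.
Proof.
move=> sf dak db.
have c0 : Cinf (cst 0 : M -> R) := Cinf_cst 0.
have c1 : Cinf (cst 1 : M -> R) := Cinf_cst 1.
elim: r => [|k r [IH1 IH2]].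
  have -> : dsum f ak [::] = dcomb (cst 0) b (cst 0) b.
    by apply/funext => D; apply/funext => y; rewrite /dsum /dcomb big_nil !mul0r addr0.
  split=> [|x]; first exact: dual_comb.
  by rewrite P2_combl // big_nil !mul0r addr0.
have -> : dsum f ak (k :: r) = dcomb (f k) (ak k) (cst 1) (dsum f ak r).
  by apply/funext => D; apply/funext => y; rewrite /dsum /dcomb big_cons mul1r.
split=> [|x]; first exact: dual_comb.
by rewrite P2_combl // big_cons IH2 mul1r.
Qed.

(** The expansion of a in jets holds over U, whereas linearity of P applies to identities between
    forms on all of M. Multiplying by a cutoff equal to 1 near x turns the first into the second. *)
Lemma P2_expandl U K s Dk a b x : @frame_at U K s Dk -> dual_sec E a ->
  dual_sec E b -> U x -> P2 a b x = \sum_k a (Dk k) x * P2 (jetE (s k)) b x.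
Proof.
move=> fr da db Ux; have [oU Hs EDk _] := fr.
have [chi [schi chi1 supp]] := cutoff_ex oU Ux.
have c0 : Cinf (cst 0 : M -> R) := Cinf_cst 0.
have [aS a0 _] := da.
have sf k : Cinf (chi \* a (Dk k)) by apply: CinfM => //; exact: aS.
have e : dcomb chi a (cst 0) a =
    dsum (fun k => chi \* a (Dk k)) (fun k => jetE (s k)) (index_enum K).
  apply/funext => D; apply/funext => y; rewrite /dcomb /dsum /= mul0r addr0.
  under eq_bigr do rewrite -mulrA; rewrite -mulr_sumr.
  have [Uy|/nbhs_singleton ->] := supp y; last by rewrite !mul0r.
  have [ED|nED] := pselect (E D); first by rewrite -(dual_expand fr da ED Uy).
  rewrite a0 //= big1 // => k _.
  by rewrite jet_out //= mulr0.
have := P2_combl x schi c0 da da db; rewrite e mul0r addr0 (nbhs_singleton chi1) mul1r => <-.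
have [_ ->] := P2_suml (index_enum K) sf (fun k => jet_dual (Hs k)) db.
by apply: eq_bigr => k _; rewrite /= (nbhs_singleton chi1) mul1r.
Qed.

Lemma P2_expandr U K s Dk a b x : @frame_at U K s Dk -> dual_sec E a ->
  dual_sec E b -> U x -> P2 b a x = \sum_k a (Dk k) x * P2 b (jetE (s k)) x.
Proof.
move=> fr da db Ux; have [_ Hs _ _] := fr.
rewrite P2_skew // (P2_expandl fr) // -sumrN; apply: eq_bigr => k _.
by rewrite [in RHS]P2_skew ?mulrN //; exact: jet_dual.
Qed.

Lemma wedge2E (X : seq (op Z)) (theta : 'I_2 -> dform Z) x : wedge_sec X theta x =
  theta i20 (nth (fun _ => cst 0) X 0) x * theta i21 (nth (fun _ => cst 0) X 1) x
  - theta i20 (nth (fun _ => cst 0) X 1) x * theta i21 (nth (fun _ => cst 0) X 0) x.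
Proof. by rewrite /wedge_sec (det_ord2 (fun i j => theta i (nth _ X j) x)). Qed.

Lemma decomposition_ex x : exists U (s : seq (2.-tuple (op Z))),
  [/\ open U, U x & decomposition_on E U P s].
Proof.
have [U [K [s [Dk [oU Ux Hs EDk fr]]]]] := Eframe x.
have frU : @frame_at U K s Dk by split.
(* P is half the sum of P(s_k, s_l) D_k /\ D_l over all ordered pairs, since each wedge occurs
   twice. A decomposition carries no scalars, so the coefficient goes into the first factor. *)
pose pk (k : K * K) : M -> R := fun y => 2^-1 * P2 (jetE (s k.1)) (jetE (s k.2)) y.
have spk k : Cinf (pk k).
  apply: CinfM; first exact: Cinf_cst.
  by apply: Cinf_P2; exact: jet_dual.
have c0 : Cinf (cst 0 : M -> R) := Cinf_cst 0.
pose X (k : K * K) : 2.-tuple (op Z) :=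
  [tuple op_comb (pk k) (Dk k.1) (cst 0) (Dk k.1); Dk k.2].
exists U, (map X (index_enum (K * K)%type)); split=> //; split.
  move=> Y i /mapP[k _ ->]; move: i; apply: ord2P => /=.
    by rewrite (tnth_nth (fun _ => cst 0)) /=; exact: Ecomb.
  by rewrite (tnth_nth (fun _ => cst 0)) /=.
move=> theta dth y Uy; rewrite big_map P2E.
have d0 := dth i20; have d1 := dth i21.
rewrite (P2_expandl frU d0 d1 Uy).
under [LHS]eq_bigr => k _ do
  rewrite (P2_expandr frU d1 (jet_dual (Hs k)) Uy) mulr_sumr.
rewrite pair_bigA /=.
pose q (k : K * K) := theta i20 (Dk k.1) y * (theta i21 (Dk k.2) y *
   P2 (jetE (s k.1)) (jetE (s k.2)) y).
rewrite -[LHS]/(\sum_k q k).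
have sym : \sum_k q k = \sum_k q (k.2, k.1).
  by rewrite (reindex_inj (h := fun k : K * K => (k.2, k.1))) //= => -[? ?] [? ?] [-> ->].
have half : \sum_k q k = 2^-1 * (\sum_k q k + \sum_k q (k.2, k.1)).
  by rewrite -sym; field.
rewrite half -big_split mulr_sumr /=; apply: eq_bigr => k _.
rewrite wedge2E /=; have [_ _ t0] := d0; have [_ _ t1] := d1.
rewrite t0 // t1 // /pk /q /= !mul0r !addr0.
rewrite (P2_skew y (jet_dual (Hs k.2)) (jet_dual (Hs k.1))); ring.
Qed.

Definition tri a b c : 'I_3 -> dform Z :=
  fun i => if i == i30 then a else if i == i31 then b else c.

Lemma triE (theta : 'I_3 -> dform Z) : theta = tri (theta i30) (theta i31) (theta i32).
Proof. by apply/funext; apply: ord3P. Qed.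

Lemma tri_dual a b c : dual_sec E a -> dual_sec E b -> dual_sec E c ->
  dual_secs E (tri a b c).
Proof. by move=> da db dc; apply: ord3P. Qed.

Definition wedge3 a b c D0 D1 D2 x : R :=
    a D0 x * (b D1 x * c D2 x - b D2 x * c D1 x)
  - a D1 x * (b D0 x * c D2 x - b D2 x * c D0 x)
  + a D2 x * (b D0 x * c D1 x - b D1 x * c D0 x).

Lemma wedge3E (X : seq (op Z)) a b c x : wedge_sec X (tri a b c) x =
  wedge3 a b c (nth (fun _ => cst 0) X 0) (nth (fun _ => cst 0) X 1)
    (nth (fun _ => cst 0) X 2) x.
Proof. by rewrite /wedge_sec (det_ord3 (fun i j => tri a b c i (nth _ X j) x)). Qed.

Lemma schouten_wedgeE (X Y : 2.-tuple (op Z)) a b c x :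
  schouten_wedge X Y (tri a b c) x =
    wedge3 a b c (commutator (tnth X i20) (tnth Y i20)) (tnth X i21) (tnth Y i21) x
  - wedge3 a b c (commutator (tnth X i20) (tnth Y i21)) (tnth X i21) (tnth Y i20) x
  - wedge3 a b c (commutator (tnth X i21) (tnth Y i20)) (tnth X i20) (tnth Y i21) x
  + wedge3 a b c (commutator (tnth X i21) (tnth Y i21)) (tnth X i20) (tnth Y i20) x.
Proof.
case: X => [[|X0 [|X1 []]] //= HX]; case: Y => [[|Y0 [|Y1 []]] //= HY].
rewrite /schouten_wedge !big_ord_recl !big_ord0 !wedge3E !(tnth_nth (fun _ => cst 0)) /=.
rewrite /bump /=; ring.
Qed.

(* The variables stand for [a i = X_i(s)], [b j = Y_j(s)], [u i j = X_i(Y_j(s))],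
   [v j i = Y_j(X_i(s))], [al i = X_i(1)] and [be j = Y_j(1)]. *)
Lemma schouten_identity (T : Type) (a0 a1 b0 b1 u00 u01 u10 u11 v00 v01 v10 v11 : T -> R)
    (al0 al1 be0 be1 : R) (p q r : T) :
  let d3 A B C := A p * (B q * C r - C q * B r) - B p * (A q * C r - C q * A r)
    + C p * (A q * B r - B q * A r) in
  let lie w0 w1 c0 c1 al i j := (c0 i * w1 j + c1 j * w0 i - c0 i * c1 j * al)
    - (c1 i * w0 j + c0 j * w1 i - c1 i * c0 j * al) in
  let K c0 c1 d0 d1 w00 w01 w10 w11 al0 al1 i j k : R :=
    c0 i * lie w10 w11 d0 d1 al1 j k - c1 i * lie w00 w01 d0 d1 al0 j k
    - (al0 * c1 i - al1 * c0 i) * (d0 j * d1 k - d1 j * d0 k) in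
  let K3 c0 c1 d0 d1 w00 w01 w10 w11 al0 al1 :=
    K c0 c1 d0 d1 w00 w01 w10 w11 al0 al1 p q r
    + K c0 c1 d0 d1 w00 w01 w10 w11 al0 al1 q r p
    + K c0 c1 d0 d1 w00 w01 w10 w11 al0 al1 r p q in
  d3 (u00 \- v00) a1 b1 - d3 (u01 \- v10) a1 b0 - d3 (u10 \- v01) a0 b1
    + d3 (u11 \- v11) a0 b0 =
  K3 a0 a1 b0 b1 u00 u01 u10 u11 al0 al1 + K3 b0 b1 a0 a1 v00 v01 v10 v11 be0 be1.
Proof. by move=> /=; ring. Qed.

Definition act_wedge (Y : 2.-tuple (op Z)) sigma tau : M -> R := fun y =>
  act (tnth Y i20) sigma y * act (tnth Y i21) tau y
  - act (tnth Y i21) sigma y * act (tnth Y i20) tau y.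

(** The share of X_0 /\ X_1 and Y_0 /\ Y_1 in P(s1, {s2, s3}) - P(phi, s1) {s2, s3}, where phi is D
    |-> D(1): the outer P is expanded along X and the bracket along Y. *)
Definition jac_term (X Y : 2.-tuple (op Z)) s1 s2 s3 x : R :=
    act (tnth X i20) s1 x * lin (tnth X i21) (act_wedge Y s2 s3) x
  - act (tnth X i21) s1 x * lin (tnth X i20) (act_wedge Y s2 s3) x
  - (lin (tnth X i20) (cst 1) x * act (tnth X i21) s1 x
     - lin (tnth X i21) (cst 1) x * act (tnth X i20) s1 x) * act_wedge Y s2 s3 x.

Definition jac_term3 X Y s1 s2 s3 x : R :=
  jac_term X Y s1 s2 s3 x + jac_term X Y s2 s3 s1 x + jac_term X Y s3 s1 s2 x.

Lemma Cinf_act_wedge (Y : 2.-tuple (op Z)) sigma tau : (forall i, E (tnth Y i)) ->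
  Sec sigma -> Sec tau -> Cinf (act_wedge Y sigma tau).
Proof.
move=> EY Hs Ht.
by apply: CinfB; apply: CinfM; apply: Cinf_act => //; exact: EEL.
Qed.

Lemma lin_act_wedge D (Y : 2.-tuple (op Z)) sigma tau x : E D ->
  (forall i, E (tnth Y i)) -> Sec sigma -> Sec tau ->
  lin D (act_wedge Y sigma tau) x =
   (act (tnth Y i20) sigma x * lin D (act (tnth Y i21) tau) x
     + act (tnth Y i21) tau x * lin D (act (tnth Y i20) sigma) x
     - act (tnth Y i20) sigma x * act (tnth Y i21) tau x * lin D (cst 1) x)
   - (act (tnth Y i21) sigma x * lin D (act (tnth Y i20) tau) x
     + act (tnth Y i20) tau x * lin D (act (tnth Y i21) sigma) x
     - act (tnth Y i21) sigma x * act (tnth Y i20) tau x * lin D (cst 1) x).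
Proof.
move=> ED EY Hs Ht; have LD := EEL ED.
have cA i rho : Sec rho -> Cinf (act (tnth Y i) rho).
  by move=> Hr; apply: Cinf_act => //; exact: EEL.
have -> : act_wedge Y sigma tau = (fun y =>
    1 * (act (tnth Y i20) sigma \* act (tnth Y i21) tau) y
    + (-1) * (act (tnth Y i21) sigma \* act (tnth Y i20) tau) y).
  by apply/funext => y; rewrite mul1r mulN1r.
rewrite (lin_linear LD); [|by apply: CinfM; exact: cA|by apply: CinfM; exact: cA].
by rewrite !(linM LD) ?mul1r ?mulN1r //; exact: cA.
Qed.

(** A commutator acts by X_i^(Y_j(s)) - Y_j^(X_i(s)). The first halves belong to the terms where X
    differentiates the wedge Y, the second to those with the roles exchanged; after the Leibniz rule
    a polynomial identity remains. *)
Lemma schouten_wedge_jets (X Y : 2.-tuple (op Z)) s1 s2 s3 x :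
  (forall i, E (tnth X i)) -> (forall i, E (tnth Y i)) ->
  Sec s1 -> Sec s2 -> Sec s3 ->
  schouten_wedge X Y (tri (jetE s1) (jetE s2) (jetE s3)) x =
  jac_term3 X Y s1 s2 s3 x + jac_term3 Y X s1 s2 s3 x.
Proof.
move=> EX EY H1 H2 H3.
(* Indexing the sections by 'I_3 presents each symbol as a function on three points, the form of
   [schouten_identity]. *)
pose s (i : 'I_3) : M -> Z := if i == i30 then s1 else if i == i31 then s2 else s3.
have Hs i : Sec (s i) by move: i; apply: ord3P.
pose ac (D : op Z) (i : 'I_3) := act D (s i) x.
pose li (D D' : op Z) (i : 'I_3) := lin D (act D' (s i)) x.
have := schouten_identity (ac (tnth X i20)) (ac (tnth X i21))
  (ac (tnth Y i20)) (ac (tnth Y i21))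
  (li (tnth X i20) (tnth Y i20)) (li (tnth X i20) (tnth Y i21))
  (li (tnth X i21) (tnth Y i20)) (li (tnth X i21) (tnth Y i21))
  (li (tnth Y i20) (tnth X i20)) (li (tnth Y i20) (tnth X i21))
  (li (tnth Y i21) (tnth X i20)) (li (tnth Y i21) (tnth X i21))
  (lin (tnth X i20) (cst 1) x) (lin (tnth X i21) (cst 1) x)
  (lin (tnth Y i20) (cst 1) x) (lin (tnth Y i21) (cst 1) x) i30 i31 i32.
rewrite /ac /li /= => Id.
rewrite schouten_wedgeE /wedge3 !jetP //; try exact: Ecomm.
rewrite !act_commutator //; try exact: EEL.
by rewrite /jac_term3 /jac_term !lin_act_wedge.
Qed.

(** The trivector i_phi P /\ P for the form phi : D |-> D(1), which is phi^0 on L~Z and zero on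
    T~Z. *)
Definition phi_multi a b c x : R :=
  P2 (dlin (cst 1)) a x * P2 b c x + P2 (dlin (cst 1)) b x * P2 c a x
  + P2 (dlin (cst 1)) c x * P2 a b x.

Section Decomposed.
Context {U : set M} {x : M} (oU : open U) (Ux : U x).

Lemma P2_decomposition (s : seq (2.-tuple (op Z))) a b : decomposition_on E U P s ->
  dual_sec E a -> dual_sec E b -> forall y, U y ->
  P2 a b y = \sum_(X <- s) (a (tnth X i20) y * b (tnth X i21) y
    - a (tnth X i21) y * b (tnth X i20) y).
Proof.
move=> [_ sP] da db y Uy; rewrite /P2 (sP _ (pair2_dual da db) y Uy).
by apply: eq_bigr => X _; rewrite wedge2E !(tnth_nth (fun _ => cst 0)).
Qed.

Definition jac s1 s2 s3 : R :=
    P2 (jetE s1) (dlin (P2 (jetE s2) (jetE s3))) x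
  + P2 (jetE s2) (dlin (P2 (jetE s3) (jetE s1))) x
  + P2 (jetE s3) (dlin (P2 (jetE s1) (jetE s2))) x.

Lemma sum_jac_term (s t : seq (2.-tuple (op Z))) s1 s2 s3 :
  decomposition_on E U P s -> decomposition_on E U P t ->
  Sec s1 -> Sec s2 -> Sec s3 ->
  \sum_(X <- s) \sum_(Y <- t) jac_term X Y s1 s2 s3 x =
  P2 (jetE s1) (dlin (P2 (jetE s2) (jetE s3))) x
  - P2 (dlin (cst 1)) (jetE s1) x * P2 (jetE s2) (jetE s3) x.
Proof.
move=> ds dt H1 H2 H3.
have c1 : Cinf (cst 1 : M -> R) := Cinf_cst 1.
have cB := Cinf_P2 (jet_dual H2) (jet_dual H3).
have Es := ds.1; have Et := dt.1.
have BE y : U y -> P2 (jetE s2) (jetE s3) y = \sum_(Y <- t) act_wedge Y s2 s3 y.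
  move=> Uy; rewrite (P2_decomposition dt (jet_dual H2) (jet_dual H3) Uy).
  by apply: eq_big_seq => Y Yt; rewrite !jetP //; exact: Et.
rewrite (P2_decomposition ds (jet_dual H1) (dlin_dual cB) Ux).
rewrite (P2_decomposition ds (dlin_dual c1) (jet_dual H1) Ux).
rewrite BE // mulr_suml; apply: etrans (sumrB _ _ _ _); apply: eq_big_seq => X Xs.
have EX i : E (tnth X i) by exact: Es.
rewrite !dlinP // !jetP //.
have linB D : E D -> lin D (P2 (jetE s2) (jetE s3)) x =
    \sum_(Y <- t) lin D (act_wedge Y s2 s3) x.
  (* Tuples outside t may consist of arbitrary operators; putting 0 there makes the whole family
     smooth, as [lin_sum] requires. *)
  move=> ED; pose w Y := if Y \in t then act_wedge Y s2 s3 else cst 0.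
  have cw Y : Cinf (w Y).
    rewrite /w; case: ifP => [Yt|_]; last exact: Cinf_cst.
    by apply: Cinf_act_wedge => // i; exact: Et.
  transitivity (lin D (fun y => \sum_(Y <- t) w Y y) x).
    (* The bracket is known as a sum of wedges on U only; U being open, this determines the germ
       that [lin D] differentiates. *)
    apply: (lin_local (EEL ED)) => //; first exact: Cinf_sum.
    have := open_nbhs_nbhs (conj oU Ux); apply: filterS => y Uy.
    by rewrite BE //; apply: eq_big_seq => Y Yt; rewrite /w Yt.
  rewrite (lin_sum (EEL ED)) //; apply: eq_big_seq => Y Yt.
  by rewrite /w Yt.
rewrite !linB // !mulr_sumr -!sumrB; apply: eq_bigr => Y _.
by rewrite /jac_term.
Qed.

(** The terms with X outside and those with Y outside sum to the same value, whence the factor 2.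
    Since s and t are arbitrary, the value on jets does not depend on the decompositions. *)
Lemma schouten_jets (s t : seq (2.-tuple (op Z))) s1 s2 s3 :
  decomposition_on E U P s -> decomposition_on E U P t ->
  Sec s1 -> Sec s2 -> Sec s3 ->
  \sum_(X <- s) \sum_(Y <- t) schouten_wedge X Y (tri (jetE s1) (jetE s2) (jetE s3)) x
  = (jac s1 s2 s3 - phi_multi (jetE s1) (jetE s2) (jetE s3) x) *+ 2.
Proof.
move=> ds dt H1 H2 H3; have Es := ds.1; have Et := dt.1.
transitivity (\sum_(X <- s) \sum_(Y <- t)
    (jac_term3 X Y s1 s2 s3 x + jac_term3 Y X s1 s2 s3 x)).
  apply: eq_big_seq => X Xs; apply: eq_big_seq => Y Yt.
  by apply: schouten_wedge_jets => // i; [exact: Es|exact: Et].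
have sum3 s' t' : decomposition_on E U P s' -> decomposition_on E U P t' ->
    \sum_(X <- s') \sum_(Y <- t') jac_term3 X Y s1 s2 s3 x =
    jac s1 s2 s3 - phi_multi (jetE s1) (jetE s2) (jetE s3) x.
  move=> ds' dt'; rewrite /jac_term3.
  under eq_bigr do rewrite 2!big_split /=.
  rewrite 2!big_split /=.
  rewrite (sum_jac_term ds' dt' H1 H2 H3) (sum_jac_term ds' dt' H2 H3 H1).
  by rewrite (sum_jac_term ds' dt' H3 H1 H2) /jac /phi_multi; ring.
under eq_bigr do rewrite big_split /=.
rewrite big_split /= sum3 // [X in _ + X]exchange_big /= sum3 //.
Qed.

End Decomposed.
(** [decomposition_ex] makes the set in [schouten] nonempty, so the chosen value does come from a
    pair of decompositions. *)
Lemma schouten_decomposed theta x : exists U (s t : seq (2.-tuple (op Z))),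
  [/\ open U, U x, decomposition_on E U P s, decomposition_on E U P t &
      schouten E P P theta x = \sum_(X <- s) \sum_(Y <- t) schouten_wedge X Y theta x].
Proof.
rewrite /schouten; case: xgetP => [r _ [U [s [t [oU Ux ds dt ->]]]]|H].
  by exists U, s, t.
have [U [s [oU Ux ds]]] := decomposition_ex x.
by case: (H (\sum_(X <- s) \sum_(Y <- s) schouten_wedge X Y theta x)); exists U, s, s.
Qed.

Lemma contractionE phi (theta : 'I_1 -> dform Z) :
  Defs.contraction phi P theta = P2 phi (theta ord0).
Proof.
rewrite /Defs.contraction P2E; congr P2; first by rewrite unlift_none.
by rewrite /i21 liftK.
Qed.

(** The six permutations fall into pairs that agree by skewness of P, which cancels the
    normalization 2! 1!. *)
Lemma multi_wedge_contractionr phi (theta : 'I_3 -> dform Z) x : dual_secs E theta ->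
  multi_wedge P (Defs.contraction phi P) theta x =
    P2 phi (theta i30) x * P2 (theta i31) (theta i32) x
  + P2 phi (theta i31) x * P2 (theta i32) (theta i30) x
  + P2 phi (theta i32) x * P2 (theta i30) (theta i31) x.
Proof.
move=> dth; rewrite /multi_wedge.
under eq_bigr do rewrite P2E contractionE -mulrA.
have e0 : lshift 1 i20 = i30 by exact: val_inj.
have e1 : lshift 1 i21 = i31 by exact: val_inj.
have e2 : rshift 2 (ord0 : 'I_1) = i32 by exact: val_inj.
rewrite e0 e1 e2.
rewrite (sum_perm3 (fun i j k => P2 (theta i) (theta j) x * P2 phi (theta k) x)).
rewrite (P2_skew x (dth i32) (dth i31)) (P2_skew x (dth i30) (dth i32)).
rewrite (P2_skew x (dth i31) (dth i30)).
have -> : (2`! * 1`!)%:R = 2 :> R by [].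
by field.
Qed.

Lemma multi_wedge_contractionl phi (theta : 'I_3 -> dform Z) x : dual_secs E theta ->
  multi_wedge (Defs.contraction phi P) P (theta : 'I_(1 + 2) -> dform Z) x =
    P2 phi (theta i30) x * P2 (theta i31) (theta i32) x
  + P2 phi (theta i31) x * P2 (theta i32) (theta i30) x
  + P2 phi (theta i32) x * P2 (theta i30) (theta i31) x.
Proof.
move=> dth; rewrite /multi_wedge.
under eq_bigr do rewrite P2E contractionE -mulrA.
have e0 : lshift 2 (ord0 : 'I_1) = i30 by exact: val_inj.
have e1 : rshift 1 i20 = i31 by exact: val_inj.
have e2 : rshift 1 i21 = i32 by exact: val_inj.
rewrite e0 e1 e2.
rewrite (sum_perm3 (fun i j k => P2 phi (theta i) x * P2 (theta j) (theta k) x)).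
rewrite (P2_skew x (dth i32) (dth i31)) (P2_skew x (dth i30) (dth i32)).
rewrite (P2_skew x (dth i31) (dth i30)).
have -> : (1`! * 2`!)%:R = 2 :> R by [].
by field.
Qed.

Lemma wedge3_cycle a b c D0 D1 D2 x :
  wedge3 a b c D0 D1 D2 x = wedge3 b c a D0 D1 D2 x.
Proof. by rewrite /wedge3; ring. Qed.

Lemma wedge3_suml (K : finType) (f : K -> R) (ak : K -> dform Z) a b c D0 D1 D2 x :
  (forall D, E D -> a D x = \sum_k f k * ak k D x) -> E D0 -> E D1 -> E D2 ->
  wedge3 a b c D0 D1 D2 x = \sum_k f k * wedge3 (ak k) b c D0 D1 D2 x.
Proof.
move=> H E0 E1 E2; rewrite /wedge3 !H // !mulr_suml -sumrB -big_split /=.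
by apply: eq_bigr => k _; ring.
Qed.

Section Trilinear.
Context {U : set M} {x : M} (oU : open U) (Ux : U x) {s t : seq (2.-tuple (op Z))}.
Context (ds : decomposition_on E U P s) (dt : decomposition_on E U P t).

(** The value at x of [[P, P]] + 2 i_phi P /\ P for fixed decompositions. None of the forms is
    differentiated in it, so linearity over functions is plain algebra; on jets it is twice the
    Jacobiator. *)
Definition trivalue a b c : R :=
  \sum_(X <- s) \sum_(Y <- t) schouten_wedge X Y (tri a b c) x + phi_multi a b c x *+ 2.

(** Reduces expansion in all three slots to expansion in the first. *)
Lemma trivalue_cycle a b c : trivalue a b c = trivalue b c a.
Proof.
rewrite /trivalue; congr (_ + _ *+ 2); last by rewrite /phi_multi; ring.
apply: eq_bigr => X _; apply: eq_bigr => Y _.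
by rewrite !schouten_wedgeE !(wedge3_cycle a).
Qed.

Lemma trivalue_expand W K sk Dk a b c : @frame_at W K sk Dk -> W x ->
  dual_sec E a -> dual_sec E b -> dual_sec E c ->
  trivalue a b c = \sum_k a (Dk k) x * trivalue (jetE (sk k)) b c.
Proof.
move=> fr Wx da db dc.
have d1 : dual_sec E (dlin (cst 1)) by apply: dlin_dual; exact: Cinf_cst.
have aE D : E D -> a D x = \sum_k a (Dk k) x * jetE (sk k) D x.
  by move=> ED; exact: dual_expand fr da ED Wx.
have phiE : phi_multi a b c x = \sum_k a (Dk k) x * phi_multi (jetE (sk k)) b c x.
  rewrite /phi_multi (P2_expandr fr da d1 Wx) (P2_expandr fr da dc Wx).
  rewrite (P2_expandl fr da db Wx) !mulr_suml !mulr_sumr -!big_split /=.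
  by apply: eq_bigr => k _; ring.
have sumE : \sum_(X <- s) \sum_(Y <- t) schouten_wedge X Y (tri a b c) x =
    \sum_k a (Dk k) x * \sum_(X <- s) \sum_(Y <- t)
      schouten_wedge X Y (tri (jetE (sk k)) b c) x.
  under [RHS]eq_bigr do rewrite mulr_sumr.
  rewrite [RHS]exchange_big /=; apply: eq_big_seq => X Xs.
  under [RHS]eq_bigr do rewrite mulr_sumr.
  rewrite [RHS]exchange_big /=; apply: eq_big_seq => Y Yt.
  have EX i : E (tnth X i) by exact: ds.1.
  have EY i : E (tnth Y i) by exact: dt.1.
  rewrite schouten_wedgeE !(wedge3_suml (f := fun k => a (Dk k) x)
    (ak := fun k => jetE (sk k)) _ _ aE) //; try exact: Ecomm.
  rewrite -!sumrB -big_split /=; apply: eq_bigr => k _.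
  by rewrite schouten_wedgeE; ring.
rewrite /trivalue sumE phiE -sumrMnl -big_split /=; apply: eq_bigr => k _.
by ring.
Qed.

Lemma trivalue_jets s1 s2 s3 : Sec s1 -> Sec s2 -> Sec s3 ->
  trivalue (jetE s1) (jetE s2) (jetE s3) = @jac x s1 s2 s3 *+ 2.
Proof.
move=> H1 H2 H3; rewrite /trivalue (schouten_jets oU Ux ds dt) //.
by rewrite -mulrnDl subrK.
Qed.

Lemma trivalue0 : (forall s1 s2 s3, Sec s1 -> Sec s2 -> Sec s3 -> @jac x s1 s2 s3 = 0) ->
  forall a b c, dual_sec E a -> dual_sec E b -> dual_sec E c -> trivalue a b c = 0.
Proof.
move=> H a b c da db dc.
have [W [K [sk [Dk [oW Wx Hs EDk frD]]]]] := Eframe x.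
have fr : @frame_at W K sk Dk by split.
rewrite (trivalue_expand fr) // big1 // => k _; rewrite trivalue_cycle.
rewrite (trivalue_expand fr) //; last exact: jet_dual.
rewrite big1 ?mulr0 // => l _; rewrite trivalue_cycle.
rewrite (trivalue_expand fr) //; try exact: jet_dual.
rewrite big1 ?mulr0 // => m _.
by rewrite trivalue_jets // H // mul0rn mulr0.
Qed.

End Trilinear.

Lemma schouten_jacP :
  (forall theta : 'I_3 -> dform Z, dual_secs E theta -> forall x,
     schouten E P P theta x + phi_multi (theta i30) (theta i31) (theta i32) x *+ 2 = 0)
  <-> (forall s1 s2 s3, Sec s1 -> Sec s2 -> Sec s3 -> forall x, @jac x s1 s2 s3 = 0).
Proof.
split=> [H s1 s2 s3 H1 H2 H3 x|H theta dth x].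
  have dj := tri_dual (jet_dual H1) (jet_dual H2) (jet_dual H3).
  have := H _ dj x.
  have [U [s [t [oU Ux ds dt ->]]]] := schouten_decomposed (tri (jetE s1) (jetE s2) (jetE s3)) x.
  have := trivalue_jets oU Ux ds dt H1 H2 H3; rewrite /trivalue => -> /eqP.
  by rewrite mulrn_eq0 /= => /eqP.
have [U [s [t [oU Ux ds dt ->]]]] := schouten_decomposed theta x.
have := trivalue0 oU Ux ds dt (fun s1 s2 s3 H1 H2 H3 => H s1 s2 s3 H1 H2 H3 x)
  (dth i30) (dth i31) (dth i32).
by rewrite /trivalue -triE.
Qed.

Lemma dlin_comb f (k : R) h (l : R) : Cinf f -> Cinf h ->
  dlin (fun y => k * f y + l * h y) = dcomb (cst k) (dlin f) (cst l) (dlin h).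
Proof.
move=> sf sh; apply/funext => D; apply/funext => y; rewrite /dcomb.
have [ED|nED] := pselect (E D); last by rewrite !dlin_out //= !mulr0 addr0.
by rewrite !dlinP // (lin_linear (EEL ED)).
Qed.

Lemma dlinM f h : Cinf f -> Cinf h -> dlin (f \* h) =
  dcomb (cst 1) (dcomb f (dlin h) h (dlin f)) (fun y => - (f y * h y)) (dlin (cst 1)).
Proof.
move=> sf sh; apply/funext => D; apply/funext => y; rewrite /dcomb.
have [ED|nED] := pselect (E D); last by rewrite !dlin_out //= !mulr0 !addr0 mulr0.
by rewrite !dlinP // (linM (EEL ED)) // mul1r mulNr.
Qed.

Section Hamiltonian.
Context {a : dform Z} (da : dual_sec E a).

Lemma P2_dlin_linear : linear_operator (fun h => P2 a (dlin h)).
Proof.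
split=> [f sf|k l f h sf sh x]; first by apply: Cinf_P2 => //; exact: dlin_dual.
by rewrite dlin_comb // P2_combr //; do ?[exact: Cinf_cst|exact: dlin_dual].
Qed.

Lemma P2_dlinM f h x : Cinf f -> Cinf h -> P2 a (dlin (f \* h)) x =
  f x * P2 a (dlin h) x + h x * P2 a (dlin f) x - f x * h x * P2 a (dlin (cst 1)) x.
Proof.
move=> sf sh; have c1 : Cinf (cst 1 : M -> R) := Cinf_cst 1.
have df := dlin_dual sf; have dh := dlin_dual sh; have d1 := dlin_dual c1.
rewrite dlinM // P2_combr //; last 2 first.
- exact: CinfN (CinfM sf sh).
- exact: dual_comb.
by rewrite P2_combr // mul1r mulNr.
Qed.

Lemma P2_diffop1 : diffop1 (fun h => P2 a (dlin h)).
Proof.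
split=> [|f g h sf sg sh x]; first exact: P2_dlin_linear.
by rewrite !P2_dlinM //=; [ring|exact: CinfM].
Qed.

(** Writing the zero form as 0 a + 0 a lets linearity of P give the value 0. *)
Lemma dlin1_0 : (forall D, E D -> forall x, lin D (cst 1) x = 0) ->
  dlin (cst 1) = dcomb (cst 0) a (cst 0) a.
Proof.
move=> E1; apply/funext => D; apply/funext => y; rewrite /dcomb !mul0r addr0.
have [ED|nED] := pselect (E D); last by rewrite dlin_out.
by rewrite dlinP // E1.
Qed.

Lemma P2_dlin1_0 : (forall D, E D -> forall x, lin D (cst 1) x = 0) ->
  forall x, P2 a (dlin (cst 1)) x = 0 /\ P2 (dlin (cst 1)) a x = 0.
Proof.
move=> E1 x; have c0 : Cinf (cst 0 : M -> R) := Cinf_cst 0.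
by rewrite dlin1_0 // P2_combr // P2_combl // !mul0r addr0.
Qed.

Lemma P2_derivation : (forall D, E D -> forall x, lin D (cst 1) x = 0) ->
  derivation (fun h => P2 a (dlin h)).
Proof.
move=> E1; split=> [|f h sf sh x]; first exact: P2_dlin_linear.
by rewrite P2_dlinM // (P2_dlin1_0 E1 x).1; ring.
Qed.

End Hamiltonian.

Lemma induced_sec_add s1 s2 h x : Sec s1 -> Sec s2 -> Cinf h ->
  P2 (jetE s1) (jetE (sec_add s2 h)) x =
  P2 (jetE s1) (jetE s2) x + P2 (jetE s1) (dlin h) x.
Proof.
move=> H1 H2 sh; rewrite jet_sec_add // P2_combr ?mul1r //;
  do ?[exact: Cinf_cst|exact: jet_dual|exact: dlin_dual].
Qed.

(** Affinity and skewness hold for the bracket of every bivector, and A concerns only the operators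
    h |-> P(a, [dlin h]); the Jacobi identity is the one condition left. *)
Lemma aff_bracketP (A : set ((M -> R) -> M -> R)) :
  (forall a, dual_sec E a -> A (fun h => P2 a (dlin h))) ->
  aff_bracket A (induced_bracket E P) <->
  forall s1 s2 s3, Sec s1 -> Sec s2 -> Sec s3 -> forall x, @jac x s1 s2 s3 = 0.
Proof.
move=> HA.
have -> : induced_bracket E P = (fun s1 s2 => P2 (jetE s1) (jetE s2)).
  by apply/funext => s1; apply/funext => s2; rewrite /induced_bracket P2E.
(* The linear part of {s1, .} is h |-> P(jet of s1, [dlin h]), so the auxiliary section s drops
   out. *)
have brE s s1 s2 s3 x : Sec s -> Sec s1 -> Sec s2 -> Sec s3 ->
    br_v (fun s1 s2 => P2 (jetE s1) (jetE s2)) s s1 (P2 (jetE s2) (jetE s3)) x =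
    P2 (jetE s1) (dlin (P2 (jetE s2) (jetE s3))) x.
  move=> Hs H1 H2 H3; rewrite /br_v induced_sec_add //.
    by rewrite addrC addKr.
  by apply: Cinf_P2; exact: jet_dual.
have aff (B : set ((M -> R) -> M -> R)) s1 : Sec s1 ->
    B (fun h => P2 (jetE s1) (dlin h)) ->
    affine_with B (fun s2 => P2 (jetE s1) (jetE s2)).
  move=> H1 HB; split=> [s2 H2|]; first by apply: Cinf_P2; exact: jet_dual.
  by exists (fun h => P2 (jetE s1) (dlin h)) => // s2 h H2 sh x; exact: induced_sec_add.
split=> [[_ _ _ H _] s1 s2 s3 H1 H2 H3 x|H].
  have [s Hs] := @Sec_ex _ _ _ Z.
  by have := H s s1 s2 s3 Hs H1 H2 H3 x; rewrite !brE.
split.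
- by move=> s1 H1; apply: aff => //; apply: P2_dlin_linear; exact: jet_dual.
- move=> s2 H2; split=> [s1 H1|]; first by apply: Cinf_P2; exact: jet_dual.
  have dj := jet_dual H2.
  exists (fun h x => - P2 (jetE s2) (dlin h) x).
    have [L1 L2] := P2_dlin_linear dj; split=> [h sh|k l f h sf sh x].
      by apply: CinfN; exact: L1.
    by rewrite L2 //; ring.
  move=> s1 h H1 sh x /=; rewrite P2_skew //; last first.
    by apply: jet_dual; exact: Sec_add.
  rewrite induced_sec_add // opprD; congr (_ + _).
  by rewrite -P2_skew //; exact: jet_dual.
- by move=> s1 s2 H1 H2 x; apply: P2_skew; exact: jet_dual.
- by move=> s s1 s2 s3 Hs H1 H2 H3 x; rewrite !brE //; exact: H.
- by move=> s1 H1; apply: aff => //; apply: HA; exact: jet_dual.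
Qed.

End Bivector.
End Algebra.

(** * Specialization to T~Z and L~Z *)

Section Main.
Context {R : realType} {n : nat} {M : manifold R n} (Z : AVbundle M).

Lemma lin_secT (D : op Z) : secT Z D -> forall x, lin D (cst 1) x = 0.
Proof. by rewrite secTE => -[_ D1] x; rewrite /lin -[cst 1 \o _]/(cst 1) D1. Qed.

Lemma phi0_dlin : phi0 Z = dlin (E := secL Z) (cst 1).
Proof.
apply/funext => D; apply/funext => x; rewrite /dlin patchE.
have [LD|nLD] := pselect (secL Z D); last by rewrite /phi0 patchE memNset.
by rewrite mem_set // phi0E // -secLE.
Qed.

End Main.

Theorem theorem24 (R : realType) (n : nat) (M : manifold R n) (Z : AVbundle M) :
  (forall Lambda : multi Z 2, multisection (secT Z) Lambda ->
     aff_Poisson (induced_bracket (secT Z) Lambda) <->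
     multi_zero (secT Z) (schouten (secT Z) Lambda Lambda)) /\
  (forall J : multi Z 2, multisection (secL Z) J ->
     aff_Jacobi (induced_bracket (secL Z) J) <->
     multi_zero (secL Z)
       (schouten_jacobi (secL Z) (phi0 Z) J J)).
Proof.
have EL_T : secT Z `<=` EL by rewrite secTE => D [].
have EL_L : secL Z `<=` EL by rewrite secLE.
have combT (f : M -> R) (D : op Z) (f' : M -> R) (D' : op Z) : Cinf f -> Cinf f' ->
  secT Z D -> secT Z D' -> secT Z (op_comb f D f' D') by rewrite secTE; exact: ET_comb.
have combL (f : M -> R) (D : op Z) (f' : M -> R) (D' : op Z) : Cinf f -> Cinf f' ->
  secL Z D -> secL Z D' -> secL Z (op_comb f D f' D') by rewrite secLE; exact: EL_comb.
have commT (D D' : op Z) : secT Z D -> secT Z D' -> secT Z (commutator D D').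
  by rewrite secTE; exact: ET_commutator.
have commL (D D' : op Z) : secL Z D -> secL Z D' -> secL Z (commutator D D').
  by rewrite secLE; exact: EL_commutator.
split=> P HP.
- apply: iff_trans (aff_bracketP EL_T combT HP (A := @derivation _ _ M) _) _.
    by move=> a da; apply: P2_derivation => // D; exact: lin_secT.
  apply: iff_trans (iff_sym (schouten_jacP EL_T combT commT (@framed_secT _ _ _ Z) HP)) _.
  (* On T~Z the form D |-> D(1) is zero, so the correction disappears and the plain bracket
     remains. *)
  have phi_multi0 (theta : 'I_3 -> dform Z) x : dual_secs (secT Z) theta ->
      phi_multi (E := secT Z) (P := P) (theta i30) (theta i31) (theta i32) x = 0.
    move=> dth; have p0 i : P2 (P := P) (dlin (E := secT Z) (cst 1)) (theta i) x = 0.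
      by have [_ ->] := P2_dlin1_0 HP (dth i) (@lin_secT _ _ _ Z) x.
    by rewrite /phi_multi !p0 !mul0r !addr0.
  split=> H theta dth x; have := H theta dth x; rewrite phi_multi0 // mul0rn addr0 //.
- apply: iff_trans (aff_bracketP EL_L combL HP (A := @diffop1 _ _ M) _) _.
    by move=> a da; exact: P2_diffop1.
  apply: iff_trans (iff_sym (schouten_jacP EL_L combL commL (@framed_secL _ _ _ Z) HP)) _.
  (* In degree 2 the corrections are P /\ i_phi P and, with sign -(-1) = +1, i_phi P /\ P. Both
     equal the same cyclic sum, whence twice [phi_multi]. *)
  have E theta x : dual_secs (secL Z) theta ->
      schouten_jacobi (secL Z) (phi0 Z) P P theta x = schouten (secL Z) P P theta x
        + phi_multi (E := secL Z) (P := P) (theta i30) (theta i31) (theta i32) x *+ 2.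
    move=> dth; rewrite /schouten_jacobi phi0_dlin.
    (* The cast between the index types of sizes (1 + 1).+1 and 1 + 2 is the identity on values. *)
    have -> : theta \o cast_ord (addnS 1 1) = theta.
      by apply/funext => i /=; congr theta; exact: val_inj.
    rewrite (multi_wedge_contractionr HP) //.
    rewrite (multi_wedge_contractionl HP) //.
    by rewrite /phi_multi; ring.
  split=> H theta dth x; have := H theta dth x; first by rewrite E.
  by rewrite E.
Qed.
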